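(* (Stochastic Fubini theorem.) Let $T>0$, let $H$ and $G$ be separable Hilbert spaces, let $M$ be a cylindrical orthogonal martingale-valued measure on $H$ satisfying the standing assumptions in the context, let $(E,\mathscr E,\varrho)$ be a $\sigma$-finite measure space, and let $\Phi\in\Lambda^{1,2}(M,T,E)$. Then: (i) For a.e. $(\omega,r,u)\in\Omega\times[0,T]\times U$, the mapping $E\ni e\mapsto\Phi(\omega,r,u,e)\in\mathcal{HS}(H_{Q_M},G)$ is Bochner integrable. Moreover $$\int_E\Phi(\cdot,\cdot,\cdot,e)\,\varrho(de)=\Bigl\{\int_E\Phi(\omega,r,u,e)\,\varrho(de):\omega\in\Omega,r\in[0,T],u\in U\Bigr\}\in\Lambda^2(M,T).$$ (ii) The mapping $E\ni e\mapsto\int_0^\cdot\!\int_U\Phi(r,u,e)\,M(dr,du)\in\mathcal M_T^2(G)$ is Bochner integrable. Furthermore, for all $t\in[0,T]$, $$\Bigl(\int_E\Bigl(\int_0^\cdot\!\int_U\Phi(r,u,e)\,M(dr,du)\Bigr)\varrho(de)\Bigr)_t=\int_E\Bigl(\int_0^t\!\int_U\Phi(r,u,e)\,M(dr,du)\Bigr)\varrho(de).$$ (iii) $\mathbb P$-a.e., for all $t\in[0,T]$, $$\int_0^t\!\int_U\Bigl(\int_E\Phi(r,u,e)\,\varrho(de)\Bigr)M(dr,du)=\int_E\Bigl(\int_0^t\!\int_U\Phi(r,u,e)\,M(dr,du)\Bigr)\varrho(de).$$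
   Context: $(\Omega,\mathcal F,\mathbb P)$ is a complete probability space with a filtration $(\mathcal F_t)_{t\ge0}$ satisfying the usual conditions; $\mathcal P_T$ is the predictable $\sigma$-algebra on $\Omega\times[0,T]$. $U$ is a Hausdorff space homeomorphic to a Borel subset of $\mathbb R$, and $\mathcal A$ is a ring of Borel subsets of $U$. For square integrable real martingales, $\langle Y,Z\rangle$ is the predictable quadratic covariation and $\langle Y\rangle=\langle Y,Y\rangle$. $\mathcal{HS}(H,G)$ is the space of Hilbert–Schmidt operators; $\mathcal M_T^2(G)$ is the space of $G$-valued càdlàg mean-zero square integrable martingales on $[0,T]$ with norm $(\sup_{t\le T}\mathbb E\|m(t)\|^2)^{1/2}$. A set function $N:\Omega\times\mathcal A\to\mathbb R$ is a $\sigma$-finite $L^2$-valued measure if: (1) $\mathbb E|N(A)|^2<\infty$; (2) $N(A\cup B)=N(A)+N(B)$ a.e. for disjoint $A,B\in\mathcal A$; (3) there are Borel $U_n\uparrow U$ with $\mathcal B(U_n)\subseteq\mathcal A$ and $\sup_{A\in\mathcal B(U_n)}\mathbb E|N(A)|^2<\infty$; (4) $\mathbb E|N(A_j)|^2\to0$ whenever $(A_j)\subseteq\mathcal B(U_n)$ decreases to $\emptyset$; (5) $N(A)$ is the $L^2$-limit of $N(A\cap U_n)$ for each $A\in\mathcal A$. A cylindrical orthogonal martingale-valued measure on $H$ is a family $M=(M(t,A):t\ge0,A\in\mathcal A)$ of linear maps $H\to L^0(\Omega,\mathcal F,\mathbb P)$, continuous for convergence in probability, with: $M(0,A)(h)=0$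 a.e.; $M(A)(h)=(M(t,A)(h))_{t\ge0}$ is a real càdlàg mean-zero square integrable martingale for each $A,h$; $M(t,\cdot)(h)$ is a $\sigma$-finite $L^2$-valued measure for each $t>0,h$; and $\langle M(A)(h),M(B)(h)\rangle_t=0$ for disjoint $A,B\in\mathcal A$. Write $M((s,t],A)=M(t,A)-M(s,A)$. A random measure is a map $\mu:\Omega\times\Sigma\to[0,\infty]$, measurable in $\omega$ and, for a.e. $\omega$, a measure on $\Sigma$; on $\mathcal B(\mathbb R_+)\otimes\mathcal B(U)$ it is predictable if $(\omega,t)\mapsto\mu(\omega)([0,t]\times B)$ is predictable for every $B\in\mathcal B(U)$. The intensity measure $\nu_h$ ($h\in H$) is the unique predictable $\sigma$-finite random measure on $\mathcal B(\mathbb R_+)\otimes\mathcal B(U)$ with $\nu_h([0,t]\times A)=\langle M(A)(h)\rangle_t$ a.e. for all $t\ge0,A\in\mathcal A$. A quadratic variation of $M$ is a random measure $\eta$ on $\mathcal B(\mathbb R_+)\otimes\mathcal B(U)$ with $\eta([0,t]\times A)<\infty$ a.e. for all $t\ge0,A\in\mathcal A$, and which is minimal (for the order: $\eta(\omega)\le\zeta(\omega)$ for a.e. $\omega$) among all random measures $\zeta$ with $\nu_h\le\zeta$ for all $\|h\|=1$. Standing assumptions on $M$: $M$ has a unique quadratic variation $\langle\!\langle M\rangle\!\rangle$; the family $(\nu_h)$ has the sequential boundedness property (for $(h_n)$ dense in the unit sphere, $\|h\|=1$, $t>0$, there is a full-probability set on which $\nu_h((s,t]\times A)\le\sup_n\nu_{h_n}((s,t]\times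 A)$ for all $0\le s<t$, $A\in\mathcal A$); and $\sup_{A\in\mathcal A}\langle\!\langle M\rangle\!\rangle(\omega)([0,T]\times A)<\infty$ for a.e. $\omega$. Also, for each $h,k\in H$, $\frac14(\nu_{h+k}-\nu_{h-k})$ is a well-defined random signed measure on $\mathcal B([0,T])\otimes\mathcal B(U)$. Then $Q_M:\Omega\times[0,T]\times U\to\mathcal L(H,H)$ denotes the associated operator process: $(Q_M(\cdot)h,k)_H$ is $\mathcal P_T\otimes\mathcal B(U)$-measurable; for a.e. $\omega$, $Q_M(\omega,\cdot,\cdot)$ is positive, symmetric and of operator norm $1$, $\langle\!\langle M\rangle\!\rangle(\omega)$-a.e.; and for $h,k\in H$, a.e., $\int_C(Q_Mh,k)_H\,d\langle\!\langle M\rangle\!\rangle=\frac14(\nu_{h+k}(C)-\nu_{h-k}(C))$ for all $C\in\mathcal B([0,T])\otimes\mathcal B(U)$. The Doléans measure on $\mathcal P_T\otimes\mathcal B(U)$ is $\mu_M(C)=\mathbb E\int_{[0,T]\times U}\mathbf 1_C\,d\langle\!\langle M\rangle\!\rangle$; ''a.e. $(\omega,r,u)$'' means $\mu_M$-a.e. For fixed $(\omega,t,u)$, $H_{Q_M}=Q_M^{1/2}(H)$ with inner product $(Q_M^{-1/2}h,Q_M^{-1/2}g)_H$ ($Q_M^{-1/2}$ the pseudo-inverse). $\Lambda^2(M,T)$ is the space of families $\Phi(\omega,t,u)\in\mathcal{HS}(H_{Q_M},G)$ such that $\Phi\circ Q_M^{1/2}(h)$ is $\mathcal P_T\otimes\mathcal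 B(U)/\mathcal B(G)$-measurable for each $h\in H$ and $\|\Phi\|^2_{\Lambda^2(M,T)}=\int_{\Omega\times[0,T]\times U}\|\Phi\circ Q_M^{1/2}\|^2_{\mathcal{HS}(H,G)}d\mu_M<\infty$; elements at zero distance are identified. $\mathcal S(M,T)$ is the class of simple functions $\Phi(\omega,s,u)=\sum_{i=1}^n\sum_{j=1}^m\mathbf 1_{(s_i,t_i]}(s)\mathbf 1_{F_i}(\omega)\mathbf 1_{A_j}(u)S_{ij}$ with $0\le s_i\le t_i\le T$, $F_i\in\mathcal F_{s_i}$, $A_j\in\mathcal A$, $S_{ij}\in\mathcal{HS}(H,G)$. For such $\Phi$, $I_t(\Phi)=\sum_{i,j}\mathbf 1_{F_i}Y_{i,j}(t)$, where $Y_{i,j}$ is the $G$-valued càdlàg square integrable martingale with $(Y_{i,j}(t),g)_G=M((s_i\wedge t,t_i\wedge t],A_j)(S_{ij}^*g)$ a.e. for all $g\in G$. The stochastic integral $I(\Phi)=\int_0^\cdot\int_U\Phi(r,u)M(dr,du)$, $\Phi\in\Lambda^2(M,T)$, is the continuous linear extension $I:\Lambda^2(M,T)\to\mathcal M_T^2(G)$ of this map ($\mathcal S(M,T)$ is dense), which satisfies $\mathbb E\|I_t(\Phi)\|^2=\int_{\Omega\times[0,t]\times U}\|\Phi\circ Q_M^{1/2}\|^2_{\mathcal{HS}(H,G)}d\mu_M$. $\Lambda^{1,2}(M,T,E)$ is the space of families of operators $\Phi(\omega,t,u,e)$, $(\omega,t,u,e)\in\Omega\times[0,T]\times U\times E$,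 such that: (1) for each $(\omega,t,u,e)$, $\Phi(\omega,t,u,e)$ is a linear operator with values in $G$ whose domain contains $H_{Q_M}$ and whose restriction to $H_{Q_M}$ belongs to $\mathcal{HS}(H_{Q_M},G)$; (2) for all $h\in H$ and $g\in G$, the map $(\omega,t,u,e)\mapsto(\Phi(\omega,t,u,e)\circ Q_M^{1/2}(\omega,t,u)(h),g)_G$ is $\mathcal P_T\otimes\mathcal B(U)\otimes\mathscr E$-measurable; (3) $\int_E\|\Phi(\cdot,\cdot,\cdot,e)\|_{\Lambda^2(M,T)}\,\varrho(de)<\infty$. *)

(* Defs.v *)
From HB Require Import structures.
From mathcomp Require Import all_boot all_order all_algebra.
From mathcomp Require Import all_classical all_reals all_analysis.
From mathcomp Require Import measurable_realfun.

Set Implicit Arguments.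
Unset Strict Implicit.
Unset Printing Implicit Defensive.

Import Order.TTheory GRing.Theory Num.Theory.
Import numFieldNormedType.Exports.

Local Open Scope classical_set_scope.
Local Open Scope ring_scope.
Local Open Scope ereal_scope.

HB.mixin Record isHilbert (R : realType) H & CompleteNormedModule R H := {
  dot : H -> H -> R ;
  dotC : forall x y, dot x y = dot y x ;
  dotPl : forall (a : R) x y z,
    dot (a *: x + y)%R z = (a * dot x z + dot y z)%R ;
  dot_norm : forall x, dot x x = (`|x| ^+ 2)%R
}.

#[short(type="hilbertType")]
HB.structure Definition Hilbert (R : realType) :=
  {H of isHilbert R H & CompleteNormedModule R H}.

Definition separable (X : topologicalType) :=
  exists2 S : set X, countable S & dense S.

Notation borel X := (g_sigma_algebraType (@open X)).

Section hilbert_schmidt.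
Context {R : realType} {H G : hilbertType R}.

(* Orthonormal bases of the Hilbert space whose carrier is the subspace S
   and whose inner product is ip. *)
Definition orthonormal_basis (S : set H) (ip : H -> H -> R) : set (set H) :=
  [set B | [/\ B `<=` S,
     (forall x y, B x -> B y -> ip x y = (x == y)%:R) &
     (forall x, S x -> (forall b, B b -> ip x b = 0%R) -> x = 0%R)]].

(* The sum does not depend on the basis: the supremum is over equal values. *)
Definition hs_norm2 (S : set H) (ip : H -> H -> R) (L : H -> G) : \bar R :=
  ereal_sup [set \esum_(b in B) (`|L b| ^+ 2)%:E
            | B in orthonormal_basis S ip].

Definition hs_norm S ip L : \bar R := hs_norm2 S ip L `^ 2^-1.

(* Only the restriction of L to S is constrained. *)
Definition HS (S : set H) (ip : H -> H -> R) : set (H -> G) :=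
  [set L | [/\ (forall a x y, S x -> S y ->
                  L (a *: x + y)%R = (a *: L x + L y)%R),
     (exists c : R, forall x, S x -> (`|L x| ^+ 2 <= c * ip x x)%R) &
     hs_norm2 S ip L < +oo]].

Definition adjoint (L : H -> G) (g : G) : H :=
  xget 0%R [set k | forall h, dot (L h) g = dot h k].

End hilbert_schmidt.

Section square_root.
Context {R : realType} {H : hilbertType R}.

Definition op_norm (L : H -> H) : R :=
  sup [set `|L x|%R | x in [set x : H | (`|x| <= 1)%R]].

Definition symmetric_op (L : H -> H) := forall h k, dot (L h) k = dot h (L k).

Definition positive_op (L : H -> H) := forall h, (0 <= dot (L h) h)%R.

(* The square root is unique when it exists, that is, when L is bounded,
   symmetric and positive; otherwise psqrt L is 0. *)
Definition psqrt (L : H -> H) : H -> H :=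
  xget (fun=> 0%R) [set A | [/\ linear A, continuous A, symmetric_op A,
    positive_op A & A \o A = L]].

Definition pseudo_inverse (A : H -> H) (y : H) : H :=
  xget 0%R [set x | A x = y /\ forall z, A z = 0%R -> dot x z = 0%R].

Definition HQ (L : H -> H) : set H := range (psqrt L).

Definition dotQ (L : H -> H) (x y : H) : R :=
  dot (pseudo_inverse (psqrt L) x) (pseudo_inverse (psqrt L) y).

End square_root.

(* The values are in the subspace S of V, with the (semi)norm N on S, vectors
   at distance zero being identified: this covers Hilbert spaces, spaces of
   Hilbert-Schmidt operators, L^2 spaces and spaces of martingales. *)
Section bochner.
Context {R : realType} {V : lmodType R} {d} {E : measurableType d}.
Variables (rho : set E -> \bar R) (S : set V) (N : V -> \bar R).

Record bsimple := BSimple {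
  bs_size : nat ;
  bs_set : 'I_bs_size -> set E ;
  bs_val : 'I_bs_size -> V ;
  bs_measurable : forall i, measurable (bs_set i) ;
  bs_finite : forall i, rho (bs_set i) < +oo ;
  bs_mem : forall i, S (bs_val i) }.

Definition bs_fun (s : bsimple) (e : E) : V :=
  (\sum_(i < bs_size s) \1_(bs_set i) e *: bs_val i)%R.

Definition bs_int (s : bsimple) : V :=
  (\sum_(i < bs_size s) fine (rho (bs_set i)) *: bs_val i)%R.

Definition bochner_approx (f : E -> V) (s : nat -> bsimple) :=
  [/\ {ae rho, forall e, S (f e)},
      {ae rho, forall e, N (f e - bs_fun (s n) e)%R @[n --> \oo] --> 0} &
      \int[rho]_e N (f e - bs_fun (s n) e)%R @[n --> \oo] --> 0].

Definition bochner_integrable (f : E -> V) := exists s, bochner_approx f s.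

Definition is_bochner_integral (f : E -> V) (v : V) :=
  S v /\ exists s, bochner_approx f s /\
                   N (v - bs_int (s n))%R @[n --> \oo] --> 0.

(* A representative of the integral if f is integrable, 0 otherwise. *)
Definition bochner (f : E -> V) : V :=
  xget 0%R [set v | is_bochner_integral f v].

End bochner.

Section processes.
Context {R : realType} {d} {Omega : measurableType d}.
Variables (P : probability Omega R) (F : R -> set (set Omega)).

Definition usual_filtration :=
  [/\ (forall t, (0 <= t)%R ->
         sigma_algebra setT (F t) /\ F t `<=` measurable),
      (forall s t, (0 <= s <= t)%R -> F s `<=` F t),
      (forall t, (0 <= t)%R -> forall A,
         (forall s, (t < s)%R -> F s A) -> F t A) &
      (forall A, P.-negligible A -> F 0%R A)].

(* The trace on Omega x [0, T] of the predictable sigma-algebra below is the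
   predictable sigma-algebra on Omega x [0, T]. *)
Definition predictable_rectangles : set (set (Omega * R)) :=
  [set C | (exists2 A, F 0%R A & C = A `*` [set 0%R]) \/
     exists s t A, [/\ (0 <= s <= t)%R, F s A & C = A `*` `]s, t]%classic]].

Local Notation predictableType := (g_sigma_algebraType predictable_rectangles).

Definition cadlag (V : topologicalType) (J : set R) (f : R -> V) :=
  forall t, J t ->
    f @ within J (at_right t) --> f t /\
    exists l : V, f @ within J (at_left t) --> l.

Local Notation Rplus := [set t : R | (0 <= t)%R].

Definition martingale (X : R -> Omega -> R) :=
  [/\ (forall t, (0 <= t)%R -> forall B, measurable B -> F t (X t @^-1` B)),
      (forall t, (0 <= t)%R -> P.-integrable setT (EFin \o X t)) &
      (forall s t, (0 <= s <= t)%R -> forall A, F s A ->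
         \int[P]_(w in A) (X t w)%:E = \int[P]_(w in A) (X s w)%:E)].

Definition sq_int_martingale (X : R -> Omega -> R) :=
  martingale X /\ forall t, (0 <= t)%R -> \int[P]_w (X t w ^+ 2)%:E < +oo.

Definition mean_zero_cadlag (X : R -> Omega -> R) :=
  (forall t, (0 <= t)%R -> \int[P]_w (X t w)%:E = 0) /\
  {ae P, forall w, cadlag Rplus (X ^~ w)}.

(* V is a version of the predictable quadratic covariation <Y, Z>. *)
Definition is_covariation (Y Z V : R -> Omega -> R) :=
  [/\ measurable_fun (setT `*` Rplus : set predictableType)
        (fun x => V x.2 x.1),
      {ae P, forall w, V 0%R w = 0%R},
      {ae P, forall w, cadlag Rplus (V ^~ w)},
      {ae P, forall w t, (0 <= t)%R -> bounded_variation 0%R t (V ^~ w)} &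
      martingale (fun t w => Y t w * Z t w - V t w)%R].

Section hilbert_valued.
Context {G : hilbertType R}.

Definition expectation (X : Omega -> G) : G :=
  bochner P setT (fun v : G => `|v|%:E) X.

Definition L2 : set (Omega -> G) :=
  [set X | measurable_fun setT (X : Omega -> borel G) /\
           \int[P]_w (`|X w| ^+ 2)%:E < +oo].

Definition L2_norm (X : Omega -> G) : \bar R :=
  (\int[P]_w (`|X w| ^+ 2)%:E) `^ 2^-1.

Definition MT2_norm (T : R) (X : R -> Omega -> G) : \bar R :=
  ereal_sup [set \int[P]_w (`|X t w| ^+ 2)%:E | t in `[0%R, T]%classic]
    `^ 2^-1.

(* Processes are indexed by R; only their restriction to [0, T] matters. *)
Definition MT2 (T : R) : set (R -> Omega -> G) :=
  [set X | [/\
    (forall t, (0 <= t <= T)%R ->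
       forall B : set (borel G), measurable B -> F t (X t @^-1` B)),
    (forall s t, (0 <= s <= t)%R -> (t <= T)%R -> forall A, F s A ->
       expectation (fun w => \1_A w *: X t w)%R =
       expectation (fun w => \1_A w *: X s w)%R),
    (forall t, (0 <= t <= T)%R -> expectation (X t) = 0%R),
    {ae P, forall w, cadlag `[0%R, T]%classic (X ^~ w)} &
    MT2_norm T X < +oo]].

End hilbert_valued.

End processes.

Notation predictableType F := (g_sigma_algebraType (predictable_rectangles F)).

Section cylindrical.
Context {R : realType} {d} {Omega : measurableType d}.
Variables (P : probability Omega R) (F : R -> set (set Omega)).
Context {U : ptopologicalType}.
Variable calA : set (set U).

Definition homeomorphic_to_borel :=
  hausdorff_space U /\
  exists (f : U -> R) (g : R -> U), [/\ measurable (range f), cancel f g,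
    continuous f & {within range f, continuous g}].

Definition borel_ring :=
  setring calA /\ forall A, calA A -> measurable (A : set (borel U)).

Definition sigma_finite_L2_measure (N : set U -> Omega -> R) :=
  [/\ (forall A, calA A -> measurable_fun setT (N A) /\
         \int[P]_w (N A w ^+ 2)%:E < +oo),
      (forall A B, calA A -> calA B -> A `&` B = set0 ->
         {ae P, forall w, N (A `|` B) w = (N A w + N B w)%R}) &
      exists Un : nat -> set U, [/\
        (forall n, [/\ measurable (Un n : set (borel U)),
           Un n `<=` Un n.+1,
           (forall A : set (borel U), measurable A -> A `<=` Un n -> calA A) &
           ereal_sup [set \int[P]_w (N A w ^+ 2)%:E |
             A in [set A : set (borel U) | measurable A /\ A `<=` Un n]]
             < +oo]),
        \bigcup_n Un n = setT,
        (forall n (A : nat -> set (borel U)),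
           (forall j, measurable (A j) /\ A j `<=` Un n) ->
           (forall j, A j.+1 `<=` A j) -> \bigcap_j A j = set0 ->
           \int[P]_w (N (A j) w ^+ 2)%:E @[j --> \oo] --> 0) &
        (forall A, calA A ->
           \int[P]_w ((N A w - N (A `&` Un n) w) ^+ 2)%:E
             @[n --> \oo] --> 0)]].

Context {H : hilbertType R}.
Variable M : R -> set U -> H -> Omega -> R.

Definition cylindrical_omvm :=
  [/\ (forall t A, (0 <= t)%R -> calA A ->
         [/\ (forall h, measurable_fun setT (M t A h)),
             (forall (a : R) h k, {ae P, forall w,
                M t A (a *: h + k)%R w = (a * M t A h w + M t A k w)%R}) &
             (forall h0 (eps : R), (0 < eps)%R ->
                P [set w | (eps <= `|M t A h w - M t A h0 w|)%R]
                  @[h --> h0] --> 0)]),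
      (forall A h, calA A ->
         [/\ {ae P, forall w, M 0%R A h w = 0%R},
             sq_int_martingale P F (fun t => M t A h) &
             mean_zero_cadlag P (fun t => M t A h)]),
      (forall t h, (0 < t)%R ->
         sigma_finite_L2_measure (fun A => M t A h)) &
      (forall A B h, calA A -> calA B -> A `&` B = set0 ->
         is_covariation P F (fun t => M t A h) (fun t => M t B h)
           (fun _ _ => 0%R))].

(* Measures on R_+ x U are measures on R x U not charging ]-oo, 0[ x U. *)
Definition is_measure (m : set (R * borel U) -> \bar R) :=
  (exists m' : {measure set (R * borel U) -> \bar R},
     forall C, measurable C -> m C = m' C) /\
  m (`]-oo, 0%R[%classic `*` setT) = 0.

Definition random_measure (eta : Omega -> set (R * borel U) -> \bar R) :=
  [/\ (forall w C, measurable C -> 0 <= eta w C),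
      (forall C, measurable C -> measurable_fun setT (eta ^~ C)) &
      {ae P, forall w, is_measure (eta w)}].

Definition predictable_rm (eta : Omega -> set (R * borel U) -> \bar R) :=
  forall B : set (borel U), measurable B ->
    measurable_fun
      (setT `*` [set t : R | (0 <= t)%R] : set (predictableType F))
      (fun x => eta x.1 (`[0%R, x.2]%classic `*` B)).

Definition rm_le (eta zeta : Omega -> set (R * borel U) -> \bar R) :=
  {ae P, forall w C, measurable C -> eta w C <= zeta w C}.

Definition is_intensity (nu : H -> Omega -> set (R * borel U) -> \bar R) :=
  forall h, [/\ random_measure (nu h), predictable_rm (nu h),
    {ae P, forall w, sigma_finite setT (nu h w)} &
    forall A, calA A -> exists V,
      is_covariation P F (fun t => M t A h) (fun t => M t A h) V /\
      forall t, (0 <= t)%R ->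
        {ae P, forall w, nu h w (`[0%R, t]%classic `*` A) = (V t w)%:E}].

Variable nu : H -> Omega -> set (R * borel U) -> \bar R.

Definition dominates_unit (zeta : Omega -> set (R * borel U) -> \bar R) :=
  forall h, `|h|%R = 1%R -> rm_le (nu h) zeta.

Definition is_quadratic_variation
    (eta : Omega -> set (R * borel U) -> \bar R) :=
  [/\ random_measure eta,
      (forall t A, (0 <= t)%R -> calA A ->
         {ae P, forall w, eta w (`[0%R, t]%classic `*` A) < +oo}),
      dominates_unit eta &
      (forall zeta, random_measure zeta -> dominates_unit zeta ->
         rm_le zeta eta -> rm_le eta zeta)].

Definition is_unique_quadratic_variation
    (eta : Omega -> set (R * borel U) -> \bar R) :=
  is_quadratic_variation eta /\
  forall eta', is_quadratic_variation eta' ->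
    {ae P, forall w C, measurable C -> eta' w C = eta w C}.

Definition sequentially_bounded :=
  forall hn : nat -> H, (forall n, `|hn n|%R = 1%R) ->
    [set h | `|h|%R = 1%R] `<=` closure (range hn) ->
  forall h, `|h|%R = 1%R -> forall t, (0 < t)%R ->
    {ae P, forall w s A, (0 <= s < t)%R -> calA A ->
       nu h w (`]s, t]%classic `*` A) <=
       ereal_sup (range (fun n => nu (hn n) w (`]s, t]%classic `*` A)))}.

Variable T : R.

Definition polarization_signed_measure :=
  forall h k, {ae P, forall w,
    exists c : charge (R * borel U)%type R,
      forall C, measurable C -> C `<=` `[0%R, T]%classic `*` setT ->
        c C = (4^-1)%:E * (nu (h + k)%R w C - nu (h - k)%R w C)}.

Variable qv : Omega -> set (R * borel U) -> \bar R.

Definition bounded_qv :=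
  {ae P, forall w,
     ereal_sup [set qv w (`[0%R, T]%classic `*` A) | A in calA] < +oo}.

(* The trace on slab T of the product sigma-algebra is P_T (x) B(U). *)
Definition slab (t : R) : set (predictableType F * borel U) :=
  [set x | (0 <= (x.1 : Omega * R).2 <= t)%R].

Definition is_QM (Q : Omega * R * U -> H -> H) :=
  [/\ (forall x, slab T x -> linear (Q x) /\ continuous (Q x)),
      (forall h k, measurable_fun (slab T) (fun x => dot (Q x h) k)),
      {ae P, forall w, {ae qv w, forall z : R * borel U, (0 <= z.1 <= T)%R ->
         [/\ positive_op (Q (w, z.1, z.2)), symmetric_op (Q (w, z.1, z.2)) &
             op_norm (Q (w, z.1, z.2)) = 1%R]}} &
      (forall h k, {ae P, forall w C, measurable C ->
         C `<=` `[0%R, T]%classic `*` setT ->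
         \int[qv w]_(z in C) (dot (Q (w, z.1, z.2) h) k)%:E =
         (4^-1)%:E * (nu (h + k)%R w C - nu (h - k)%R w C)})].

Definition doleans (C : set (predictableType F * borel U)) : \bar R :=
  \int[P]_w \int[qv w]_(z in `[0%R, T]%classic `*` setT)
    (\1_C (w, z.1, z.2))%:E.

Variable Q : Omega * R * U -> H -> H.
Context {G : hilbertType R}.

Definition HSQ (x : Omega * R * U) : set (H -> G) := HS (HQ (Q x)) (dotQ (Q x)).

Definition HSQ_norm (x : Omega * R * U) (L : H -> G) : \bar R :=
  hs_norm (HQ (Q x)) (dotQ (Q x)) L.

Definition Lambda2_norm2 (t : R) (Phi : Omega * R * U -> H -> G) : \bar R :=
  \int[doleans]_(x in slab t) hs_norm2 setT dot (Phi x \o psqrt (Q x)).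

Definition Lambda2_norm (Phi : Omega * R * U -> H -> G) : \bar R :=
  Lambda2_norm2 T Phi `^ 2^-1.

(* An operator defined on a domain containing HQ (Q x) is represented by any
   function on H extending it; only its restriction to HQ (Q x) is used. *)
Definition Lambda2 : set (Omega * R * U -> H -> G) :=
  [set Phi | [/\ (forall x, slab T x -> HSQ x (Phi x)),
     (forall h, measurable_fun (slab T)
        ((fun x => Phi x (psqrt (Q x) h))
           : predictableType F * borel U -> borel G)) &
     Lambda2_norm2 T Phi < +oo]].

Definition simple_integrand n m (s t : 'I_n -> R) (B : 'I_n -> set Omega)
    (A : 'I_m -> set U) (L : 'I_n -> 'I_m -> H -> G) :
    Omega * R * U -> H -> G :=
  fun x h => (\sum_(i < n) \sum_(j < m)
    (\1_(`]s i, t i]%classic) x.1.2 * \1_(B i) x.1.1 * \1_(A j) x.2)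
      *: L i j h)%R.

(* The restriction to [0, T] of Y is a version of the martingale
   M((s /\ t, t0 /\ t], A) o L^*. *)
Definition is_elementary_integral (s t0 : R) (A : set U) (L : H -> G)
    (Y : R -> Omega -> G) :=
  MT2 P F T Y /\
  forall t, (0 <= t <= T)%R -> forall g, {ae P, forall w,
    dot (Y t w) g = (M (Num.min t0 t) A (adjoint L g) w
                     - M (Num.min s t) A (adjoint L g) w)%R}.

(* Elements of Lambda2 (resp. MT2) at zero distance are identified (resp.
   indistinguishable processes); the isometry gives continuity and
   compatibility with the identification in Lambda2. *)
Definition is_stochastic_integral
    (I : (Omega * R * U -> H -> G) -> R -> Omega -> G) :=
  [/\ (forall Phi, Lambda2 Phi -> MT2 P F T (I Phi)),
      (forall (a : R) Phi Psi, Lambda2 Phi -> Lambda2 Psi ->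
         {ae P, forall w t, (0 <= t <= T)%R ->
            I (a *: Phi + Psi)%R t w = (a *: I Phi t w + I Psi t w)%R}),
      (forall Phi t, Lambda2 Phi -> (0 <= t <= T)%R ->
         \int[P]_w (`|I Phi t w| ^+ 2)%:E = Lambda2_norm2 t Phi) &
      (forall n m (s t : 'I_n -> R) (B : 'I_n -> set Omega)
          (A : 'I_m -> set U) (L : 'I_n -> 'I_m -> H -> G),
         (forall i, [/\ (0 <= s i <= t i)%R, (t i <= T)%R & F (s i) (B i)]) ->
         (forall j, calA (A j)) ->
         (forall i j, HS setT dot (L i j)) ->
         exists Y : 'I_n -> 'I_m -> R -> Omega -> G,
           (forall i j,
              is_elementary_integral (s i) (t i) (A j) (L i j) (Y i j)) /\
           {ae P, forall w r, (0 <= r <= T)%R ->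
              I (simple_integrand s t B A L) r w =
              (\sum_(i < n) \sum_(j < m) \1_(B i) w *: Y i j r w)%R})].

Definition Lambda12 dE (E : measurableType dE) (rho : set E -> \bar R)
    (Phi : Omega * R * U -> E -> H -> G) :=
  [/\ (forall x e, slab T x -> HSQ x (Phi x e)),
      (forall h g, measurable_fun (slab T `*` setT)
         (fun z : predictableType F * borel U * E =>
            dot (Phi z.1 z.2 (psqrt (Q z.1) h)) g)) &
      \int[rho]_e Lambda2_norm (fun x => Phi x e) < +oo].

End cylindrical.

Arguments homeomorphic_to_borel R U : clear implicits.
Arguments slab {R d Omega} F {U} t _.
Arguments doleans {R d Omega} P F {U} T qv C.

(* Main.v *)
(* Fixing Parseval sequences of H and G, an integrand Psi is encoded by the real
   function of the matrix coefficients of Psi o Q^{1/2} on Omega x [0, T] x U x nat;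
   this embeds Lambda2(M, T) isometrically in an L2(m), and I is an isometry into
   M_T^2(G). The field Phi becomes one jointly measurable f(x, e) with
   int_E |f(., e)|_{L2(m)} < oo. Since e |-> f(., e) has separable range in L2(m), it
   is approximated in L1(E; L2(m)) by steps sum_i 1_{B_i}(e) f(., e_i), whose values
   are values of f; by the isometry the same sets B_i and points e_i approximate
   e |-> I(Phi(e)) in M_T^2(G). Minkowski's integral inequality shows that the
   pointwise integral int_E f(., e) exists m-a.e., lies in L2(m), and is the limit of
   the integrals of the steps, so I of the pointwise integral is the Bochner integral
   of I(Phi(e)). Evaluation at t is a contraction M_T^2(G) -> L2, and two cadlag
   versions agreeing at each time are indistinguishable. *)

From HB Require Import structures.
Require Import Defs.
From mathcomp Require Import all_boot all_order all_algebra.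
From mathcomp Require Import all_classical all_reals all_analysis.
From mathcomp Require Import measurable_realfun.
From mathcomp Require Import ring lra.

Set Implicit Arguments.
Unset Strict Implicit.
Unset Printing Implicit Defensive.

Import Order.TTheory GRing.Theory Num.Theory.
Import numFieldNormedType.Exports.

Local Open Scope classical_set_scope.
Local Open Scope ring_scope.

(** * Integrals and the L2 seminorm *)

(** Three obstacles shape the proof. The spaces of Hilbert-Schmidt operators on [HQ (Q x)] change
    with the point, and bases of them would have to be chosen measurably; composing with
    [psqrt (Q x)] moves everything to H itself, where one basis serves all points. The
    sigma-algebras are arbitrary, so L2(m) need not be separable; separability is won only for the
    slices of one product-measurable function. For sets it holds because the sets whose slices lie
    in the closure of a countable family form a sigma-algebra containing the rectangles; a function
    is reduced to the region between 0 and its signed square, whose slices have measure comparable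
    to squared norms. Finally, [bochner] returns 0 where no integral exists, so measurability of the
    pointwise integral requires knowing exactly where it exists: at a point of the slab, Bochner
    integrability is equivalent to finiteness of the integral of the Hilbert-Schmidt norms. *)

Section integral_set_function.
Local Open Scope ereal_scope.
Context d (T : measurableType d) (R : realType).
Import HBNNSimple.

(** [doleans] and [qv w] are bare set functions that agree with measures on measurable sets only; an
    integral evaluates its set function only at level sets of simple functions. *)
Lemma eq_integral_set_fun (m1 m2 : set T -> \bar R) (D : set T) (f : T -> \bar R) :
  (forall A, measurable A -> m1 A = m2 A) ->
  \int[m1]_(x in D) f x = \int[m2]_(x in D) f x.
Proof.
move=> m12; have e (h : {nnsfun T >-> R}) : sintegral m1 h = sintegral m2 h.
  by apply: eq_fsbigr => r _; rewrite m12.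
rewrite /integral; congr (ereal_sup _ - ereal_sup _); apply/seteqP; split => y /=;
  by case=> h hf <-; exists h.
Qed.

(* Unlike ge0_le_integral, no measurability is needed: the integral of a
   nonnegative function is a supremum over simple functions below it. *)
Lemma ge0_ae_le_integral (mu : {measure set T -> \bar R}) (f g : T -> \bar R) :
  (forall x, 0 <= f x) -> (forall x, 0 <= g x) ->
  {ae mu, forall x, f x <= g x} -> \int[mu]_x f x <= \int[mu]_x g x.
Proof.
move=> f0 g0 [N [mN N0 fgN]].
rewrite !ge0_integralTE//; apply: ge_ereal_sup => _ [h hf <-].
have mh : measurable_fun setT (EFin \o h) by apply/measurable_EFinP.
pose k := mrestrict h (measurableC mN).
(* Replacing [h] by 0 on the null set [N] leaves its integral unchanged and puts it below [g]
   everywhere. *)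
have -> : sintegral mu h = sintegral mu (proj_nnsfun h (measurableC mN)).
  rewrite -!integralT_nnsfun.
  apply: ge0_ae_eq_integral => //.
  - by apply/measurable_EFinP.
  - by move=> x _; rewrite lee_fin; exact: fun_ge0.
  - by move=> x _; rewrite lee_fin; exact: fun_ge0.
  exists N; split => // x /=; apply: contra_notP => Nx _.
  by rewrite /= /mindic indicE mem_set// mulr1.
apply: ereal_sup_ubound; exists (proj_nnsfun h (measurableC mN)) => //= x.
rewrite /= /mindic indicE; have [Nx|Nx] := boolP (x \in ~` N); last by rewrite mulr0.
rewrite mulr1 (le_trans (hf x))//.
by move: Nx; rewrite inE /=; apply: contra_notP => Nx; apply: fgN.
Qed.

Lemma ge0_le_integralT (mu : {measure set T -> \bar R}) (f g : T -> \bar R) :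
  (forall x, 0 <= f x) ->
  (forall x, f x <= g x) -> \int[mu]_x f x <= \int[mu]_x g x.
Proof.
move=> f0 fg; apply: ge0_ae_le_integral => //; last by apply: aeW.
by move=> x; exact: le_trans (fg x).
Qed.

Lemma ge0_ae_eq_integralT (mu : {measure set T -> \bar R}) (f g : T -> \bar R) :
  (forall x, 0 <= f x) -> (forall x, 0 <= g x) ->
  {ae mu, forall x, f x = g x} -> \int[mu]_x f x = \int[mu]_x g x.
Proof.
move=> f0 g0 fg; apply/eqP; rewrite eq_le !ge0_ae_le_integral//.
  by apply: filterS fg => x ->.
by apply: filterS fg => x ->.
Qed.

End integral_set_function.

Section L2norm.
Local Open Scope ereal_scope.
Context d (T : measurableType d) (R : realType).
Variable m : {measure set T -> \bar R}.

(** The power 1/2 is taken as in [L2_norm] and [Lambda2_norm], so that comparing the norms reduces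
    to comparing the integrals. *)
Definition l2norm (f : T -> R) : \bar R := (\int[m]_x (f x ^+ 2)%:E) `^ 2^-1.

Implicit Types f g : T -> R.

Lemma sqr_ge0E (x : R) : 0 <= (x ^+ 2)%:E.
Proof. by rewrite lee_fin sqr_ge0. Qed.
Hint Resolve sqr_ge0E : core.

Lemma l2normE f : l2norm f = Lnorm m 2%:E (EFin \o f).
Proof.
rewrite unlock /l2norm; congr (_ `^ _); apply: eq_integral => x _.
by rewrite [`|_|]/= poweR_EFin -[2%R]/(2%:R) powR_mulrn// real_normK// num_real.
Qed.

Lemma l2norm_ge0 f : 0 <= l2norm f. Proof. exact: poweR_ge0. Qed.

Lemma sqr_l2norm f : l2norm f * l2norm f = \int[m]_x (f x ^+ 2)%:E.
Proof.
rewrite /l2norm -poweRM ?integral_ge0//.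
have I0 : 0 <= \int[m]_x (f x ^+ 2)%:E by apply: integral_ge0.
case: (\int[m]_x _) I0 => [r||]//; last by rewrite mulyy poweRyr ?invr_neq0.
rewrite lee_fin => r0; rewrite -EFinM -expr2 poweR_EFin; congr EFin.
by rewrite -powR_mulrn// -powRrM mulfV// powRr1.
Qed.

Lemma l2norm_lty f : (l2norm f < +oo) = (\int[m]_x (f x ^+ 2)%:E < +oo).
Proof.
apply/idP/idP => [|]; last exact: poweR_lty.
by apply: lty_poweRy; rewrite invr_neq0.
Qed.

Lemma l2norm_triangle f g : measurable_fun setT f -> measurable_fun setT g ->
  l2norm (f \+ g)%R <= l2norm f + l2norm g.
Proof.
move=> mf mg; rewrite !l2normE.
by rewrite (le_trans (eminkowski m mf mg _))// lee1n.
Qed.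

Lemma cauchy_schwarz f g : measurable_fun setT f -> measurable_fun setT g ->
  \int[m]_x (`|f x * g x|)%:E <= l2norm f * l2norm g.
Proof.
move=> mf mg; rewrite !l2normE.
have := @hoelder _ _ _ m f g 2 2 mf mg; rewrite Lnorm1; apply => //.
by rewrite [RHS](splitr 1) div1r.
Qed.

Lemma le_l2norm f g : (forall x, (`|f x| <= `|g x|)%R) -> l2norm f <= l2norm g.
Proof.
move=> fg; apply: gt0_ler_poweR; rewrite ?invr_ge0 ?in_itv/= ?integral_ge0 ?leey//.
apply: ge0_le_integralT => // x.
by rewrite lee_fin -[leLHS]real_normK ?num_real// -[leRHS]real_normK ?num_real// lerXn2r ?nnegrE.
Qed.

End L2norm.
#[global] Hint Resolve sqr_ge0E l2norm_ge0 : core.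

Section minkowski_integral.
Local Open Scope ereal_scope.
Context d1 d2 (X : measurableType d1) (E : measurableType d2) (R : realType).
Variable m : {sigma_finite_measure set X -> \bar R}.
Variable rho : {sigma_finite_measure set E -> \bar R}.
Variable f : X * E -> R.
Hypothesis mf : measurable_fun setT f.

Lemma measurable_sections1 x : measurable_fun setT (fun e => f (x, e)).
Proof. exact: measurableT_comp. Qed.

Lemma measurable_sections2 e : measurable_fun setT (fun x => f (x, e)).
Proof. exact: measurableT_comp. Qed.

Lemma measurable_sqr_EFin : measurable_fun setT (fun z => (f z ^+ 2)%:E).
Proof. by apply/measurable_EFinP; exact: measurable_funX. Qed.

Lemma measurable_l2norm_section :
  measurable_fun setT (fun e => l2norm m (fun x => f (x, e))).
Proof.
apply: (measurableT_comp (measurable_poweR _)).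
exact: (measurable_fun_fubini_tonelli_G _ measurable_sqr_EFin).
Qed.

(** The square of an inner integral is a double integral over two parameters [e], [e']; Tonelli's
    theorem moves [x] inside, and the Cauchy-Schwarz inequality applies to each pair. The squared
    form avoids dividing by a norm that may be 0 or infinite. *)
Lemma minkowski_integral : (forall z, 0 <= f z)%R ->
  \int[m]_x (\int[rho]_e (f (x, e))%:E * \int[rho]_e (f (x, e))%:E) <=
  \int[rho]_e l2norm m (fun x => f (x, e)) *
  \int[rho]_e l2norm m (fun x => f (x, e)).
Proof.
move=> f0; have f0' z : 0 <= (f z)%:E by rewrite lee_fin.
have mfE : measurable_fun setT (EFin \o f) by exact/measurable_EFinP.
pose F x := \int[rho]_e (f (x, e))%:E.
have F0 x : 0 <= F x by apply: integral_ge0.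
have mF : measurable_fun setT F.
  exact: (@measurable_fun_fubini_tonelli_F _ _ _ _ _ rho (EFin \o f) mfE).
pose N e := l2norm m (fun x => f (x, e)).
have mN : measurable_fun setT N by exact: measurable_l2norm_section.
have N0 e : 0 <= N e by exact: l2norm_ge0.
have -> : \int[m]_x (F x * F x) = \int[m]_x \int[rho]_e ((f (x, e))%:E * F x).
  apply: eq_integral => x _; rewrite ge0_integralZr//.
  by apply/measurable_EFinP; exact: measurable_sections1.
rewrite (@fubini_tonelli _ _ _ _ _ m rho (fun z => (f z)%:E * F z.1)); last 2 first.
- apply: emeasurable_funM => //; exact: measurableT_comp.
- by move=> z; rewrite mule_ge0.
rewrite -ge0_integralZr//; last exact: integral_ge0.
apply: ge0_le_integralT => e.
  by apply: integral_ge0 => x _; rewrite mule_ge0.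
have -> : \int[m]_x ((f (x, e))%:E * F x) =
    \int[m]_x \int[rho]_e' ((f (x, e))%:E * (f (x, e'))%:E).
  apply: eq_integral => x _; rewrite ge0_integralZl//.
  by apply/measurable_EFinP; exact: measurable_sections1.
rewrite (@fubini_tonelli _ _ _ _ _ m rho (fun z => (f (z.1, e))%:E * (f z)%:E)); last 2 first.
- apply: emeasurable_funM => //.
  apply/measurable_EFinP; apply: (measurableT_comp (measurable_sections2 e)).
  exact: measurable_fst.
- by move=> z; rewrite mule_ge0.
rewrite -ge0_integralZl//.
apply: ge0_le_integralT => e'.
  by apply: integral_ge0 => x _; rewrite mule_ge0.
apply: (le_trans _ (cauchy_schwarz m (measurable_sections2 e) (measurable_sections2 e'))).
apply: ge0_le_integralT => x /=; first by rewrite mule_ge0.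
by rewrite -EFinM lee_fin ler_norm.
Qed.

End minkowski_integral.

(** * Sigma-finite measures and their products *)

Section sigma_finite_of.
Context d (T : measurableType d) (R : realType) (mu : {measure set T -> \bar R}).

(* The proof argument only carries the sigma-finite structure attached to mu. *)
Definition sigma_finite_of of sigma_finite setT mu : set T -> \bar R := mu.

Variable H : sigma_finite setT mu.
HB.instance Definition _ := Measure.copy (sigma_finite_of H) mu.
HB.instance Definition _ := Measure_isSigmaFinite.Build _ _ _ (sigma_finite_of H) H.

End sigma_finite_of.

Section product_sigma_finite.
Local Open Scope ereal_scope.
Context d1 d2 (T1 : measurableType d1) (T2 : measurableType d2) (R : realType).
Variable m1 : {sigma_finite_measure set T1 -> \bar R}.
Variable m2 : {sigma_finite_measure set T2 -> \bar R}.

Lemma product_sigma_finite : sigma_finite setT (m1 \x m2).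
Proof.
have [F TF HF] := sigma_finiteT m1; have [G TG HG] := sigma_finiteT m2.
pose p (i : nat) : nat * nat := odflt (0%N, 0%N) (unpickle i).
exists (fun i => F (p i).1 `*` G (p i).2) => [|i].
  apply/seteqP; split => // -[x y] _.
  have [n _ Fx] : (\bigcup_i F i) x by rewrite -TF.
  have [k _ Gy] : (\bigcup_i G i) y by rewrite -TG.
  by exists (pickle (n, k)) => //; rewrite /p pickleK.
have [mF Foo] := HF (p i).1; have [mG Goo] := HG (p i).2.
split; first exact: measurableX.
by rewrite product_measure1E// lte_mul_pinfty// ge0_fin_numE.
Qed.

Definition sigma_prod : {sigma_finite_measure set (T1 * T2)%type -> \bar R} :=
  sigma_finite_of product_sigma_finite.

End product_sigma_finite.

Definition sigma_counting (R : realType) : {sigma_finite_measure set nat -> \bar R} :=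
  sigma_finite_of (sigma_finite_counting R).

(** * Separability of the slices of a product-measurable function *)

Section separable_sections.
Local Open Scope ereal_scope.
Context d1 d2 (X : measurableType d1) (E : measurableType d2) (R : realType).

Definition slice (C : set (X * E)) (e : E) : set X := [set x | C (x, e)].

Lemma measurable_slice C e : measurable C -> measurable (slice C e).
Proof.
move=> mC; rewrite (_ : slice C e = ysection C e); first exact: measurable_ysection.
by apply/seteqP; split => x; rewrite /ysection /= inE.
Qed.

Lemma measurable_setY (A B : set X) :
  measurable A -> measurable B -> measurable (A `+` B).
Proof. by move=> mA mB; apply: measurableU; exact: measurableD. Qed.

Lemma measure_setY_triangle (m : {measure set X -> \bar R}) (A B C : set X) :
  measurable A -> measurable B -> measurable C ->
  m (A `+` C) <= m (A `+` B) + m (B `+` C).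
Proof.
move=> mA mB mC; apply: le_trans (measureU2 _ _ _); try exact: measurable_setY.
apply: le_measure; rewrite ?inE; try exact: measurable_setY.
  by apply: measurableU; exact: measurable_setY.
by move=> x /=; case: (pselect (B x)); tauto.
Qed.

Lemma tail_measure_lt (m : {measure set X -> \bar R}) (F : nat -> set X) (A : set X)
    (r : R) : m A < +oo -> measurable A -> (forall n, measurable (F n)) ->
  A `<=` \bigcup_n F n -> (0 < r)%R ->
  exists N, m (A `\` \bigcup_(i < N) F i) < r%:E.
Proof.
move=> Aoo mA mF AF r0.
pose B N := A `\` \bigcup_(i < N) F i.
have mB N : measurable (B N) by apply: measurableD => //; exact: bigcup_measurable.
have capB : \bigcap_N B N = set0.
  apply/seteqP; split => // x Bx.
  have [Ax _] := Bx 0%N Logic.I; have [n _ Fnx] := AF _ Ax.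
  by have [_ +] := Bx n.+1 Logic.I; apply; exists n => /=.
have := @nonincreasing_cvg_mu _ _ _ m B; rewrite capB measure0 => cB.
have {}cB : (m \o B) x @[x --> \oo] --> 0.
  apply: cB => //.
  - apply: le_lt_trans Aoo; apply: le_measure; rewrite ?inE//.
    by move=> x [].
  - move=> p q pq; apply/subsetPset => x [Ax nF]; split => //.
    by move=> [i /= ip Fi]; apply: nF; exists i => //=; exact: leq_trans pq.
have /(cB)[N _ /(_ N (leqnn N)) /=] : nbhs 0 [set x : \bar R | x < r%:E].
  by apply: (open_nbhs_nbhs (conj _ _)); [exact: open_ereal_lt_ereal|rewrite /= lte_fin].
by exists N.
Qed.

(** The sets whose slices lie in the closure of a countable family, for the measure of the symmetric
    difference, form a sigma-algebra. A rectangle has only two slices, the empty set and its base;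
    complements have the same symmetric differences; a countable union is approximated by finite
    unions. *)
Lemma slices_separable_finite (m : {measure set X -> \bar R}) (C : set (X * E)) :
  m setT < +oo -> measurable C ->
  exists D : nat -> set X, (forall k, measurable (D k)) /\
    forall e (r : R), (0 < r)%R -> exists k, m (slice C e `+` D k) < r%:E.
Proof.
move=> moo mC.
have mfin A : measurable A -> m A < +oo.
  by move=> mA; apply: le_lt_trans moo; apply: le_measure; rewrite ?inE.
pose good (C : set (X * E)) := measurable C /\
  exists D : nat -> set X, (forall k, measurable (D k)) /\
    forall e (r : R), (0 < r)%R -> exists k, m (slice C e `+` D k) < r%:E.
suff: good C by case.
move: C mC; rewrite measurable_prod_measurableType; apply: smallest_sub.
  split.
  - split => //; exists (fun=> set0); split => // e r r0; exists 0%N.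
    by rewrite (_ : slice _ _ = set0)// setYK measure0 lte_fin.
  - move=> A [mA [D [mD AD]]]; split; first exact: measurableD.
    exists (fun k => ~` D k); split; first by move=> k; exact: measurableC.
    move=> e r /(AD e)[k Ak]; exists k; rewrite (_ : _ `+` _ = slice A e `+` D k)//.
    by apply/seteqP; split => x /=; rewrite /slice/=;
      case: (pselect (A (x, e))); case: (pselect (D k x)); tauto.
  - move=> A gA; split; first by apply: bigcupT_measurable => n; case: (gA n).
    have mA n : measurable (A n) by case: (gA n).
    have [D_ gD] := choice (fun n => (gA n).2).
    (* [k] encodes a finite list of indices: the candidates are all finite unions of one approximant
       from each of the first few families. *)
    pose s_ (k : nat) : seq nat := odflt [::] (unpickle k).
    exists (fun k => \bigcup_(i < size (s_ k)) D_ i (nth 0%N (s_ k) i)).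
    split; first by move=> k; apply: bigcup_measurable => i _; case: (gD i).
    move=> e r r0.
    have mS n : measurable (slice (A n) e) by exact: measurable_slice.
    have sE : slice (\bigcup_n A n) e = \bigcup_n slice (A n) e by [].
    have mU : measurable (\bigcup_n slice (A n) e) by exact: bigcupT_measurable.
    have r20 : (0 < r / 2)%R by rewrite divr_gt0.
    have [N HN] := tail_measure_lt (mfin _ mU) mU mS (@subset_refl _ _) r20.
    (* [N] slices with error [q] cost at most [r / 2]; the divisor [N.+1] is nonzero even when [N]
       is 0. *)
    pose q := (r / 2 / N.+1%:R)%R.
    have q0 : (0 < q)%R by rewrite divr_gt0.
    have [k_ Hk] := choice (fun i => (gD i).2 e q q0).
    exists (pickle (mkseq k_ N)); rewrite /s_ pickleK /= size_mkseq sE.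
    (* The pieces with [i < N] are the symmetric differences; the piece of index [N] is the tail of
       the union. *)
    pose F i := if (i < N)%N then slice (A i) e `+` D_ i (k_ i)
                else (\bigcup_n slice (A n) e) `\` \bigcup_(i < N) slice (A i) e.
    have mF i : measurable (F i).
      rewrite /F; case: ifP => _; first by apply: measurable_setY => //; case: (gD i).
      by apply: measurableD => //; exact: bigcup_measurable.
    apply: (@le_lt_trans _ _ (\sum_(i < N.+1) m (F i))).
      apply: content_subadditive.
      + by move=> k _; exact: mF.
      + apply: measurable_setY => //; apply: bigcup_measurable => i _.
        by case: (gD i).
      + rewrite -bigcup_mkord => x /= [[Ux nD]|[[i iN Dx] nU]].
          have [[i /= iN Ax]|nA] := pselect ((\bigcup_(i < N) slice (A i) e) x).
            exists i => /=; first exact: ltnW.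
            rewrite /F iN; left; split => // Dx; apply: nD; exists i => //=.
            by rewrite nth_mkseq.
          by exists N => //=; rewrite /F ltnn.
        exists i => /=; first exact: ltnW.
        rewrite /F iN; right; rewrite nth_mkseq// in Dx; split => // Ax; apply: nU.
        by exists i.
    rewrite big_ord_recr /= [in X in _ + X]/F ltnn (splitr r) EFinD.
    apply: lee_ltD => //.
      rewrite ge0_fin_numE; last exact: sume_ge0.
      by apply: lte_sum_pinfty => i _; exact: mfin.
    apply: (@le_trans _ _ (\sum_(i < N) q%:E)).
      by apply: lee_sum => i _; rewrite /F ltn_ord; exact: ltW.
    rewrite sumEFin lee_fin sumr_const card_ord -[leLHS]mulr_natr /q.
    by rewrite mulrAC ler_pdivrMr// ler_pM2l// ler_nat.
move=> _ [A mA] [B mB] <-; split; first exact: measurableX.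
exists (fun k => if k is 0 then set0 else A); split; first by case.
move=> e r r0; have [Be|nBe] := pselect (B e).
  exists 1%N; rewrite (_ : slice _ _ = A) ?setYK ?measure0 ?lte_fin//.
  by apply/seteqP; split => x; rewrite /slice/=; tauto.
exists 0%N; rewrite (_ : slice _ _ = set0) ?setYK ?measure0 ?lte_fin//.
by apply/seteqP; split => x; rewrite /slice/=; tauto.
Qed.

(** The finite case is applied on each [V n] of an exhaustion. The approximants it gives are
    arbitrary sets; a point is attached to each approximant and each tolerance, so that the dense
    sequence consists of slices of [C] itself. *)
Lemma slices_separable (m : {sigma_finite_measure set X -> \bar R}) (C : set (X * E)) :
  measurable C -> (exists e, m (slice C e) < +oo) ->
  exists e_ : nat -> E, (forall k, m (slice C (e_ k)) < +oo) /\
    forall e (r : R), m (slice C e) < +oo -> (0 < r)%R ->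
      exists k, m (slice C e `+` slice C (e_ k)) < r%:E.
Proof.
move=> mC [e0 Ce0].
have [S [TS _ mS]] := (sigma_finiteP _ _).1 (sigma_finiteT m).
pose V n := \bigcup_(i < n) S i.
have mV n : measurable (V n) by apply: bigcup_measurable => i _; case: (mS i).
have Voo n : m (V n) < +oo.
  rewrite /V bigcup_mkord.
  apply: (@le_lt_trans _ _ (\sum_(i < n) m (S i))).
    apply: content_subadditive => //; last by apply: bigsetU_measurable => i _; case: (mS i).
    by move=> k _; case: (mS k).
  by apply: lte_sum_pinfty => i _; case: (mS i).
have H n : exists D : nat -> set X, (forall k, measurable (D k)) /\
    forall e (r : R), (0 < r)%R -> exists k, mrestr m (mV n) (slice C e `+` D k) < r%:E.
  apply: (@slices_separable_finite (mrestr m (mV n)) C) => //.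
  by rewrite /= /mrestr setTI.
have [D_ HD] := choice H.
pose D n k := D_ n k `&` V n.
have mD n k : measurable (D n k) by apply: measurableI => //; case: (HD n).
have DA e (r : R) : m (slice C e) < +oo -> (0 < r)%R ->
    exists n k, m (slice C e `+` D n k) < r%:E.
  move=> Ce r0; have r20 : (0 < r / 2)%R by rewrite divr_gt0.
  have mCe := measurable_slice e mC.
  have [|n Hn] := tail_measure_lt Ce mCe (fun i => (mS i).1) _ r20.
    by rewrite -TS.
  have [_ /(_ e _ r20)[k Hk]] := HD n.
  exists n, k; rewrite (splitr r) EFinD; apply: le_lt_trans (lteD Hn Hk).
  rewrite /mrestr; apply: le_trans (measureU2 _ _ _); last 2 first.
  - by apply: measurableD => //; exact: mV.
  - by apply: measurableI => //; apply: measurable_setY => //; case: (HD n).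
  apply: le_measure; rewrite ?inE.
  - by apply: measurable_setY => //; exact: mD.
  - apply: measurableU; first by apply: measurableD => //; exact: mV.
    by apply: measurableI => //; apply: measurable_setY => //; case: (HD n).
  move=> x /=; rewrite -/(V n) /D /=.
  by case: (pselect (V n x)); case: (pselect (D_ n k x)); tauto.
(* A point whose slice is within [1 / (p.2 + 1)] of the approximant is taken if there is one, and
   [e0] otherwise; in both cases the slice has finite measure. *)
have P (p : nat * nat * nat) : exists e, m (slice C e) < +oo /\
    ((exists e', m (slice C e') < +oo /\ m (slice C e' `+` D p.1.1 p.1.2) < (p.2.+1%:R^-1)%:E) ->
     m (slice C e `+` D p.1.1 p.1.2) < (p.2.+1%:R^-1)%:E).
  have [[e' [? ?]]|no] := pselect (exists e', m (slice C e') < +oo /\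
    m (slice C e' `+` D p.1.1 p.1.2) < (p.2.+1%:R^-1)%:E); first by exists e'.
  by exists e0.
have [pe Hpe] := choice P.
exists (fun k => pe (odflt (0%N, 0%N, 0%N) (unpickle k))); split.
  by move=> k; case: (Hpe (odflt (0%N, 0%N, 0%N) (unpickle k))).
move=> e r Ce r0.
have r20 : (0 < r / 2)%R by rewrite divr_gt0.
have [j _ /(_ j (leqnn j)) /= Hj] := near_infty_natSinv_lt (PosNum r20).
have j0 : (0 < (j.+1%:R^-1 : R))%R by rewrite invr_gt0.
have [n [k Hnk]] := DA e _ Ce j0.
exists (pickle (n, k, j)); rewrite pickleK /=.
have [_ /(_ (ex_intro _ e (conj Ce Hnk))) /= H'] := Hpe (n, k, j).
apply: le_lt_trans (measure_setY_triangle m (measurable_slice e mC) (mD n k)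
  (measurable_slice _ mC)) _.
rewrite (splitr r) EFinD (setYC (D n k)); apply: lteD.
  by apply: lt_trans Hnk _; rewrite lte_fin.
by apply: lt_trans H' _; rewrite lte_fin.
Qed.

End separable_sections.

Section separable_functions.
Local Open Scope ereal_scope.
Context d1 d2 (X : measurableType d1) (E : measurableType d2) (R : realType).
Variable m : {sigma_finite_measure set X -> \bar R}.
Variable f : X * E -> R.
Hypothesis mf : measurable_fun setT f.

(** The signed square of [f]. In [C] below, the product is positive exactly when [z.1.2] lies
    strictly between 0 and [h], for either sign of [h]; each section of a slice is thus an interval
    of length [f ^ 2], which ties the measure of a slice to the squared L2 norm. *)
Let h (z : X * E) : R := (f z * `|f z|)%R.
Let C : set ((X * R) * E) := [set z | (0 < z.1.2 * (h (z.1.1, z.2) - z.1.2))%R].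

Let S (a : R) : set R := [set y | (0 < y * (a - y))%R].

Let measurable_C : measurable C.
Proof.
have mg : measurable_fun setT
    (fun z : (X * R) * E => (z.1.2 * (h (z.1.1, z.2) - z.1.2))%R).
  have m12 : measurable_fun setT (fun z : (X * R) * E => z.1.2).
    exact: (measurableT_comp measurable_snd measurable_fst).
  have mz : measurable_fun setT (fun z : (X * R) * E => (z.1.1, z.2)).
    apply/measurable_fun_pairP; split => /=; last exact: measurable_snd.
    exact: (measurableT_comp measurable_fst measurable_fst).
  apply: measurable_funM => //; apply: measurable_funB => //.
  apply: (measurableT_comp _ mz); rewrite /h; apply: measurable_funM => //.
  exact: measurableT_comp.
rewrite [C](_ : _ = setT `&` (fun z : (X * R) * E => (z.1.2 * (h (z.1.1, z.2) - z.1.2))%R) @^-1` `]0%R, +oo[%classic).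
  exact: mg.
by apply/seteqP; split => z; rewrite /C/= in_itv/= andbT ?setTI//; tauto.
Qed.

Let sliceS e x : xsection (slice C e) x = S (h (x, e)).
Proof. by apply/seteqP; split => y; rewrite /xsection /= inE. Qed.

Let slice_finite e : l2norm m (fun x => f (x, e)) < +oo ->
  (m \x lebesgue_measure)%E (slice C e) < +oo.
Proof.
rewrite l2norm_lty => foo.
rewrite /product_measure1.
apply: (@le_lt_trans _ _ (\int[m]_x (2%:E * (f (x, e) ^+ 2)%:E))).
  apply: ge0_le_integralT => // x /=; rewrite sliceS.
  (* The enclosing interval is twice too long, whence the factor 2; only finiteness matters here. *)
  apply: (@le_trans _ _ (lebesgue_measure `[- `|h (x, e)|, `|h (x, e)|]%classic)%R).
    apply: le_measure; rewrite ?inE//.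
      rewrite -sliceS; apply: measurable_xsection; exact: measurable_slice.
    move=> y; rewrite /S/= in_itv/= -ler_norml => yh.
    have := ler_norm (y * h (x, e)); rewrite normrM => yh'.
    have y0 : (y != 0)%R by apply: contraTneq yh => ->; rewrite mul0r ltxx.
    rewrite mulrBr subr_gt0 in yh.
    have := lt_le_trans yh yh'; rewrite -[(y * y)%R]ger0_norm; last first.
      by rewrite -expr2 sqr_ge0.
    by rewrite normrM ltr_pM2l ?normr_gt0//; exact: ltW.
  rewrite lebesgue_measure_itv/= lte_fin; case: ifP => _; last first.
    by rewrite -EFinM lee_fin mulr_ge0 ?sqr_ge0.
  rewrite opprK -EFinD -EFinM lee_fin /h normrM normr_id -expr2 real_normK ?num_real//.
  by rewrite mulr_natl mulr2n.
rewrite ge0_integralZl//.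
  exact: lte_mul_pinfty.
exact: (measurableT_comp (measurable_sqr_EFin mf)).
Qed.

(** For equal signs [(a - b)^2 <= |a^2 - b^2|]; for opposite signs [(a - b)^2 <= 2 * (a^2 + b^2)],
    which is where the factor 2 comes from. *)
Lemma sqr_sub_le_signed (a b : R) : ((a - b) ^+ 2 <= 2 * `|a * `|a| - b * `|b| |)%R.
Proof.
wlog ab : a b / (b <= a)%R.
  move=> H; have [/H//|/ltW/H] := leP b a.
  by rewrite distrC -(opprB a b) sqrrN.
have [a0|a0] := leP 0%R a; have [b0|b0] := leP 0%R b;
  rewrite ?(ger0_norm a0) ?(ger0_norm b0) ?(ltr0_norm a0) ?(ltr0_norm b0).
- rewrite ger0_norm; last by nra.
  by nra.
- rewrite ger0_norm; last by nra.
  by have := sqr_ge0 (a + b)%R; nra.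
- by lra.
- rewrite ger0_norm; last by nra.
  by nra.
Qed.

(** [S a] is the open interval between 0 and [a], and the symmetric difference of [S a] and [S b]
    covers the interval between [a] and [b] except possibly the point 0. *)
Let lebesgue_setY (a b : R) :
  (`|a - b|)%:E <= lebesgue_measure (S a `+` S b).
Proof.
have mS c : measurable (S c).
  have mg : measurable_fun setT (fun y : R => (y * (c - y))%R).
    by apply: measurable_funM => //; exact: measurable_funB.
  rewrite [S c](_ : _ = setT `&` (fun y => (y * (c - y))%R) @^-1` `]0%R, +oo[%classic).
    exact: mg.
  by apply/seteqP; split => z; rewrite /S/= in_itv/= andbT ?setTI//; tauto.
wlog ab : a b / (a <= b)%R.
  move=> H; have [/H//|/ltW/H] := leP a b.
  by rewrite distrC setYC.
have -> : (`|a - b|)%:E = lebesgue_measure (`]a, b[%classic : set R).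
  rewrite lebesgue_measure_itv/= lte_fin distrC ger0_norm ?subr_ge0//.
  case: ltP => [//|ba]; congr EFin; apply/eqP; rewrite subr_eq0; apply/eqP.
  by apply/le_anti; rewrite ab ba.
have mY : measurable (S a `+` S b) by exact: measurable_setY.
apply: (@le_trans _ _ (lebesgue_measure ((S a `+` S b) `|` [set 0%R]))).
  apply: le_measure; rewrite ?inE//; first exact: measurableU.
  move=> y /=; rewrite in_itv/= => /andP[ay yb].
  have [y0|y0|->] := ltgtP y 0%R; last by right.
  - left; left; rewrite /S/=; split; first by nra.
    by apply/negP; rewrite -leNgt; nra.
  - left; right; rewrite /S/=; split; first by nra.
    by apply/negP; rewrite -leNgt; nra.
apply: le_trans (measureU2 _ _ _) _ => //.
by rewrite [X in _ + X](lebesgue_measure_set1 0%R) adde0.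
Qed.

Let le_slice e e' : \int[m]_x ((f (x, e) - f (x, e')) ^+ 2)%:E <=
  2%:E * (m \x lebesgue_measure)%E (slice C e `+` slice C e').
Proof.
have mY : measurable (slice C e `+` slice C e').
  by apply: measurable_setY; exact: measurable_slice.
rewrite /product_measure1 -ge0_integralZl//; last exact: measurable_fun_xsection.
apply: ge0_le_integralT => // x /=.
rewrite (_ : xsection _ x = S (h (x, e)) `+` S (h (x, e'))); last first.
  by rewrite -!sliceS; apply/seteqP; split => y; rewrite /xsection /= !inE.
apply: (@le_trans _ _ (2%:E * (`|h (x, e) - h (x, e')|)%:E)).
  by rewrite -EFinM lee_fin sqr_sub_le_signed.
by rewrite lee_pmul2l.
Qed.

Let slice_lower e : \int[m]_x (f (x, e) ^+ 2)%:E <=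
  (m \x lebesgue_measure)%E (slice C e).
Proof.
apply: ge0_le_integralT => // x /=; rewrite sliceS.
have := lebesgue_setY (h (x, e)) 0; rewrite subr0.
rewrite (_ : S 0 = set0) ?setY0; last first.
  apply/seteqP; split => y //=; rewrite /S/= sub0r mulrN oppr_gt0 -expr2.
  by rewrite ltNge sqr_ge0.
by rewrite /h normrM normr_id -expr2 real_normK ?num_real.
Qed.

Lemma L2_slices_separable : (exists e, l2norm m (fun x => f (x, e)) < +oo) ->
  exists e_ : nat -> E, (forall k, l2norm m (fun x => f (x, e_ k)) < +oo) /\
    forall e (r : R), l2norm m (fun x => f (x, e)) < +oo -> (0 < r)%R ->
      exists k, l2norm m (fun x => f (x, e) - f (x, e_ k))%R < r%:E.
Proof.
have ltyE e : (l2norm m (fun x => f (x, e)) < +oo) =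
    ((m \x lebesgue_measure)%E (slice C e) < +oo).
  apply/idP/idP; first exact: slice_finite.
  by rewrite l2norm_lty; apply: le_lt_trans; exact: slice_lower.
move=> [e0]; rewrite ltyE => Ce0.
pose M := sigma_prod m (@lebesgue_measure R).
have [|e_ [He_ Hsep]] := @slices_separable _ _ _ _ _ M C measurable_C.
  by exists e0.
exists e_; split; first by move=> k; rewrite ltyE; exact: He_.
move=> e r; rewrite ltyE => Ce r0.
(* [le_slice] loses a factor 2, so slices within [r ^ 2 / 2] give functions within [r]. *)
have q0 : (0 < r ^+ 2 / 2)%R by rewrite divr_gt0 ?exprn_gt0.
have [k Hk] := Hsep e _ Ce q0; exists k.
rewrite ltNge; apply/negP => rN.
have : r%:E * r%:E <= l2norm m (fun x => f (x, e) - f (x, e_ k))%R *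
    l2norm m (fun x => f (x, e) - f (x, e_ k))%R.
  by apply: lee_pmul => //; rewrite lee_fin ltW.
rewrite sqr_l2norm => /le_trans/(_ (le_slice _ _)).
rewrite leNgt => /negP; apply.
rewrite -EFinM (_ : (r * r)%R = (2 * (r ^+ 2 / 2))%R); last first.
  by rewrite expr2; field.
by rewrite EFinM lte_pmul2l.
Qed.

End separable_functions.

(** * Approximation by sampled steps *)

Lemma cvge0P (R : realType) (u : (\bar R)^nat) : (forall n, (0 <= u n)%E) ->
  (forall r : R, 0 < r -> exists n0, forall n, (n0 <= n)%N -> (u n <= r%:E)%E) ->
  u n @[n --> \oo] --> 0%E.
Proof.
move=> u0 H; have cv r : 0 < r -> \forall n \near \oo, (u n <= r%:E)%E.
  by move=> /H[n0 Hn0]; exists n0.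
apply/fine_cvgP; split.
  by apply: filterS (cv 1 ltr01) => n un; rewrite ge0_fin_numE// (le_lt_trans un) ?ltry.
apply/cvgrPdist_le => r r0; apply: filterS (cv r r0) => n un.
rewrite sub0r normrN ger0_norm ?fine_ge0// -lee_fin fineK//.
by rewrite ge0_fin_numE// (le_lt_trans un) ?ltry.
Qed.

Section simple_approximation.
Local Open Scope ereal_scope.
Context d1 d2 (X : measurableType d1) (E : measurableType d2) (R : realType).
Variable m : {sigma_finite_measure set X -> \bar R}.
Variable rho : {sigma_finite_measure set E -> \bar R}.
Variable f : X * E -> R.
Hypothesis mf : measurable_fun setT f.

(* Only the values of f at the points are used, so that the same sample also
   approximates any vector-valued function with the same distances as f. *)
Record sample := Sample {
  sample_size : nat ;
  sample_set : 'I_sample_size -> set E ;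
  sample_point : 'I_sample_size -> E }.

Let N e := l2norm m (fun x => f (x, e)).

Definition good_sample (s : sample) := forall i,
  [/\ measurable (sample_set i : set E), rho (sample_set i) < +oo &
      N (@sample_point s i) < +oo].

Definition sample_step (s : sample) (x : X) (e : E) : R :=
  (\sum_(i < sample_size s) \1_(@sample_set s i) e * f (x, @sample_point s i))%R.

Definition sample_error (s : sample) (e : E) : \bar R :=
  l2norm m (fun x => f (x, e) - sample_step s x e)%R.

Lemma measurable_sample_diff s : good_sample s ->
  measurable_fun setT (fun z : X * E => f z - sample_step s z.1 z.2)%R.
Proof.
move=> gs; apply: measurable_funB => //.
apply: measurable_sum => i; have [mB _ _] := gs i.
apply: measurable_funM; first by apply: measurableT_comp => //; exact: measurable_indic.
apply: (measurableT_comp (measurable_sections2 mf _)).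
exact: measurable_fst.
Qed.

Lemma measurable_sample_error s : good_sample s ->
  measurable_fun setT (sample_error s).
Proof.
move=> gs.
exact: (measurable_l2norm_section m (measurable_sample_diff gs)).
Qed.

Lemma sample_error_ge0 s e : 0 <= sample_error s e.
Proof. exact: l2norm_ge0. Qed.

(** At stage [n], a parameter of [S n] is assigned the nearest of the points [e_ 0], ..., [e_ n],
    unless the zero function is strictly nearer. The error then never exceeds [N e], which
    dominates, and it tends to 0 by density wherever [N e] is finite. *)
Lemma sample_approximation : \int[rho]_e N e < +oo ->
  exists s : nat -> sample, [/\ forall n, good_sample (s n),
    (forall e, N e < +oo -> sample_error (s n) e @[n --> \oo] --> 0) &
    \int[rho]_e sample_error (s n) e @[n --> \oo] --> 0].
Proof.
move=> Noo; have mN : measurable_fun setT N by exact: measurable_l2norm_section.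
have N0 e : 0 <= N e by exact: l2norm_ge0.
have iN : rho.-integrable setT N.
  apply/integrableP; split => //; rewrite (eq_integral N)// => e _.
  by rewrite gee0_abs.
have aeN : {ae rho, forall e, N e < +oo}.
  have := integrable_ae measurableT iN; apply: filterS => e /(_ Logic.I).
  by rewrite ge0_fin_numE.
(* If no parameter has finite norm then [rho] is null, and the empty sample will do. *)
have [[e0 Ne0]|noE] := pselect (exists e, N e < +oo); last first.
  have ae0 : {ae rho, forall e, False} by apply: filterS aeN => e Ne; apply: noE; exists e.
  exists (fun=> @Sample 0 (fun=> set0) (fun i => match (ltn_ord i : false) with end)).
  split => [n [] //|e Ne|]; first by exfalso; apply: noE; exists e.
  apply: cvge0P => [n|r r0]; first by apply: integral_ge0 => e _; exact: sample_error_ge0.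
  exists 0%N => n _; rewrite (@ge0_ae_eq_integralT _ _ _ _ _ (cst 0))//.
    by rewrite integral0 lee_fin ltW.
    by move=> e; exact: sample_error_ge0.
  by apply: filterS ae0.
have [e_ [Ne_ sep]] := L2_slices_separable mf (ex_intro _ e0 Ne0).
pose d k e := l2norm m (fun x => f (x, e) - f (x, e_ k))%R.
have d0 k e : 0 <= d k e by exact: l2norm_ge0.
have md k : measurable_fun setT (d k).
  apply: (@measurable_l2norm_section _ _ _ _ _ m (fun z => f z - f (z.1, e_ k))%R).
  apply: measurable_funB => //.
  apply: (measurableT_comp (measurable_sections2 mf _)); exact: measurable_fst.
have [S [TS ndS HS]] := (sigma_finiteP _ _).1 (sigma_finiteT rho).
(* [e] lies in [B' n k] when [k] minimizes the distance among the indices up to [n] and the sample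
   at [e_ k] is no farther than 0; [B n k] keeps the least such [k], which makes the sets
   disjoint. *)
pose B' n k := S n `&` [set e | d k e <= N e] `&`
  \bigcap_(j < n.+1) [set e | d k e <= d j e].
pose B n k := B' n k `\` \bigcup_(j < k) B' n j.
have mle (u v : E -> \bar R) : measurable_fun setT u -> measurable_fun setT v ->
    measurable [set e | u e <= v e].
  by move=> mu mv; rewrite -[X in measurable X]setTI; exact: emeasurable_fun_le.
have mB' n k : measurable (B' n k).
  apply: measurableI; first by apply: measurableI; [case: (HS n)|exact: mle].
  by apply: bigcap_measurable => [|j _]; [exists 0%N|exact: mle].
have mB n k : measurable (B n k).
  by apply: measurableD => //; exact: bigcup_measurable.
pose s n := @Sample n.+1 (fun i => B n i) (fun i => e_ i).
have gs n : good_sample (s n).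
  move=> i; split => //=; last exact: Ne_.
  apply: le_lt_trans (HS n).2; apply: le_measure; rewrite ?inE//; first by case: (HS n).
  by move=> e [[[]]].
have disj n k k' e : B n k e -> B n k' e -> k = k'.
  wlog kk' : k k' / (k < k')%N.
    move=> H Bk Bk'; have [/H/(_ Bk Bk')//|kk'|//] := ltngtP k k'.
    by rewrite (H _ _ kk').
  by move=> [Bk _] [_ nB]; exfalso; apply: nB; exists k.
have errB n k e : (k <= n)%N -> B n k e -> sample_error (s n) e = d k e.
  move=> kn Bk; rewrite /sample_error; congr (l2norm m _); apply/funext => x.
  rewrite /sample_step /= (bigD1 (Ordinal (kn : k < n.+1)%N))//= indicE mem_set// mul1r.
  rewrite big1 ?addr0// => i ik; rewrite indicE memNset ?mul0r// => /(disj _ _ _ _ Bk) kE.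
  by move/eqP: ik; apply; exact/val_inj.
have errN n e : (forall k, (k <= n)%N -> ~ B n k e) -> sample_error (s n) e = N e.
  move=> nB; rewrite /sample_error; congr (l2norm m _); apply/funext => x.
  rewrite /sample_step /= big1 ?subr0// => i _; rewrite indicE memNset ?mul0r//.
  by apply: nB; rewrite -ltnS.
have err_cases n e : (exists2 k, (k <= n)%N & B n k e) \/
    (forall k, (k <= n)%N -> ~ B n k e).
  have [|H] := pselect (exists2 k, (k <= n)%N & B n k e); first by left.
  by right => k kn Bk; apply: H; exists k.
have err_le n e : sample_error (s n) e <= N e.
  have [[k kn Bk]|nB] := err_cases n e; last by rewrite errN.
  by rewrite (errB _ k)//; case: Bk => -[[_]].
have err_d n j e : (j <= n)%N -> S n e -> sample_error (s n) e <= d j e.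
  move=> jn Sn; have [[k kn Bk]|nB] := err_cases n e.
    by rewrite (errB _ k)//; case: Bk => -[_ + _]; apply.
  rewrite errN//.
  have [k _ kmin] := @Order.TotalTheory.arg_minP _ _ _ (@ord0 n) xpredT (fun i : 'I_n.+1 => d i e) isT.
  have [dk|/ltW dk] := leP (d k e) (N e); last first.
    by apply: le_trans dk _; have := kmin (Ordinal (jn : j < n.+1)%N) isT.
  (* If the nearest sample were no farther than 0, some [B n k'] with [k' <= n] would contain
     [e]. *)
  exfalso.
  have B'k : exists i, `[< B' n i e /\ (i <= n)%N >].
    exists k; apply/asboolP; split; last by rewrite -ltnS.
    by split => // i /= ilt; have := kmin (Ordinal ilt) isT.
  have [k' /asboolP[B'k' k'n] k'min] := ex_minnP B'k.
  apply: (nB _ k'n); split => // -[i /= ik' B'i].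
  suff : (k' <= i)%N by rewrite leqNgt ik'.
  by apply: k'min; apply/asboolP; split => //; exact: leq_trans (ltnW ik') k'n.
have err_cvg e : N e < +oo -> sample_error (s n) e @[n --> \oo] --> 0.
  move=> Ne; apply: cvge0P => [n|r r0]; first exact: sample_error_ge0.
  have [k dk] := sep e r Ne r0.
  have [n0 _ Sn0] : (\bigcup_i S i) e by rewrite -TS.
  exists (maxn k n0) => n; rewrite geq_max => /andP[kn n0n].
  apply: le_trans (ltW dk); apply: err_d => //.
  by have /subsetPset := ndS _ _ n0n; apply.
exists s; split => //.
have mcst : measurable_fun [set: E] (cst (0 : \bar R)) by [].
have cv0 : {ae rho, forall e, setT e -> sample_error (s n) e @[n --> \oo] --> cst 0 e}.
  by apply: filterS aeN => e Ne _; exact: err_cvg.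
have dom : {ae rho, forall e n, setT e -> `|sample_error (s n) e| <= N e}.
  by apply: aeW => e n _; rewrite gee0_abs//; exact: sample_error_ge0.
have [_ _] := @dominated_convergence _ _ _ rho setT measurableT
  (fun n => sample_error (s n)) (cst 0) N (fun n => measurable_sample_error (gs n))
  mcst cv0 iN dom.
by rewrite integral0.
Qed.

End simple_approximation.

(** * Hilbert spaces *)

Section linear_subspace.
Context {R : realType} {V : lmodType R}.
Implicit Types (W : set V) (x y : V) (a : R).

Definition linear_subspace W := W 0 /\ forall a x y, W x -> W y -> W (a *: x + y).

Lemma subspaceB W x y : linear_subspace W -> W x -> W y -> W (x - y).
Proof. by move=> [_ h] Wx Wy; rewrite addrC -scaleN1r; exact: h. Qed.

Lemma subspaceD W x y : linear_subspace W -> W x -> W y -> W (x + y).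
Proof. by move=> [_ h] Wx Wy; rewrite -(scale1r x); exact: h. Qed.

Lemma subspaceZ W a x : linear_subspace W -> W x -> W (a *: x).
Proof. by move=> [W0 h] Wx; rewrite -(addr0 (_ *: _)); exact: h. Qed.

Lemma subspace_sum W (I : Type) (r : seq I) (F : I -> V) : linear_subspace W ->
  (forall i, W (F i)) -> W (\sum_(i <- r) F i).
Proof.
move=> sW WF; elim/big_ind: _ => //; first by case: sW.
by move=> x y; exact: subspaceD.
Qed.

End linear_subspace.

Section hilbert.
Context {R : realType} {H : hilbertType R}.
Implicit Types (x y z w : H) (a : R).

Lemma dotZl a x z : dot (a *: x) z = a * dot x z.
Proof.
have := dotPl a x 0 z; rewrite addr0 => ->.
have := dotPl 1 0 0 z; rewrite scaler0 addr0 mul1r => /eqP.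
by rewrite -subr_eq0 opprD addNKr oppr_eq0 => /eqP ->; rewrite addr0.
Qed.

Lemma dotDl x y z : dot (x + y) z = dot x z + dot y z.
Proof. by have := dotPl 1 x y z; rewrite scale1r mul1r. Qed.

Lemma dotDr x y z : dot x (y + z) = dot x y + dot x z.
Proof. by rewrite dotC dotDl !(dotC x). Qed.

Lemma dotZr a x z : dot x (a *: z) = a * dot x z.
Proof. by rewrite dotC dotZl (dotC x). Qed.

Lemma dotNl x z : dot (- x) z = - dot x z.
Proof. by rewrite -scaleN1r dotZl mulN1r. Qed.

Lemma dotNr x z : dot x (- z) = - dot x z.
Proof. by rewrite dotC dotNl (dotC x). Qed.

Lemma dotBl x y z : dot (x - y) z = dot x z - dot y z.
Proof. by rewrite dotDl dotNl. Qed.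

Lemma dotBr x y z : dot x (y - z) = dot x y - dot x z.
Proof. by rewrite dotDr dotNr. Qed.

Lemma dot0l z : dot (0 : H) z = 0.
Proof. by rewrite -(scale0r 0) dotZl mul0r. Qed.

Lemma dot0r z : dot z (0 : H) = 0. Proof. by rewrite dotC dot0l. Qed.

Lemma dot_suml (I : Type) (r : seq I) (F : I -> H) z :
  dot (\sum_(i <- r) F i) z = \sum_(i <- r) dot (F i) z.
Proof. by elim/big_rec2: _ => [|i u v _ <-]; rewrite ?dot0l ?dotDl. Qed.

Lemma dot_ge0 x : 0 <= dot x x. Proof. by rewrite dot_norm sqr_ge0. Qed.

Lemma dot_eq0 x : dot x x = 0 -> x = 0.
Proof. by rewrite dot_norm => /eqP; rewrite sqrf_eq0 normr_eq0 => /eqP. Qed.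

Lemma sqr_normB x y : `|x - y| ^+ 2 = `|x| ^+ 2 - 2 * dot x y + `|y| ^+ 2.
Proof. rewrite -!dot_norm dotBl !dotBr (dotC y x); ring. Qed.

Lemma sqr_normD x y : `|x + y| ^+ 2 = `|x| ^+ 2 + 2 * dot x y + `|y| ^+ 2.
Proof. rewrite -!dot_norm dotDl !dotDr (dotC y x); ring. Qed.

Lemma dot_le_norm x y : `|dot x y| <= `|x| * `|y|.
Proof.
have [->|y0] := eqVneq y 0; first by rewrite dot0r !normr0 mulr0.
have ny : 0 < `|y| ^+ 2 by rewrite exprn_gt0 ?normr_gt0.
have := sqr_ge0 (`|x - (dot x y / `|y| ^+ 2) *: y|).
rewrite sqr_normB dotZr normrZ exprMn real_normK ?num_real//.
set c := dot x y; set n := `|y| ^+ 2 => h.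
have {}h : c ^+ 2 <= (`|x| * `|y|) ^+ 2.
  rewrite exprMn -/n -ler_pdivrMr//.
  suff <- : `|x| ^+ 2 - (`|x| ^+ 2 - 2 * (c / n * c) + (c / n) ^+ 2 * n) = c ^+ 2 / n by lra.
  by field; rewrite gt_eqF.
rewrite -(@ler_pXn2r _ 2)// ?nnegrE ?mulr_ge0//.
by rewrite real_normK ?num_real.
Qed.

Lemma cvg_dotl (u : nat -> H) w z : u n @[n --> \oo] --> w ->
  dot (u n) z @[n --> \oo] --> dot w z.
Proof.
move=> uw; apply/cvgrPdist_le => e e0.
have e1 : 0 < e / (`|z| + 1) by rewrite divr_gt0 ?ltr_wpDl.
move/cvgrPdist_le : uw => /(_ _ e1); apply: filterS => n wn.
rewrite -dotBl (le_trans (dot_le_norm _ _))//.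
apply: (@le_trans _ _ (e / (`|z| + 1) * `|z|)); first by rewrite ler_wpM2r.
by rewrite mulrAC ler_pdivrMr ?ltr_wpDl// ler_pM2l// lerDl.
Qed.

Definition seq_closed (W : set H) := forall (u : nat -> H) w, (forall n, W (u n)) ->
  u n @[n --> \oo] --> w -> W w.

(* The minimizing sequence is Cauchy by the parallelogram law. *)
Lemma projection (W : set H) z : linear_subspace W -> exists u w,
  [/\ forall n : nat, W (u n), u n @[n --> \oo] --> w & forall v, W v -> dot (z - w) v = 0].
Proof.
move=> sW; have [W0 _] := sW.
pose D := [set `|z - w| ^+ 2 | w in W].
have D0 : lbound D 0 by move=> _ [w _ <-]; exact: sqr_ge0.
have iD : has_inf D by split; [exists (`|z - 0| ^+ 2), 0|exists 0].
pose d := inf D.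
have dle w : W w -> d <= `|z - w| ^+ 2.
  by move=> Ww; apply: ge_inf; [exists 0|exists w].
have Hu n : exists w, W w /\ `|z - w| ^+ 2 < d + n.+1%:R^-1.
  have n0 : (0 : R) < n.+1%:R^-1 by rewrite invr_gt0.
  by have [_ [w Ww <-] lt] := inf_adherent n0 iD; exists w.
have [u {}Hu] := choice Hu.
have Wu n : W (u n) by case: (Hu n).
have mid n k : `|u n - u k| ^+ 2 <= 2 * (n.+1%:R^-1 + k.+1%:R^-1).
  have := dle (2^-1 *: (u n + u k)) (subspaceZ _ sW (subspaceD sW (Wu n) (Wu k))).
  have := (Hu n).2; have := (Hu k).2.
  rewrite !sqr_normB !dotZr normrZ exprMn sqr_normD !dotDr real_normK ?num_real//.
  rewrite (_ : (2^-1 : R) ^+ 2 = 4^-1); last by field.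
  by set p := n.+1%:R^-1; set q := k.+1%:R^-1; set i := dot z (u n);
     set j := dot z (u k); set l := dot _ _ => *; lra.
have inv_small (e : R) : 0 < e -> exists n0, forall n, (n0 <= n)%N -> n.+1%:R^-1 <= e.
  move=> e0; have [n0 _ Hn0] := near_infty_natSinv_lt (PosNum e0).
  by exists n0 => n n0n; apply: ltW; exact: Hn0.
have cu : cvg (u n @[n --> \oo]).
  apply/cauchy_cvgP/cauchy_exP => e e0.
  have e1 : 0 < e ^+ 2 / 8 by rewrite divr_gt0 ?exprn_gt0.
  have [n0 Hn0] := inv_small _ e1.
  exists (u n0); exists n0 => // n /= n0n; rewrite -ball_normE /=.
  rewrite -(@ltr_pXn2r _ 2)// ?nnegrE ?(ltW e0)//.
  apply: le_lt_trans (mid _ _) _; have := Hn0 _ n0n; have := Hn0 _ (leqnn n0).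
  have e2 : 0 < e ^+ 2 by rewrite exprn_gt0.
  set p := n.+1%:R^-1; set q := n0.+1%:R^-1 => *; lra.
have [w uw] : exists w, u n @[n --> \oo] --> w by move/cvg_ex: cu.
exists u, w; split => [n|//|v Wv]; first exact: Wu.
have [->|v0] := eqVneq v 0; first by rewrite dot0r.
have nv : 0 < `|v| ^+ 2 by rewrite exprn_gt0 ?normr_gt0.
(* Moving [u n] by [(c / k) *: v] stays in [W] and lowers the squared distance by [c ^ 2 / k], while
   less than [1 / (n + 1)] is left to gain. *)
have small n : (dot (z - u n) v) ^+ 2 <= `|v| ^+ 2 * n.+1%:R^-1.
  set c := dot (z - u n) v; set k := `|v| ^+ 2.
  have := dle _ (subspaceD sW (Wu n) (subspaceZ (c / k) sW Wv)).
  rewrite opprD addrA sqr_normB dotZr -/c normrZ exprMn real_normK ?num_real// -/k.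
  have := (Hu n).2; set p := `|z - u n| ^+ 2; set q := n.+1%:R^-1 => pq h.
  rewrite mulrC -ler_pdivrMr//.
  suff : p - 2 * (c / k * c) + (c / k) ^+ 2 * k = p - c ^+ 2 / k by lra.
  by field; rewrite gt_eqF.
have c1 : dot (z - u n) v @[n --> \oo] --> dot (z - w) v.
  by apply: cvg_dotl; apply: cvgB => //; exact: cvg_cst.
have c2 : dot (z - u n) v @[n --> \oo] --> 0.
  apply/cvgrPdist_le => e e0.
  have e1 : 0 < e ^+ 2 / `|v| ^+ 2 by apply: divr_gt0 => //; exact: exprn_gt0.
  have [n0 Hn0] := inv_small _ e1; exists n0 => // n /= n0n.
  rewrite sub0r normrN -(@ler_pXn2r _ 2)// ?nnegrE ?(ltW e0)// real_normK ?num_real//.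
  by rewrite (le_trans (small n))// mulrC -ler_pdivlMr//; exact: Hn0.
by rewrite -(cvg_lim (@Rhausdorff R) c1) (cvg_lim (@Rhausdorff R) c2).
Qed.

Lemma closed_projection (W : set H) z : linear_subspace W -> seq_closed W ->
  exists w, W w /\ forall v, W v -> dot (z - w) v = 0.
Proof.
move=> sW cW; have [u [w [Wu uw orth]]] := projection z sW.
by exists w; split => //; exact: cW uw.
Qed.

(** The representing vector is normal to the kernel of [l]: it is a multiple of the residual [z - w]
    of the projection on the kernel of some [z] with [l z] nonzero. *)
Lemma riesz (l : H -> R) (c : R) : (forall a x y, l (a *: x + y) = a * l x + l y) ->
  (forall x, `|l x| <= c * `|x|) -> exists u, forall x, l x = dot x u.
Proof.
move=> lin bnd.
have l0 : l 0 = 0.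
  have := lin 1 0 0; rewrite scaler0 addr0 mul1r => /eqP.
  by rewrite -subr_eq0 opprD addNKr oppr_eq0 => /eqP.
have lZ a x : l (a *: x) = a * l x by rewrite -[a *: x]addr0 lin l0 addr0.
have lB x y : l (x - y) = l x - l y.
  by rewrite addrC -scaleN1r lin mulN1r addrC.
pose W := [set x | l x = 0].
have sW : linear_subspace W.
  by split => // a x y; rewrite /W/= => lx ly; rewrite lin lx ly mulr0 addr0.
have cW : seq_closed W.
  move=> u w Wu uw; rewrite /W/=.
  have cl : l (u n) @[n --> \oo] --> l w.
    apply/cvgrPdist_le => e e0.
    have c0 : 0 < `|c| + 1 by rewrite ltr_wpDl.
    have e1 : 0 < e / (`|c| + 1) by rewrite divr_gt0.
    move/cvgrPdist_le : uw => /(_ _ e1); apply: filterS => n wn.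
    rewrite -lB (le_trans (bnd _))//.
    apply: (@le_trans _ _ ((`|c| + 1) * `|w - u n|)).
      by rewrite ler_wpM2r// (le_trans (ler_norm c))// lerDl.
    by rewrite mulrC -ler_pdivlMr.
  rewrite -(cvg_lim (@Rhausdorff R) cl) (_ : (fun n => l (u n)) = cst 0).
    by rewrite lim_cst//; exact: Rhausdorff.
  by apply/funext => n; exact: Wu.
have [W1|nW] := pselect (forall x, l x = 0).
  by exists 0 => x; rewrite dot0r W1.
have /existsNP[z lz] := nW.
have [w [Ww orth]] := closed_projection z sW cW.
pose v := z - w.
have lv : l v != 0 by rewrite /v lB (_ : l w = 0)// subr0; exact/eqP.
have vv : dot v v != 0.
  by apply: contra_neq lv => /dot_eq0 ->.
exists ((l v / dot v v) *: v) => x; rewrite dotZr.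
have : dot v (x - (l x / l v) *: v) = 0.
  by apply: orth; rewrite /W/= lB lZ divfK// subrr.
rewrite dotBr dotZr (dotC v x) => /eqP; rewrite subr_eq0 => /eqP ->.
by field; rewrite lv vv.
Qed.

(* Zero vectors are allowed in b, so that a sequence exists in every dimension. *)
Definition parseval (I : choiceType) (K : set H) (S : set I) (b : I -> H) :=
  forall z, K z -> (\esum_(i in S) (dot z (b i) ^+ 2)%:E = (`|z| ^+ 2)%:E)%E.

(** Pythagoras' formula [dist] for finite combinations gives both bounds: with the coefficients of
    [z] it is Bessel's inequality, and with those of an approximation of [z] from the span it bounds
    the missing part of the sum. Totality puts [z] in the closure of the span. *)
Lemma parseval_total (I : choiceType) (K : set H) (S : set I) (b : I -> H) :
  linear_subspace K -> seq_closed K -> (forall i, S i -> K (b i)) ->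
  (forall i j, S i -> S j -> i != j -> dot (b i) (b j) = 0) ->
  (forall i, S i -> dot (b i) (b i) = 1 \/ b i = 0) ->
  (forall z, K z -> (forall i, S i -> dot z (b i) = 0) -> z = 0) ->
  parseval K S b.
Proof.
move=> sK cK Kb orth nrm tot z Kz.
have dist (r : seq I) (w : H) (c : I -> R) : uniq r -> (forall i, i \in r -> S i) ->
    w = \sum_(i <- r) c i *: b i ->
    `|z - w| ^+ 2 = `|z| ^+ 2 - \sum_(i <- r) (dot z (b i)) ^+ 2
      + \sum_(i <- r) (c i ^+ 2 * dot (b i) (b i) - 2 * c i * dot z (b i) + dot z (b i) ^+ 2).
  move=> + + ->; elim: r z {w Kz} => [|i r IH] z ur rS.
    by rewrite !big_nil subr0 addr0 subr0.
  rewrite !big_cons opprD addrA -/(_ - _).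
  have /andP[ir ur'] := ur.
  have rS' j : j \in r -> S j by move=> jr; apply: rS; rewrite inE jr orbT.
  have Si : S i by apply: rS; rewrite inE eqxx.
  rewrite (IH (z - c i *: b i))//.
  have dE j : j \in r -> dot (z - c i *: b i) (b j) = dot z (b j).
    move=> jr; rewrite dotBl dotZl orth ?mulr0 ?subr0//; first exact: rS'.
    by apply: contraNneq ir => ->.
  rewrite (eq_big_seq (fun j => dot z (b j) ^+ 2)); last by move=> j jr; rewrite dE.
  rewrite [X in _ + X](eq_big_seq (fun j => c j ^+ 2 * dot (b j) (b j) -
    2 * c j * dot z (b j) + dot z (b j) ^+ 2)); last by move=> j jr; rewrite dE.
  rewrite sqr_normB dotZr normrZ exprMn real_normK ?num_real// -(dot_norm (b i)).
  by ring.
have bessel (r : seq I) : uniq r -> (forall i, i \in r -> S i) ->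
    \sum_(i <- r) (dot z (b i)) ^+ 2 <= `|z| ^+ 2.
  move=> ur rS; have := dist r _ (fun i => dot z (b i)) ur rS erefl.
  rewrite [X in _ = _ + X]big_seq [X in _ = _ + X]big1 ?addr0; last first.
    move=> i ir; have [->|->] := nrm _ (rS _ ir); last by rewrite !dot0r; ring.
    by ring.
  by move=> dE; have := sqr_ge0 (`|z - \sum_(i <- r) dot z (b i) *: b i|); rewrite dE subr_ge0.
have S_seq (A : set I) : fsets S A -> exists r : seq I,
    [/\ uniq r, forall i, i \in r -> S i & A = [set` r]].
  move=> [/finite_seqP[r Ar] AS]; exists (undup r); split; rewrite ?undup_uniq//.
    by move=> i; rewrite mem_undup => ir; apply: AS; rewrite Ar.
  by rewrite Ar; apply/seteqP; split => i /=; rewrite mem_undup.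
apply/eqP; rewrite eq_le; apply/andP; split.
  apply: ge_ereal_sup => _ [A /S_seq[r [ur rS ->]] <-].
  by rewrite -fsbig_seq//= sumEFin lee_fin bessel.
pose W := [set w | exists r : seq I, [/\ uniq r, forall i, i \in r -> S i &
  exists c : I -> R, w = \sum_(i <- r) c i *: b i]].
have sW : linear_subspace W.
  split; first by exists [::]; split => //; exists (fun=> 0); rewrite big_nil.
  move=> a x y [r [ur rS [c ->]]] [r' [ur' r'S [c' ->]]].
  exists (undup (r ++ r')); split; rewrite ?undup_uniq//.
    by move=> i; rewrite mem_undup mem_cat => /orP[/rS|/r'S].
  (* Two combinations are written over a common list by giving the coefficient 0 to new indices. *)
  have ext (s s' : seq I) (k : I -> R) : uniq s -> uniq s' -> {subset s <= s'} ->
      \sum_(i <- s) k i *: b i = \sum_(i <- s') (if i \in s then k i else 0) *: b i.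
    move=> us us' ss'; rewrite [RHS](bigID (mem s))/= [X in _ + X]big1 ?addr0; last first.
      by move=> i /negbTE ->; rewrite scale0r.
    have pe : perm_eq s [seq i <- s' | i \in s].
      apply: uniq_perm => //; first exact: filter_uniq.
      by move=> i; rewrite mem_filter; case: (boolP (i \in s)) => // /ss' ->.
    rewrite -[RHS]big_filter -(perm_big _ pe) /=.
    by apply: eq_big_seq => i ->.
  exists (fun i => a * (if i \in r then c i else 0) + (if i \in r' then c' i else 0)).
  rewrite (ext r (undup (r ++ r')) c)//; last first.
  - by move=> i ir; rewrite mem_undup mem_cat ir.
  - exact: undup_uniq.
  rewrite (ext r' (undup (r ++ r')) c')//; last first.
  - by move=> i ir; rewrite mem_undup mem_cat ir orbT.
  - exact: undup_uniq.
  rewrite scaler_sumr -big_split; apply: eq_bigr => i _.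
  by rewrite scalerDl scalerA.
have WK w : W w -> K w.
  move=> [r [_ rS [c ->]]]; rewrite big_seq; elim/big_ind: _ => //; first by case: sK.
    by move=> x y; exact: subspaceD.
  by move=> i ir; apply: subspaceZ => //; apply: Kb; exact: rS.
have Wb i : S i -> W (b i).
  move=> Si; exists [:: i]; split => //; first by move=> j; rewrite inE => /eqP ->.
  by exists (fun=> 1); rewrite big_seq1 scale1r.
have [u [w [Wu uw orthw]]] := projection z sW.
have Kw : K w by apply: cK uw => n; exact: WK.
have zw : z = w.
  apply/eqP; rewrite -subr_eq0; apply/eqP; apply: tot; first exact: subspaceB.
  by move=> i Si; apply: orthw; exact: Wb.
apply/lee_addgt0Pr => e e0.
(* The bound 1 turns [|z - u n0| <= e] into the same bound for the square. *)
have e1 : 0 < Num.min 1 e by rewrite lt_min ltr01.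
move/cvgrPdist_lt: uw => /(_ _ e1)[n0 _ /(_ n0 (leqnn _))]; rewrite -zw /= => Hn.
have [r [ur rS [c uE]]] := Wu n0.
apply: (@le_trans _ _ ((\sum_(i <- r) (dot z (b i)) ^+ 2)%:E + e%:E)%E); last first.
  rewrite leeD2r//; apply: esum_ge; exists [set` r]; last by rewrite -fsbig_seq//= sumEFin.
  by split => //; apply/finite_seqP; exists r.
rewrite -EFinD lee_fin -lerBlDl.
have : `|z - u n0| ^+ 2 <= e.
  have [n1 ne] : `|z - u n0| <= 1 /\ `|z - u n0| <= e.
    by split; apply/ltW/(lt_le_trans Hn); rewrite ge_min lexx ?orbT.
  by rewrite expr2 (le_trans _ ne)// ler_piMl.
apply: le_trans; rewrite (dist r _ c ur rS uE) lerDl big_seq sumr_ge0// => i /rS/nrm[|] bi.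
  rewrite bi (_ : _ + _ = (c i - dot z (b i)) ^+ 2) ?sqr_ge0//.
  by ring.
by rewrite bi !dot0r; rewrite (_ : _ + _ = 0)//; ring.
Qed.

End hilbert.

Lemma exchange_esum (R : realType) (I J : choiceType) (S : set I) (D : set J)
    (a : I -> J -> \bar R) : (forall i j, 0 <= a i j)%E ->
  (\esum_(i in S) \esum_(j in D) a i j = \esum_(j in D) \esum_(i in S) a i j)%E.
Proof.
move=> a0; rewrite !esum_esum//.
apply/esym; rewrite [RHS](@reindex_esum _ _ _ (D `*`` fun=> S) _ (fun p => (p.2, p.1)))//.
split => [[j i] /= [Dj Si]//||[i j] /= [Si Dj]]; last by exists (j, i).
by move=> [j i] [j' i'] _ _ [-> ->].
Qed.

(** * Orthonormal bases of separable Hilbert spaces *)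

Section orthobasis.
Context {R : realType} {H : hilbertType R}.
Implicit Types (x y z w : H) (a : R).

(** A vector dependent on its predecessors has residual 0, which [nrm] sends to 0, so the index set
    stays [nat]. The last clause is the part of the equality of spans that totality uses. *)
Lemma gram_schmidt (K : set H) (d : nat -> H) : linear_subspace K -> (forall n, K (d n)) ->
  exists b : nat -> H, [/\ forall n, K (b n),
    forall i j, i != j -> dot (b i) (b j) = 0,
    forall i, dot (b i) (b i) = 1 \/ b i = 0 &
    forall z, (forall i, dot z (b i) = 0) -> forall n, dot z (d n) = 0].
Proof.
move=> sK Kd; pose nrm x := `|x|^-1 *: x.
pose step n (s : seq H) := d n - \sum_(v <- s) dot (d n) v *: v.
pose fix gs n := if n is k.+1 then rcons (gs k) (nrm (step k (gs k))) else [::].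
pose b n := nrm (step n (gs n)).
have gsE n : gs n = mkseq b n.
  by elim: n => [//|n IH]; rewrite mkseqS -IH.
pose r n := d n - \sum_(i < n) dot (d n) (b i) *: b i.
have bE n : b n = nrm (r n).
  rewrite /b /step gsE /mkseq big_map /r; congr (nrm (_ - _)).
  by rewrite -[n in iota 0 n]subn0 -/(index_iota 0 n) big_mkord.
have rE n : r n = `|r n| *: b n.
  rewrite bE /nrm scalerA; have [->|r0] := eqVneq (r n) 0; first by rewrite scaler0.
  by rewrite divff ?normr_eq0// scale1r.
have nb n : dot (b n) (b n) = 1 \/ b n = 0.
  rewrite bE /nrm; have [->|r0] := eqVneq (r n) 0; first by right; rewrite scaler0.
  by left; rewrite dotZl dotZr dot_norm; field; rewrite normr_eq0.
have orth n i : (i < n)%N -> dot (b n) (b i) = 0.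
  elim/ltn_ind: n i => n IH i lin.
  rewrite bE /nrm dotZl; suff -> : dot (r n) (b i) = 0 by rewrite mulr0.
  rewrite /r dotBl dot_suml (bigD1 (Ordinal lin))//= big1; last first.
    move=> [j jn] /=; rewrite -val_eqE /= => ji; rewrite dotZl.
    have [lij|lji|/eqP] := ltngtP i j; first by rewrite IH ?mulr0.
      by rewrite (dotC (b j)) IH ?mulr0.
    by rewrite eq_sym (negbTE ji).
  rewrite addr0 dotZl; have [->|->] := nb i; first by rewrite mulr1 subrr.
  by rewrite !dot0r mulr0 subr0.
exists b; split => // [n|i j|z zb n].
- elim/ltn_ind: n => n IH; rewrite bE; apply: subspaceZ => //.
  by rewrite /r; apply: subspaceB => //; apply: subspace_sum => // -[i lin]; apply: subspaceZ => //; exact: IH.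
- by rewrite neq_ltn => /orP[ij|ij]; [rewrite dotC|]; exact: orth.
- rewrite (_ : d n = r n + \sum_(i < n) dot (d n) (b i) *: b i); last by rewrite subrK.
  rewrite dotDr rE dotZr zb mulr0 add0r dotC dot_suml big1// => i _.
  by rewrite dotZl (dotC _ z) zb mulr0.
Qed.

Hypothesis H_sep : separable H.

Lemma dense_sequence : exists d : nat -> H, forall x (e : R), 0 < e -> exists n, `|x - d n| < e.
Proof.
have [S /countable_injP[f finj] dS] := H_sep.
pose d n := xget 0 [set s | S s /\ f s = n].
exists d => x e e0.
have [|y [yb Sy]] := dS (ball x e) _ (ball_open x e); first by exists x; exact: ballxx.
exists (f y); rewrite (_ : d (f y) = y); first by move: yb; rewrite -ball_normE.
rewrite /d; case: xgetP => [z _ [Sz fz]|/(_ y)]; last by case.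
by apply: finj; rewrite ?inE.
Qed.

(** Gram-Schmidt is applied to the projections on [K] of a dense sequence [d]. A vector [z] of [K]
    orthogonal to the result is orthogonal to every [d n], so [|z - d n| >= |z|], which density
    excludes unless [z = 0]. *)
Lemma basis_sequence (K : set H) : linear_subspace K -> seq_closed K ->
  exists b : nat -> H, [/\ forall n, K (b n),
    forall i j, i != j -> dot (b i) (b j) = 0,
    forall i, dot (b i) (b i) = 1 \/ b i = 0 &
    forall z, K z -> (forall i, dot z (b i) = 0) -> z = 0].
Proof.
move=> sK cK; have [d dd] := dense_sequence.
have [p Hp] := choice (fun n => closed_projection (d n) sK cK).
have [b [Kb orth nb tot]] := gram_schmidt sK (fun n => (Hp n).1).
exists b; split => // z Kz zb; apply/eqP; apply: contraT => z0.
have nz : 0 < `|z| by rewrite normr_gt0.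
have [n] := dd z _ nz.
have zd : dot z (d n) = 0.
  by rewrite -(subrK (p n) (d n)) dotDr tot// addr0 dotC (Hp n).2.
have : `|z| ^+ 2 <= `|z - d n| ^+ 2.
  by rewrite sqr_normB zd mulr0 subr0 lerDl sqr_ge0.
by rewrite ler_pXn2r ?nnegrE// leNgt => /negbTE ->.
Qed.

Lemma subspaceT : linear_subspace [set: H]. Proof. by []. Qed.

Lemma seq_closedT : seq_closed [set: H]. Proof. by []. Qed.

Lemma parseval_sequence : exists b : nat -> H, parseval setT setT b.
Proof.
have [b [_ orth nb tot]] := basis_sequence subspaceT seq_closedT.
exists b; apply: parseval_total => //.
- by move=> i j _ _; exact: orth.
- by move=> z _ zb; apply: tot => // i; exact: zb.
Qed.

(** [hs_norm2] ranges over sets of unit vectors; dropping the zero terms of the sequence gives one,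
    so that the supremum is over a nonempty family. *)
Lemma basis_set (K : set H) : linear_subspace K -> seq_closed K ->
  exists B : set H, [/\ B `<=` K, forall x y, B x -> B y -> dot x y = (x == y)%:R &
    forall z, K z -> (forall b, B b -> dot z b = 0) -> z = 0].
Proof.
move=> sK cK; have [b [Kb orth nb tot]] := basis_sequence sK cK.
exists [set x | x != 0 /\ exists n, b n = x]; split.
- by move=> x [_ [n <-]].
- move=> x y [x0 [n xE]] [y0 [k yE]]; move: x0 y0; rewrite -{}xE -{}yE => bn0 bk0; have [->|nk] := eqVneq n k.
    by rewrite eqxx; case: (nb k) => // bk; rewrite bk eqxx in bk0.
  rewrite orth//; case: eqP => // bnk.
  have := orth _ _ nk; rewrite bnk => /dot_eq0 bk; by rewrite bk eqxx in bk0.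
- move=> z Kz zB; apply: tot => // i; have [->|bi0] := eqVneq (b i) 0.
    by rewrite dot0r.
  by apply: zB; split => //; exists i.
Qed.

End orthobasis.

(** * Matrix coefficients of operators *)

Section hilbert_schmidt_coordinates.
Context {R : realType} {H G : hilbertType R}.

Definition bounded_linear (T : H -> G) :=
  (forall a x y, T (a *: x + y) = a *: T x + T y) /\
  exists c : R, forall x, `|T x| ^+ 2 <= c * `|x| ^+ 2.

Lemma bounded_linear_norm T : bounded_linear T ->
  exists2 c : R, 0 <= c & forall x, `|T x| <= c * `|x|.
Proof.
move=> [_ [c Hc]]; exists (`|c| + 1); first by rewrite addr_ge0.
move=> x; rewrite -(@ler_pXn2r _ 2)// ?nnegrE ?mulr_ge0 ?addr_ge0//.
rewrite (le_trans (Hc x))// exprMn ler_wpM2r ?sqr_ge0//.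
rewrite (le_trans (ler_norm c))//; have := normr_ge0 c; nra.
Qed.

Lemma adjoint_exists T g : bounded_linear T -> exists u, forall x, dot (T x) g = dot x u.
Proof.
move=> bT; have [c c0 Hc] := bounded_linear_norm bT; have [lin _] := bT.
apply: (@riesz _ _ _ (c * `|g|)) => [a x y|x]; first by rewrite lin dotPl.
by rewrite (le_trans (dot_le_norm _ _))// mulrAC ler_wpM2r.
Qed.

Variable g : nat -> G.
Hypothesis g_parseval : parseval setT setT g.

(** Expanding [|T (b i)|^2] in [g] and exchanging the sums leaves the sum of the [|T' k|^2], where
    [T' k] is the adjoint image of [g k]. It does not involve [b], so all Parseval families of [K]
    give the same value. *)
Lemma hs_esum (T : H -> G) (K : set H) (I : choiceType) (S : set I) (b : I -> H) (T' : nat -> H) :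
  (forall x k, dot (T x) (g k) = dot x (T' k)) -> (forall k, K (T' k)) ->
  parseval K S b ->
  (\esum_(i in S) (`|T (b i)| ^+ 2)%:E = \esum_(k in setT) (`|T' k| ^+ 2)%:E)%E.
Proof.
move=> adj KT' pb; under eq_esum => i _ do rewrite -g_parseval//.
rewrite exchange_esum; last by move=> i j; rewrite lee_fin sqr_ge0.
apply: eq_esum => k _; rewrite -pb//; apply: eq_esum => i _.
by rewrite adj dotC.
Qed.

(* nat encodes nat * nat, so that the matrix of an operator is a real sequence. *)
Definition pair_fst (b : nat -> H) (i : nat) : H :=
  if @pickle_inv (nat * nat)%type i is Some p then b p.1 else 0.
Definition pair_snd (i : nat) : G :=
  if @pickle_inv (nat * nat)%type i is Some p then g p.2 else 0.

Definition hs_coef (b : nat -> H) (T : H -> G) i := dot (T (pair_fst b i)) (pair_snd i).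

Lemma hs_coefE b T :
  (\sum_(i <oo) (hs_coef b T i ^+ 2)%:E = \esum_(j in setT) (`|T (b j)| ^+ 2)%:E)%E.
Proof.
under eq_esum => i _ do rewrite -g_parseval//.
rewrite esum_esum; last by move=> i j _ _; rewrite lee_fin sqr_ge0.
rewrite nneseries_esumT; last by move=> i; rewrite lee_fin sqr_ge0.
(* Numbers that encode no pair have second vector 0 and contribute nothing. *)
transitivity (\esum_(i in range (@pickle (nat * nat)%type)) (hs_coef b T i ^+ 2)%:E)%E.
  rewrite [RHS]esum_mkcond; apply: eq_esum => i _.
  case: ifPn => //; rewrite notin_setE => ni.
  rewrite /hs_coef /pair_snd; case ip : pickle_inv => [p|]; last by rewrite dot0r expr0n.
  exfalso; apply: ni; exists p => //; have := @pickle_invK (nat * nat)%type i.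
  by rewrite ip.
rewrite (@reindex_esum _ _ _ (setT `*`` (fun=> setT)) _ (@pickle (nat * nat)%type)).
  apply: eq_esum => -[j k] _.
  by rewrite /hs_coef /pair_fst /pair_snd pickleK_inv.
split => [p _|p q _ _ /(pcan_inj (@pickleK _))//|_ [p _ <-]]; first by exists p.
by exists p.
Qed.

End hilbert_schmidt_coordinates.

(** * Hilbert-Schmidt norms in coordinates *)

Lemma ereal_sup_cst (R : realType) (T : Type) (S : set T) (f : T -> \bar R) (x : \bar R) :
  S !=set0 -> (forall t, S t -> f t = x) -> ereal_sup [set f t | t in S] = x.
Proof.
move=> [t St] fx; apply/le_anti/andP; split.
  by apply: ge_ereal_sup => _ [s Ss <-]; rewrite fx.
by apply: ereal_sup_ubound; exists t => //; exact: fx.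
Qed.

Lemma l2norm_lin_lty d (T : measurableType d) (R : realType) (m : {measure set T -> \bar R})
    (a : R) (f h : T -> R) : measurable_fun setT f -> measurable_fun setT h ->
  (l2norm m f < +oo)%E -> (l2norm m h < +oo)%E ->
  (l2norm m (fun x => a * f x + h x)%R < +oo)%E.
Proof.
move=> mf mh foo hoo.
have maf : measurable_fun setT (fun x => a * f x)%R by exact: measurable_funM.
apply: le_lt_trans (l2norm_triangle m maf mh) _; apply: lte_add_pinfty => //.
move: foo; rewrite !l2norm_lty => foo.
under eq_integral do rewrite exprMn EFinM.
rewrite ge0_integralZl//.
- by rewrite lte_mul_pinfty// lee_fin sqr_ge0.
- by apply/measurable_EFinP; exact: measurable_funX.
Qed.

Section hilbert_schmidt_norm.
Context {R : realType} {H G : hilbertType R}.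
Variables (g : nat -> G) (b : nat -> H).
Hypotheses (g_parseval : parseval setT setT g) (b_parseval : parseval setT setT b).
Hypothesis H_sep : separable H.

Let count := sigma_counting R.

Lemma l2norm_count (c : nat -> R) :
  l2norm count c = ((\sum_(i <oo) (c i ^+ 2)%:E) `^ 2^-1)%E.
Proof. by rewrite /l2norm [X in (X `^ _)%E](@ge0_integral_count R). Qed.

Lemma hs_norm2_setT (T : H -> G) : bounded_linear T ->
  hs_norm2 setT dot T = (\sum_(i <oo) (hs_coef g b T i ^+ 2)%:E)%E.
Proof.
move=> bT; have [T' adj] := choice (fun k => adjoint_exists (g k) bT).
have adjT x k : dot (T x) (g k) = dot x (T' k) by [].
rewrite hs_coefE// (@hs_esum _ _ _ _ g_parseval T setT _ setT b T')//.
apply: ereal_sup_cst.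
  have [B [_ oB tB]] := basis_set H_sep (@subspaceT _ _) (@seq_closedT _ _).
  by exists B; split => // x _ xB; apply: tB.
move=> B [_ oB tB]; apply: (@hs_esum _ _ _ _ g_parseval T setT _ B id T') => //.
apply: parseval_total => //.
- by move=> x y Bx By /negbTE xy; rewrite oB// xy.
- by move=> x Bx; left; rewrite oB// eqxx.
Qed.

Variable A : H -> H.
Hypotheses (linA : linear A) (contA : continuous A).

Let ip (x y : H) : R := dot (pseudo_inverse A x) (pseudo_inverse A y).

(** [A] is an isometry from this space onto [range A] with the inner product [ip], and
    [pseudo_inverse A] is its inverse. *)
Definition ker_orth : set H := [set x | forall z, A z = 0 -> dot x z = 0].

Lemma ker_orth_subspace : linear_subspace ker_orth.
Proof.
split=> [z _|a x y Kx Ky z Az]; first by rewrite dot0l.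
by rewrite dotPl Kx// Ky// mulr0 addr0.
Qed.

Lemma ker_orth_closed : seq_closed ker_orth.
Proof.
move=> u w Ku uw z Az; have := cvg_dotl (z := z) uw.
rewrite (_ : (fun n => _) = cst 0); last by apply/funext => n; exact: Ku.
by move=> /cvg_unique; apply => //; exact: cvg_cst.
Qed.

Lemma linearD0 : A 0 = 0 /\ forall x y, A (x - y) = A x - A y.
Proof.
have A0 : A 0 = 0.
  have := linA 1 0 0; rewrite scaler0 addr0 scale1r => /eqP.
  by rewrite -subr_eq0 opprD addNKr oppr_eq0 => /eqP.
by split => // x y; rewrite addrC -scaleN1r linA scaleN1r addrC.
Qed.

Lemma ker_orth_proj h : exists p, ker_orth p /\ A p = A h.
Proof.
have [A0 AB] := linearD0.
have sW : linear_subspace [set z | A z = 0].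
  by split => //= a x y Ax Ay; rewrite linA Ax Ay scaler0 addr0.
have cW : seq_closed [set z | A z = 0].
  move=> u w Au uw /=.
  have : A (u n) @[n --> \oo] --> A w by apply: continuous_cvg => //; exact: contA.
  rewrite (_ : (fun n => A (u n)) = cst 0); last by apply/funext => n; exact: Au.
  move=> /cvg_unique; apply => //; exact: cvg_cst.
have [w [Aw orth]] := closed_projection h sW cW.
exists (h - w); split; first by move=> z Az; exact: orth.
by rewrite AB (Aw : A w = 0) subr0.
Qed.

Lemma pseudo_inverseP h : ker_orth (pseudo_inverse A (A h)) /\ A (pseudo_inverse A (A h)) = A h.
Proof.
have [p [Kp Ap]] := ker_orth_proj h; rewrite /pseudo_inverse.
by case: xgetP => [x _ [] //|/(_ p)]; case.
Qed.

Lemma pseudo_inverseK x : ker_orth x -> pseudo_inverse A (A x) = x.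
Proof.
move=> Kx; have [Kp Ap] := pseudo_inverseP x; apply/eqP; rewrite -subr_eq0; apply/eqP.
apply: dot_eq0; have [_ AB] := linearD0.
by apply: (subspaceB ker_orth_subspace) => //; rewrite AB Ap subrr.
Qed.

Lemma pseudo_inverse_norm h : `|pseudo_inverse A (A h)| ^+ 2 <= `|h| ^+ 2.
Proof.
have [Kp Ap] := pseudo_inverseP h; set p := pseudo_inverse _ _ in Kp Ap *.
have [_ AB] := linearD0.
rewrite -[in leRHS](subrK p h) sqr_normD (dotC (h - p)) Kp; last by rewrite AB Ap subrr.
by rewrite mulr0 addr0 lerDr sqr_ge0.
Qed.

Definition range_bounded (L : H -> G) :=
  (forall a x y, range A x -> range A y -> L (a *: x + y) = a *: L x + L y) /\
  exists c : R, forall x, range A x -> `|L x| ^+ 2 <= c * ip x x.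

Lemma range_bounded_linear L : range_bounded L -> bounded_linear (L \o A).
Proof.
move=> [linL [c Hc]]; split=> [a x y /=|].
  by rewrite linA linL//.
exists `|c| => x /=; rewrite (le_trans (Hc (A x) _))//.
rewrite /ip dot_norm (@le_trans _ _ (`|c| * `|pseudo_inverse A (A x)| ^+ 2))//.
  by rewrite ler_wpM2r ?sqr_ge0 ?ler_norm.
by rewrite ler_wpM2l// pseudo_inverse_norm.
Qed.

(** Orthonormal bases of [range A] for [ip] correspond through [A] to those of [ker_orth], and the
    adjoint images of the [g k] lie in [ker_orth] because [L \o A] vanishes on the kernel. Every
    basis thus gives the same sum as the fixed sequence [b] of the whole space. *)
Lemma hs_norm2_range L : range_bounded L ->
  hs_norm2 (range A) ip L = (\sum_(i <oo) (hs_coef g b (L \o A) i ^+ 2)%:E)%E.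
Proof.
move=> bL; have bT := range_bounded_linear bL.
have [A0 AB] := linearD0.
have [T' adj] := choice (fun k => adjoint_exists (g k) bT).
have adjT x k : dot ((L \o A) x) (g k) = dot x (T' k) by [].
have L0 : L 0 = 0.
  have [linL _] := bL; have := linL 1 0 0; rewrite scaler0 addr0 scale1r.
  have rA0 : range A 0 by exists 0.
  by move=> /(_ rA0 rA0)/eqP; rewrite -subr_eq0 opprD addNKr oppr_eq0 => /eqP.
have KT' k : ker_orth (T' k).
  by move=> z Az; rewrite dotC -adj /= Az L0 dot0l.
rewrite hs_coefE// (@hs_esum _ _ _ _ g_parseval (L \o A) setT _ setT b T')//.
apply: ereal_sup_cst.
  have [B [BK oB tB]] := basis_set H_sep ker_orth_subspace ker_orth_closed.
  exists (A @` B); split.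
  - by move=> _ [x _ <-]; exists x.
  - move=> _ _ [x Bx <-] [y By <-]; rewrite /ip !pseudo_inverseK ?oB//; [|exact: BK..].
    congr (_ %:R); congr nat_of_bool; apply/eqP/eqP => [->//|].
    by move=> /(congr1 (pseudo_inverse A)); rewrite !pseudo_inverseK//; exact: BK.
  - move=> _ [h _ <-] ortho; have [Kp Ap] := pseudo_inverseP h.
    rewrite -Ap (tB _ Kp) // => x Bx; rewrite -(pseudo_inverseK (BK _ Bx)).
    by apply: ortho; exists x.
move=> B [BA oB tB].
rewrite -(@hs_esum _ _ _ _ g_parseval (L \o A) ker_orth _ B (pseudo_inverse A) T')//.
  by apply: eq_esum => y /BA[h _ <-] /=; have [_ ->] := pseudo_inverseP h.
apply: parseval_total.
- exact: ker_orth_subspace.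
- exact: ker_orth_closed.
- by move=> y /BA[h _ <-]; case: (pseudo_inverseP h).
- by move=> x y Bx By /negbTE xy; have := oB _ _ Bx By; rewrite xy.
- by move=> x Bx; left; have := oB _ _ Bx Bx; rewrite eqxx.
- move=> z Kz zB; rewrite -(pseudo_inverseK Kz) (tB (A z))//; last first.
    by move=> y By; rewrite /ip pseudo_inverseK// zB.
  by rewrite -A0 pseudo_inverseK//; case: ker_orth_subspace.
Qed.

Lemma HS_rangeP L : HS (range A) ip L <->
  range_bounded L /\ (l2norm count (hs_coef g b (L \o A)) < +oo)%E.
Proof.
have e2 : (2^-1 : R) != 0 by rewrite invr_neq0.
split=> [[linL bndL hsL]|[bL hsL]].
  have bL : range_bounded L by [].
  by split => //; rewrite l2norm_count -hs_norm2_range//; exact: poweR_lty.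
case: (bL) => ? ?; split => //; rewrite hs_norm2_range//.
by move: hsL; rewrite l2norm_count; exact: lty_poweRy.
Qed.

Lemma hs_norm_range L : range_bounded L ->
  hs_norm (range A) ip L = l2norm count (hs_coef g b (L \o A)).
Proof. by move=> bL; rewrite /hs_norm hs_norm2_range// l2norm_count. Qed.

Lemma hs_coef_lin a (L L' : H -> G) i :
  hs_coef g b ((a *: L + L') \o A) i = a * hs_coef g b (L \o A) i + hs_coef g b (L' \o A) i.
Proof. by rewrite /hs_coef /= dotPl. Qed.

Lemma range_bounded_lin a (L L' : H -> G) :
  range_bounded L -> range_bounded L' -> range_bounded (a *: L + L').
Proof.
move=> [lL [c Hc]] [lL' [c' Hc']]; have E x : (a *: L + L') x = a *: L x + L' x by [].
split.
  move=> k x y Ax Ay; rewrite !E lL// lL'//.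
  rewrite scalerDr !scalerA (mulrC a k) -!scalerA scalerDr.
  by rewrite addrACA.
exists (2 * (a ^+ 2 * c) + 2 * c') => x Ax; rewrite E.
apply: (@le_trans _ _ (2 * `|a *: L x| ^+ 2 + 2 * `|L' x| ^+ 2)).
  have := sqr_ge0 (`|a *: L x - L' x|).
  rewrite sqr_normB sqr_normD; lra.
rewrite normrZ exprMn real_normK ?num_real//.
have h1 := Hc _ Ax; have h2 := Hc' _ Ax; have := sqr_ge0 a.
set q := a ^+ 2; set n := `|L x| ^+ 2 in h1 *; set n' := `|L' x| ^+ 2 in h2 *.
by move=> q0; have := ler_wpM2l q0 h1; lra.
Qed.

Lemma HS_range_lin a (L L' : H -> G) :
  HS (range A) ip L -> HS (range A) ip L' -> HS (range A) ip (a *: L + L').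
Proof.
move=> /HS_rangeP[bL hL] /HS_rangeP[bL' hL']; apply/HS_rangeP; split.
  exact: range_bounded_lin.
rewrite (_ : hs_coef g b _ = fun i => a * hs_coef g b (L \o A) i + hs_coef g b (L' \o A) i).
  exact: l2norm_lin_lty.
by apply/funext => i; exact: hs_coef_lin.
Qed.

Lemma HS_range0 : HS (range A) ip (0 : H -> G).
Proof.
apply/HS_rangeP; split.
  have E x : (0 : H -> G) x = 0 by [].
  split=> [a x y _ _|]; first by rewrite !E scaler0 addr0.
  by exists 0 => x _; rewrite E normr0 expr0n mul0r.
rewrite l2norm_lty integral0_eq// => i _.
by rewrite /hs_coef dot0l expr0n.
Qed.

End hilbert_schmidt_norm.

(** * Minkowski's integral inequality *)

Lemma integrable_indic_lty d (T : measurableType d) (R : realType)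
    (mu : {measure set T -> \bar R}) (B : set T) :
  measurable B -> (mu B < +oo)%E -> mu.-integrable setT (fun x => (\1_B x)%:E).
Proof.
move=> mB Boo; apply/integrableP; split; first by apply/measurable_EFinP; exact: measurable_indic.
under eq_integral do rewrite gee0_abs ?lee_fin//.
by rewrite integral_indic// setIT.
Qed.

Section integral_minkowski.
Local Open Scope ereal_scope.
Context d1 d2 (X : measurableType d1) (E : measurableType d2) (R : realType).
Variable m : {sigma_finite_measure set X -> \bar R}.
Variable rho : {sigma_finite_measure set E -> \bar R}.

Lemma lee_of_sqr (x y : \bar R) : 0 <= x -> 0 <= y -> x * x <= y * y -> x <= y.
Proof.
case: x => [x||//]; case: y => [y||//] x0 y0; rewrite ?leey//.
rewrite -!EFinM !lee_fin -!expr2 in x0 y0 *.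
by rewrite ler_pXn2r ?nnegrE.
Qed.

Lemma le_sqr_l2norm d (T : measurableType d) (mu : {measure set T -> \bar R}) (h : T -> R)
    (a : \bar R) : 0 <= a -> \int[mu]_x (h x ^+ 2)%:E <= a * a -> l2norm mu h <= a.
Proof. by move=> a0; rewrite -sqr_l2norm; apply: lee_of_sqr. Qed.

Section one_function.
Variable f : X * E -> R.
Hypothesis mf : measurable_fun setT f.

Let N e := l2norm m (fun x => f (x, e)).

Let absf z := `|f z|%R.
Let mabsf : measurable_fun setT absf. Proof. exact: measurableT_comp. Qed.

Lemma l2norm_abs e : l2norm m (fun x => `|f (x, e)|)%R = N e.
Proof.
by congr (_ `^ _); apply: eq_integral => x _; rewrite real_normK ?num_real.
Qed.

Lemma minkowski_abs :
  \int[m]_x (\int[rho]_e (`|f (x, e)|)%:E * \int[rho]_e (`|f (x, e)|)%:E) <=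
  \int[rho]_e N e * \int[rho]_e N e.
Proof.
have := @minkowski_integral _ _ _ _ _ m rho absf mabsf (fun z => normr_ge0 _).
by under [X in _ <= X * X -> _]eq_integral do rewrite l2norm_abs.
Qed.

(** By Minkowski's inequality the square of [F x], the integral of [|f (x, e)|] over [e], has finite
    integral, so it is finite for almost every [x]. *)
Lemma ae_integrable_section : \int[rho]_e N e < +oo ->
  {ae m, forall x, rho.-integrable setT (fun e => (f (x, e))%:E)}.
Proof.
move=> Noo; pose F x := \int[rho]_e (`|f (x, e)|)%:E.
have F0 x : 0 <= F x by apply: integral_ge0 => e _; rewrite lee_fin.
have mF : measurable_fun setT F.
  have mE : measurable_fun setT (EFin \o absf) by exact/measurable_EFinP.
  apply: (@measurable_fun_fubini_tonelli_F _ _ _ _ _ rho (EFin \o absf) mE) => z.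
  by rewrite /= lee_fin /absf.
have iFF : m.-integrable setT (fun x => F x * F x).
  apply/integrableP; split; first exact: emeasurable_funM.
  rewrite (eq_integral (fun x => F x * F x)); last by move=> x _; rewrite gee0_abs// mule_ge0.
  apply: le_lt_trans minkowski_abs _; apply: lte_mul_pinfty => //.
    by apply: integral_ge0 => e _; exact: l2norm_ge0.
  by rewrite ge0_fin_numE// integral_ge0// => e _; exact: l2norm_ge0.
have := integrable_ae measurableT iFF; apply: filterS => x /(_ Logic.I) FF.
apply/integrableP; split.
  by apply/measurable_EFinP; exact: measurable_sections1.
rewrite -/(F x) ltey; apply: contraTN FF => /eqP ->.
by rewrite mulyy.
Qed.

Lemma minkowski_Rintegral :
  l2norm m (fun x => fine (\int[rho]_e (f (x, e))%:E)) <= \int[rho]_e N e.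
Proof.
apply: le_sqr_l2norm; first by apply: integral_ge0 => e _; exact: l2norm_ge0.
apply: le_trans minkowski_abs; apply: ge0_le_integralT => x //.
have mfx : measurable_fun setT (fun e => (f (x, e))%:E).
  by apply/measurable_EFinP; exact: measurable_sections1.
have := le_abse_integral rho measurableT mfx.
set I := \int[rho]_e (f (x, e))%:E => /= le_I.
(* [fine] sends an infinite integral to 0, which only lowers the left side. *)
have : (`|fine I|)%:E <= `|I| by case: I {le_I} => [r||]//=; rewrite normr0 leey.
move=> /le_trans/(_ le_I) {}le_I.
rewrite -[(_ ^+ 2)%R]real_normK ?num_real// expr2 EFinM.
by apply: lee_pmul => //; rewrite lee_fin.
Qed.

End one_function.

(** For almost every [x] the section of [f] is integrable, and the function on the left is the
    integral over [e] of [f - sample_step]; Minkowski's inequality bounds its norm by the integral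
    of the errors. *)
Lemma sample_integral_error (f : X * E -> R) (s : sample E) : measurable_fun setT f ->
  \int[rho]_e l2norm m (fun x => f (x, e)) < +oo -> good_sample m rho f s ->
  l2norm m (fun x => fine (\int[rho]_e (f (x, e))%:E) -
    \sum_(i < sample_size s) fine (rho (sample_set i)) * f (x, @sample_point _ _ s i))%R
  <= \int[rho]_e sample_error m f s e.
Proof.
move=> mf Noo gs.
apply: le_trans (minkowski_Rintegral (measurable_sample_diff mf gs)).
rewrite le_eqVlt; apply/orP; left; apply/eqP; congr (_ `^ _).
apply: ge0_ae_eq_integralT => //.
apply: filterS (ae_integrable_section mf Noo) => x ix.
congr (_ ^+ 2)%:E.
have mx := measurable_sections1 mf x.
have iB (i : 'I_(sample_size s)) : rho.-integrable setT
    (fun e => ((\1_(sample_set i) e * f (x, @sample_point _ _ s i))%R)%:E).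
  have [mB Boo _] := gs i.
  under eq_fun do rewrite mulrC EFinM.
  by apply: integrableZl => //; exact: integrable_indic_lty.
have istep : rho.-integrable setT (fun e => (sample_step f s x e)%:E).
  rewrite /sample_step; under eq_fun do rewrite -sumEFin.
  exact: integrable_sum.
apply/esym; under eq_integral do rewrite /= EFinB.
rewrite integralB//= fineB ?integrable_fin_num//; congr (_ - _)%R.
rewrite /sample_step; under eq_integral do rewrite -sumEFin.
rewrite integral_sum//= -[RHS]/(fine (_%:E)) -sumEFin; congr fine.
apply: eq_bigr => i _; have [mB Boo _] := gs i.
under eq_integral do rewrite mulrC EFinM.
rewrite integralZl//; last exact: integrable_indic_lty.
by rewrite integral_indic// setIT EFinM muleC fineK// ge0_fin_numE.
Qed.

End integral_minkowski.

(** * Bochner integrals *)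

Section bochner_functional.
Local Open Scope ereal_scope.
Context {R : realType} {V : lmodType R} {d} {E : measurableType d}.
Variables (rho : {measure set E -> \bar R}) (S : set V) (N : V -> \bar R).
Hypotheses (subS : linear_subspace S) (N0 : forall v, 0 <= N v).
Variables (l : V -> R) (c : R).
Hypotheses (c0 : (0 < c)%R)
  (lin : forall (a : R) x y, S x -> S y -> (l (a *: x + y) = a * l x + l y)%R)
  (bnd : forall x, S x -> (`|l x|)%:E <= c%:E * N x).

Let l0 : l 0%R = 0%R.
Proof.
have [S0 _] := subS; have := lin 1 S0 S0; rewrite scaler0 addr0 mul1r => /eqP.
by rewrite -subr_eq0 opprD addNKr oppr_eq0 => /eqP.
Qed.

Let lB x y : S x -> S y -> (l (x - y) = l x - l y)%R.
Proof. by move=> Sx Sy; rewrite addrC -scaleN1r lin// mulN1r addrC. Qed.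

Let l_sum n (a : 'I_n -> R) (v : 'I_n -> V) : (forall i, S (v i)) ->
  (l (\sum_(i < n) a i *: v i) = \sum_(i < n) a i * l (v i))%R.
Proof.
move=> Sv; suff [_ ->] : S (\sum_(i < n) a i *: v i)%R /\
  (l (\sum_(i < n) a i *: v i) = \sum_(i < n) a i * l (v i))%R by [].
elim/big_ind2: _ => [|x x' y y' [Sx <-] [Sy <-]|i _].
- by split; [case: subS|exact: l0].
- by split; [exact: subspaceD|rewrite -[X in (X + _)%R]scale1r lin// mul1r].
- split; first exact: subspaceZ.
  by rewrite -[X in l X]addr0 lin ?l0 ?addr0//; case: subS.
Qed.

Let step (s : bsimple rho S) (e : E) : R := (\sum_(i < bs_size s) \1_(bs_set i) e * l (bs_val i))%R.

Let step_sum (s : bsimple rho S) :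
  rho.-integrable setT (fun e => (step s e)%:E) /\
  \int[rho]_e (step s e)%:E = (l (bs_int s))%:E.
Proof.
have iB (i : 'I_(bs_size s)) : rho.-integrable setT (fun e => (\1_(bs_set i) e * l (bs_val i))%:E).
  under eq_fun do rewrite mulrC EFinM.
  apply: integrableZl => //; apply: integrable_indic_lty; [exact: bs_measurable|exact: bs_finite].
rewrite /step; split.
  by under eq_fun do rewrite -sumEFin; exact: integrable_sum.
under eq_integral do rewrite -sumEFin.
rewrite integral_sum//= /bs_int l_sum; last by move=> i; exact: bs_mem.
rewrite -sumEFin; apply: eq_bigr => i _.
under eq_integral do rewrite mulrC EFinM.
rewrite integralZl//; last first.
  by apply: integrable_indic_lty; [exact: bs_measurable|exact: bs_finite].
rewrite integral_indic//; last exact: bs_measurable.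
rewrite setIT EFinM muleC fineK// ge0_fin_numE//; exact: bs_finite.
Qed.

Let step_fun (s : bsimple rho S) e : l (bs_fun s e) = step s e.
Proof. by rewrite /bs_fun l_sum// => i; exact: bs_mem. Qed.

Let S_step (s : bsimple rho S) e : S (bs_fun s e).
Proof. by apply: subspace_sum => // i; apply: subspaceZ => //; exact: bs_mem. Qed.

Let S_int (s : bsimple rho S) : S (bs_int s).
Proof. by apply: subspace_sum => // i; apply: subspaceZ => //; exact: bs_mem. Qed.

Let near_step (s : bsimple rho S) f e : S (f e) ->
  (`|l (f e) - step s e|)%:E <= c%:E * N (f e - bs_fun s e)%R.
Proof.
move=> Sf; rewrite -step_fun -lB//; apply: bnd; exact: subspaceB.
Qed.

Lemma cvg0_small (u : nat -> \bar R) (e : R) : u n @[n --> \oo] --> 0 -> (0 < e)%R ->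
  exists n0, forall n, (n0 <= n)%N -> u n < e%:E.
Proof.
move=> cu e0.
have /cu[n0 _ Hn0] : nbhs 0 [set x : \bar R | x < e%:E].
  by apply: (open_nbhs_nbhs (conj _ _)); [exact: open_ereal_lt_ereal|rewrite /= lte_fin].
by exists n0 => n n0n; exact: (Hn0 n n0n).
Qed.

(** Off a null set [l \o f] is the limit of the steps [l (bs_fun (s n) e)], because [l] is bounded
    by [N]; on that null set it is replaced by 0. *)
Lemma bochner_functional_measurable f (s : nat -> bsimple rho S) : bochner_approx N f s ->
  exists phi : E -> R, measurable_fun setT phi /\ {ae rho, forall e, phi e = l (f e)}.
Proof.
move=> [aeS aeN _]; have [Z [mZ Z0 HZ]] := filterI aeS aeN.
have goodZ e : ~ Z e -> S (f e) /\ N (f e - bs_fun (s n) e)%R @[n --> \oo] --> 0.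
  by move=> nZ; apply: contra_notP nZ => H; apply: HZ => -[/= ? ?]; apply: H.
exists ((l \o f) \_ (~` Z))%R; split; last first.
  exists Z; split => // e /=; apply: contra_notP => nZ.
  by rewrite patchE mem_set.
apply/(measurable_restrictT _ _).1; first exact: measurableC.
apply: (measurable_fun_cvg (h := fun n => step (s n))).
  by move=> n; apply: measurable_funTS; have [/measurable_int/measurable_EFinP] := step_sum (s n).
move=> e nZ; have [Sf cN] := goodZ e nZ.
apply/cvgrPdist_le => r r0.
have [n0 Hn0] := cvg0_small cN (divr_gt0 r0 c0).
exists n0 => // n /Hn0 /ltW Hn; rewrite -lee_fin (le_trans (near_step _ Sf))//.
apply: (@le_trans _ _ (c%:E * (r / c)%:E)); first by rewrite lee_pmul2l.
by rewrite -EFinM mulrC divfK// gt_eqF.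
Qed.

(* phi is a measurable modification of l o f, which need not be measurable. *)
Lemma bochner_integral_functional f v phi : is_bochner_integral rho S N f v ->
  measurable_fun setT phi -> {ae rho, forall e, phi e = l (f e)} ->
  rho.-integrable setT (fun e => (phi e)%:E) /\ \int[rho]_e (phi e)%:E = (l v)%:E.
Proof.
move=> [Sv [s [[aeS _ cint] cv]]] mphi phiE.
have mphiE : measurable_fun setT (fun e => (phi e)%:E) by exact/measurable_EFinP.
have istep n := (step_sum (s n)).1.
have mstep n : measurable_fun setT (step (s n)).
  by have /measurable_int/measurable_EFinP := istep n.
pose I n := \int[rho]_e N (f e - bs_fun (s n) e)%R.
have dist n : \int[rho]_e (`|phi e - step (s n) e|)%:E <= c%:E * I n.
  have md : measurable_fun setT (fun e => (`|phi e - step (s n) e|)%:E).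
    by apply/measurable_EFinP; apply: measurableT_comp => //; exact: measurable_funB.
  (* The constant is put on the measurable side, since [N (f e - bs_fun (s n) e)] need not be
     measurable in [e]. *)
  have : \int[rho]_e ((c^-1)%:E * (`|phi e - step (s n) e|)%:E) <= I n.
    apply: ge0_ae_le_integral => //.
      by move=> e; rewrite -EFinM lee_fin mulr_ge0// invr_ge0 ltW.
    apply: filterS2 aeS phiE => e Sf ->.
    rewrite -(@lee_pmul2l _ c%:E)// muleA -!EFinM divff ?gt_eqF// mul1r.
    exact: near_step.
  rewrite ge0_integralZl//; last by rewrite lee_fin invr_ge0 ltW.
  by rewrite -(@lee_pmul2l _ c%:E)// muleA -EFinM divff ?gt_eqF// mul1e.
have I0 n : 0 <= I n by apply: integral_ge0.
have iphi : rho.-integrable setT (fun e => (phi e)%:E).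
  have [n0 /(_ n0 (leqnn _)) In0] := cvg0_small cint ltr01.
  apply/integrableP; split => //=.
  apply: (@le_lt_trans _ _ (\int[rho]_e ((`|phi e - step (s n0) e|)%:E + (`|step (s n0) e|)%:E))).
    apply: ge0_le_integralT => [e|e]; first by [].
    by rewrite -EFinD lee_fin -[X in `|X|%R](subrK (step (s n0) e)) ler_normD.
  rewrite ge0_integralD//; last 2 first.
  - by apply/measurable_EFinP; apply: measurableT_comp => //; exact: measurable_funB.
  - by apply/measurable_EFinP; exact: measurableT_comp.
  apply: lte_add_pinfty.
    apply: le_lt_trans (dist n0) _; apply: lte_mul_pinfty => //; first by rewrite lee_fin ltW.
    by apply: lt_trans In0 _; rewrite ltry.
  by have /integrableP[_] := istep n0.
split => //.
have ifin := integrable_fin_num measurableT iphi.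
rewrite -(fineK ifin); congr EFin; apply/eqP; rewrite -subr_eq0 -normr_eq0 eq_le normr_ge0 andbT.
apply/ler_addgt0Pr => r r0; rewrite add0r.
have r20 : (0 < r / 2 / c)%R by rewrite !divr_gt0.
have [n1 Hn1] := cvg0_small cint r20; have [n2 Hn2] := cvg0_small cv r20.
pose n := maxn n1 n2.
have {}Hn1 := Hn1 n (leq_maxl _ _); have {}Hn2 := Hn2 n (leq_maxr _ _).
have cE : (c%:E * (r / 2 / c)%:E = (r / 2)%:E) by rewrite -EFinM mulrC divfK// gt_eqF.
have d1 : (`|fine (\int[rho]_e (phi e)%:E) - l (bs_int (s n))| <= r / 2)%R.
  rewrite -lee_fin -cE; apply: (@le_trans _ _ (c%:E * I n)); last first.
    by rewrite lee_pmul2l// ltW.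
  apply: le_trans (dist n).
  rewrite -[leLHS]/(`| _%:E |) EFinB fineK// -(step_sum (s n)).2 -integralB_EFin//; last exact: istep.
  apply: le_trans (le_abse_integral rho measurableT _) _.
    by apply: emeasurable_funB => //; exact/measurable_EFinP.
  by under eq_integral do rewrite -EFinB.
have d2 : (`|l v - l (bs_int (s n))| <= r / 2)%R.
  rewrite -lB// -lee_fin -cE; apply: le_trans (bnd _) _; first exact: subspaceB.
  by rewrite lee_pmul2l// ltW.
rewrite (le_trans (ler_distD (l (bs_int (s n))) _ _))// (splitr r).
by rewrite lerD// distrC.
Qed.

Lemma bochner_integral_functional_unique f v v' : is_bochner_integral rho S N f v ->
  is_bochner_integral rho S N f v' -> l v = l v'.
Proof.
move=> fv fv'; have [_ [s [fs _]]] := fv.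
have [phi [mphi phiE]] := bochner_functional_measurable fs.
have [_ h] := bochner_integral_functional fv mphi phiE.
have [_ h'] := bochner_integral_functional fv' mphi phiE.
by move: h'; rewrite h => -[].
Qed.

End bochner_functional.

Lemma ae_l2norm_lty d1 d2 (X : measurableType d1) (E : measurableType d2) (R : realType)
    (m : {sigma_finite_measure set X -> \bar R}) (rho : {measure set E -> \bar R})
    (f : X * E -> R) : measurable_fun setT f ->
  (\int[rho]_e l2norm m (fun x => f (x, e)) < +oo)%E ->
  {ae rho, forall e, (l2norm m (fun x => f (x, e)) < +oo)%E}.
Proof.
move=> mf Noo; have mN := measurable_l2norm_section m mf.
have iN : rho.-integrable setT (fun e => l2norm m (fun x => f (x, e))).
  apply/integrableP; split => //; under eq_integral do rewrite gee0_abs ?l2norm_ge0//.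
  exact: Noo.
have := integrable_ae measurableT iN; apply: filterS => e /(_ Logic.I).
by rewrite ge0_fin_numE ?l2norm_ge0.
Qed.

Section bochner_samples.
Local Open Scope ereal_scope.
Context d1 d2 (X : measurableType d1) (E : measurableType d2) (R : realType).
Variable m : {sigma_finite_measure set X -> \bar R}.
Variable rho : {sigma_finite_measure set E -> \bar R}.
Variable f : X * E -> R.
Hypothesis mf : measurable_fun setT f.
Hypothesis f_fin : \int[rho]_e l2norm m (fun x => f (x, e)) < +oo.
Context {V : lmodType R}.
Variables (S : set V) (N : V -> \bar R) (F : E -> V).
Hypothesis N0 : forall v, 0 <= N v.
Hypothesis FS : forall e, l2norm m (fun x => f (x, e)) < +oo -> S (F e).
Hypothesis FN : forall s, good_sample m rho f s -> forall e,
  l2norm m (fun x => f (x, e)) < +oo ->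
  N (F e - \sum_(i < sample_size s) \1_(sample_set i) e *: F (@sample_point _ _ s i))%R
  = sample_error m f s e.

Definition sample_bsimple s (gs : good_sample m rho f s) : bsimple rho S :=
  @BSimple _ _ _ _ rho S (sample_size s) (@sample_set _ _ s)
    (fun i => F (@sample_point _ _ s i))
    (fun i => let: And3 p _ _ := gs i in p) (fun i => let: And3 _ p _ := gs i in p)
    (fun i => FS (let: And3 _ _ p := gs i in p)).

(** [FN] says that [F] has the same distances to sampled steps as [f]. It serves twice: at a fixed
    point of the slab, with [m] the counting measure and operator values, and for the stochastic
    integrals, with [m] the measure [coord_measure]. *)
Lemma bochner_approx_samples : exists (s : nat -> sample E)
    (gs : forall n, good_sample m rho f (s n)),
  bochner_approx N F (fun n => sample_bsimple (gs n)) /\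
  \int[rho]_e sample_error m f (s n) e @[n --> \oo] --> 0.
Proof.
have [s [gs cv ci]] := sample_approximation mf f_fin.
have ae_fin := ae_l2norm_lty mf f_fin.
exists s, gs; split => //; split.
- by apply: filterS ae_fin; exact: FS.
- apply: filterS ae_fin => e Ne; have := cv e Ne.
  by under eq_fun do rewrite -(FN (gs _) Ne).
- rewrite (_ : (fun n => _) = (fun n => \int[rho]_e sample_error m f (s n) e)) //.
  apply/funext => n; apply: ge0_ae_eq_integralT => //.
    by move=> e; exact: sample_error_ge0.
  by apply: filterS ae_fin => e Ne; exact: FN.
Qed.

Lemma bochner_integrable_samples : bochner_integrable rho S N F.
Proof.
have [s [gs [h _]]] := bochner_approx_samples.
by exists (fun n => sample_bsimple (gs n)).
Qed.

(** It is enough that [v] be as close to the integral of each sampled step as the pointwise integral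
    of [f] is, since the latter distance is at most the integral of the errors. *)
Lemma is_bochner_integral_samples v : S v ->
  (forall s, good_sample m rho f s ->
    N (v - \sum_(i < sample_size s) fine (rho (sample_set i)) *: F (@sample_point _ _ s i))%R
    <= l2norm m (fun x => fine (\int[rho]_e (f (x, e))%:E) -
      \sum_(i < sample_size s) fine (rho (sample_set i)) * f (x, @sample_point _ _ s i))%R) ->
  is_bochner_integral rho S N F v.
Proof.
move=> Sv Nv; have [s [gs [h ci]]] := bochner_approx_samples.
split => //; exists (fun n => sample_bsimple (gs n)); split => //.
apply: (@squeeze_cvge _ _ _ _ (cst 0) _ (fun n => \int[rho]_e sample_error m f (s n) e)) => //.
  apply: nearW => n; rewrite N0/=; apply: le_trans (Nv _ (gs n)) _.
  exact: sample_integral_error.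
exact: cvg_cst.
Qed.

End bochner_samples.

Section bochner_map.
Local Open Scope ereal_scope.
Context {R : realType} {V V' : lmodType R} {d} {E : measurableType d}.
Variables (rho : {measure set E -> \bar R}) (S : set V) (N : V -> \bar R).
Variables (S' : set V') (N' : V' -> \bar R) (t : V -> V').
Hypotheses (N'0 : forall v, 0 <= N' v) (tlin : linear t)
  (tS : forall v, S v -> S' (t v)) (tN : forall v, N' (t v) <= N v).

Definition bsimple_map (s : bsimple rho S) : bsimple rho S' :=
  @BSimple _ _ _ _ rho S' (bs_size s) (@bs_set _ _ _ _ _ _ s) (fun i => t (bs_val i))
    (@bs_measurable _ _ _ _ _ _ s) (@bs_finite _ _ _ _ _ _ s) (fun i => tS (bs_mem i)).

Let t_sum n (a : 'I_n -> R) (v : 'I_n -> V) :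
  t (\sum_(i < n) a i *: v i)%R = (\sum_(i < n) a i *: t (v i))%R.
Proof.
have t0 : t 0%R = 0%R.
  have := tlin 1%R 0%R 0%R; rewrite scaler0 addr0 scale1r => /eqP.
  by rewrite -subr_eq0 opprD addNKr oppr_eq0 => /eqP.
elim/big_ind2: _ => [//|x x' y y' <- <-|i _].
  by rewrite -[X in (X + _)%R]scale1r tlin scale1r.
by rewrite -[X in t X]addr0 tlin t0 addr0.
Qed.

Let tB x y : t (x - y)%R = (t x - t y)%R.
Proof. by rewrite addrC -scaleN1r tlin scaleN1r addrC. Qed.

Lemma is_bochner_integral_map f v : is_bochner_integral rho S N f v ->
  is_bochner_integral rho S' N' (t \o f) (t v).
Proof.
move=> [Sv [s [[aeS aeN ci] cv]]]; split; first exact: tS.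
exists (fun n => bsimple_map (s n)).
have funE n e : bs_fun (bsimple_map (s n)) e = t (bs_fun (s n) e) by rewrite /bs_fun t_sum.
have intE n : bs_int (bsimple_map (s n)) = t (bs_int (s n)) by rewrite /bs_int t_sum.
have le_fun n e : N' ((t \o f) e - bs_fun (bsimple_map (s n)) e)%R <=
    N (f e - bs_fun (s n) e)%R by rewrite funE /= -tB.
have sq (u w : nat -> \bar R) : (forall n, 0 <= w n) -> (forall n, w n <= u n) ->
    u n @[n --> \oo] --> 0 -> w n @[n --> \oo] --> 0.
  move=> w0 wu cu; apply: (@squeeze_cvge _ _ _ _ (cst 0) _ u) => //; last exact: cvg_cst.
  by apply: nearW => n; rewrite w0 wu.
split; first split.
- by apply: filterS aeS => e; exact: tS.
- by apply: filterS aeN => e; exact: sq.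
- apply: sq ci => n; first exact: integral_ge0.
  exact: ge0_le_integralT.
- by apply: sq cv => n //; rewrite intE -tB.
Qed.

End bochner_map.

Section discrete_product.
Context d1 d2 (T : measurableType d1) (T' : measurableType d2).

Lemma measurable_fun_nat_prod (f : nat * T -> T') :
  (forall i, measurable_fun setT (fun x => f (i, x))) -> measurable_fun setT f.
Proof.
move=> mf _ B mB; rewrite setTI.
rewrite (_ : f @^-1` B = \bigcup_i ([set i] `*` ((fun x => f (i, x)) @^-1` B))).
  apply: bigcupT_measurable => i; apply: measurableX => //.
  by rewrite -[X in measurable X]setTI; exact: mf.
apply/seteqP; split => [[i x] fx|[i x] [j _ [/= -> fx]]] //.
by exists i.
Qed.

End discrete_product.

Section sample_triangle.
Local Open Scope ereal_scope.
Context d1 d2 (X : measurableType d1) (E : measurableType d2) (R : realType).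
Variable m : {sigma_finite_measure set X -> \bar R}.
Variable rho : {measure set E -> \bar R}.

Lemma integral_l2norm_sum_lty n (B : 'I_n -> set E) (c : 'I_n -> X -> R) :
  (forall i, measurable (B i)) -> (forall i, rho (B i) < +oo) ->
  (forall i, measurable_fun setT (c i)) -> (forall i, l2norm m (c i) < +oo) ->
  \int[rho]_e l2norm m (fun x => \sum_(i < n) \1_(B i) e * c i x)%R < +oo.
Proof.
move=> mB Boo mc coo.
have le e : l2norm m (fun x => \sum_(i < n) \1_(B i) e * c i x)%R <=
    \sum_(i < n) (\1_(B i) e)%:E * l2norm m (c i).
  have mi i : measurable_fun setT (fun x => \1_(B i) e * c i x)%R by exact: measurable_funM.
  suff [] : measurable_fun setT (fun x => \sum_(i < n) \1_(B i) e * c i x)%R /\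
    l2norm m (fun x => \sum_(i < n) \1_(B i) e * c i x)%R <=
    \sum_(i < n) (\1_(B i) e)%:E * l2norm m (c i) by [].
  elim: n B c {mB Boo mc coo} mi => [|n IH] B c mi.
    rewrite big_ord0 /l2norm; split; first by apply: measurable_sum.
    rewrite integral0_eq ?poweR0r ?invr_neq0// => x _.
    by rewrite big_ord0 expr0n.
  have [mS le] := IH (fun i => B (lift ord0 i)) (fun i => c (lift ord0 i)) (fun i => mi _).
  have -> : (fun x => \sum_(i < n.+1) \1_(B i) e * c i x)%R =
     ((fun x => \1_(B ord0) e * c ord0 x) \+
      (fun x => \sum_(i < n) \1_(B (lift ord0 i)) e * c (lift ord0 i) x))%R.
    by apply/funext => x; rewrite big_ord_recl.
  split; first exact: measurable_funD.
  apply: le_trans (l2norm_triangle m (mi ord0) mS) _; rewrite big_ord_recl.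
  apply: leeD => //; rewrite indicE; case: (_ \in _); rewrite /= ?mul1e ?mul0e.
    by rewrite le_eqVlt; apply/orP; left; apply/eqP; congr (l2norm m _);
       apply/funext => x; rewrite mul1r.
  rewrite /l2norm integral0_eq ?poweR0r ?invr_neq0// => x _.
  by rewrite mul0r expr0n.
apply: (@le_lt_trans _ _ (\int[rho]_e \sum_(i < n) (\1_(B i) e)%:E * l2norm m (c i))).
  by apply: ge0_le_integralT => e //; exact: l2norm_ge0.
have m1 i : measurable_fun setT (fun e => (\1_(B i) e)%:E : \bar R).
  by apply/measurable_EFinP; exact: measurable_indic.
rewrite ge0_integral_sum//; last 2 first.
- by move=> i; apply: emeasurable_funM.
- by move=> i e _; rewrite mule_ge0// lee_fin.
apply: lte_sum_pinfty => i _; rewrite ge0_integralZr//.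
rewrite integral_indic// setIT; apply: lte_mul_pinfty => //.
by rewrite ge0_fin_numE.
Qed.

End sample_triangle.

(** * The Doleans measure *)

Section ae_eq_integral.
Local Open Scope ereal_scope.

Lemma ae_eq_integralT d (T : measurableType d) (R : realType) (mu : {measure set T -> \bar R})
    (f g : T -> \bar R) : {ae mu, forall x, f x = g x} -> \int[mu]_x f x = \int[mu]_x g x.
Proof.
move=> fg; rewrite integralE [RHS]integralE; congr (_ - _).
  by apply: ge0_ae_eq_integralT => //; apply: filterS fg => x; rewrite !funeposE => ->.
by apply: ge0_ae_eq_integralT => //; apply: filterS fg => x; rewrite !funenegE => ->.
Qed.

End ae_eq_integral.

(** * Semidirect product of a measure and a kernel *)

Section semidirect.
Local Open Scope ereal_scope.
Context d d' (X : measurableType d) (Y : measurableType d') (R : realType).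
Variables (P : {finite_measure set X -> \bar R}) (k : X -> {measure set Y -> \bar R}).

Definition measurable_family := forall B, measurable B -> measurable_fun setT (k ^~ B).

Definition kernel_of of measurable_family : X -> {measure set Y -> \bar R} := k.

Hypotheses (mk : measurable_family) (kfin : forall x, k x setT < +oo).

HB.instance Definition _ := isKernel.Build _ _ _ _ _ (kernel_of mk) mk.

Lemma measurable_kernel_xsection (A : set (X * Y)) : measurable A ->
  measurable_fun setT (fun x => k x (xsection A x)).
Proof.
move=> mA.
have [|_] := @measurable_prod_subset_xsection_kernel _ _ X Y R (kernel_of mk) setT measurableT _ A mA.
  move=> x; have kx : k x setT \is a fin_num by rewrite ge0_fin_numE.
  exists (fine (k x setT) + 1)%R => B mB; rewrite /mrestr setIT /kernel_of.
  apply: (@le_lt_trans _ _ (k x setT)); first by apply: le_measure; rewrite ?inE.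
  by rewrite -[ltLHS](fineK kx) lte_fin ltrDl.
by under eq_fun do rewrite /mrestr setIT.
Qed.

Definition semidirect of measurable_family & (forall x, k x setT < +oo) :=
  fun A : set (X * Y) => \int[P]_x k x (xsection A x).

Let m := semidirect mk kfin.

Let m0 : m set0 = 0.
Proof. by rewrite /m /semidirect integral0_eq// => x _; rewrite xsection0 measure0. Qed.

Let m_ge0 A : 0 <= m A.
Proof. by apply: integral_ge0. Qed.

Let m_additive : semi_sigma_additive m.
Proof.
move=> F mF tF mU; rewrite [X in _ --> X](_ : _ = \sum_(n <oo) m (F n)).
  by apply/cvg_closeP; split; [exact: is_cvg_nneseries|rewrite closeE].
rewrite /m /semidirect -integral_nneseries//; last first.
  by move=> n; exact: measurable_kernel_xsection.
apply: eq_integral => x _; apply/esym/cvg_lim => //=; rewrite xsection_bigcup.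
apply: (measure_sigma_additive _ (trivIset_xsection tF)) => n.
exact: measurable_xsection.
Qed.

HB.instance Definition _ := isMeasure.Build _ _ _ (semidirect mk kfin) m0 m_ge0 m_additive.

(** The total masses of the [k x] are finite but not uniformly bounded; the exhaustion cuts the base
    at mass at most [n]. *)
Lemma semidirect_sigma_finite : sigma_finite setT (semidirect mk kfin).
Proof.
pose A n := [set x | k x setT <= n%:R%:E].
have mA n : measurable (A n).
  rewrite -[X in measurable X]setTI; apply: emeasurable_fun_le => //.
  exact: mk.
exists (fun n => A n `*` setT).
  apply/seteqP; split => // -[x y] _.
  have kx : k x setT \is a fin_num by rewrite ge0_fin_numE.
  have [n _ /(_ n (leqnn n)) /= Hn] := nbhs_infty_ger (fine (k x setT)).
  by exists n => //; split => //; rewrite /A/= -(fineK kx) lee_fin.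
move=> n; split; first exact: measurableX.
rewrite /semidirect; apply: (@le_lt_trans _ _ (\int[P]_x (n%:R%:E))).
  apply: ge0_le_integralT => // x; have [Ax|nAx] := boolP (x \in A n).
    by rewrite in_xsectionX//; move: Ax; rewrite inE.
  by rewrite notin_xsectionX// measure0.
rewrite integral_cst//; apply: lte_mul_pinfty => //.
by rewrite -ge0_fin_numE// fin_num_measure.
Qed.

Definition sigma_semidirect : {sigma_finite_measure set (X * Y)%type -> \bar R} :=
  sigma_finite_of semidirect_sigma_finite.

End semidirect.

Section doleans_measure.
Local Open Scope ereal_scope.
Context {R : realType} {d} {Omega : measurableType d}.
Variables (P : probability Omega R) (F : R -> set (set Omega)).
Context {U : ptopologicalType}.
Variables (calA : set (set U)) (T : R).
Variable qv : Omega -> set (R * borel U) -> \bar R.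
Hypothesis F_usual : usual_filtration P F.
Hypothesis qv_random : random_measure P qv.
Hypothesis qv_bounded : bounded_qv P calA T qv.
Variable Un : nat -> set U.
Hypotheses (mUn : forall n, measurable (Un n : set (borel U)))
  (ndUn : forall n, Un n `<=` Un n.+1) (Un_calA : forall n, calA (Un n))
  (TUn : \bigcup_n Un n = setT).

(* qv is a random measure on R * borel U while the predictable sigma-algebra
   lives on Omega * R. *)
Definition reassoc (y : Omega * (R * borel U)) : predictableType F * borel U :=
  ((y.1, y.2.1), y.2.2).

Lemma F_measurable t A : (0 <= t)%R -> F t A -> measurable A.
Proof. by move=> t0; have [/(_ t t0)[_ FM] _ _ _] := F_usual; exact: FM. Qed.

Lemma measurable_predictable_pair :
  @measurable_fun _ _ (Omega * R)%type (predictableType F) setT id.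
Proof.
apply: (@measurability _ _ (Omega * R)%type (predictableType F) setT id (predictable_rectangles F)) => //.
move=> _ [C + <-]; rewrite setTI => -[[A FA ->]|[s [t [A [st FA ->]]]]].
  by apply: measurableX => //; exact: F_measurable FA.
by apply: measurableX => //; apply: F_measurable FA; case/andP: st.
Qed.

Lemma measurable_reassoc : measurable_fun setT reassoc.
Proof.
have m2 : measurable_fun setT (fun y : Omega * (R * borel U) => y.2) by exact: measurable_snd.
apply/measurable_fun_pairP; split; last exact: (measurableT_comp measurable_snd m2).
apply: (measurableT_comp measurable_predictable_pair).
apply/measurable_fun_pairP; split; first exact: measurable_fst.
exact: (measurableT_comp measurable_fst m2).
Qed.

Lemma measurable_slab t : (0 <= t)%R -> measurable (@slab R d Omega F U t).
Proof.
move=> t0; have [/(_ 0%R (lexx _))[sF _] _ _ _] := F_usual.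
have FT : F 0%R setT.
  by have [F0 FC _] := sF; rewrite -[setT]setD0; exact: FC.
have m1 : measurable ([set: Omega] `*` [set 0%R] : set (predictableType F)).
  by apply: sub_sigma_algebra; left; exists setT.
have m2 : measurable ([set: Omega] `*` `]0%R, t]%classic : set (predictableType F)).
  by apply: sub_sigma_algebra; right; exists 0%R, t, setT; rewrite lexx t0.
rewrite (_ : slab F t = (([set: Omega] `*` [set 0%R]) `|` ([set: Omega] `*` `]0%R, t]%classic)) `*` setT).
  by apply: measurableX => //; exact: measurableU.
apply/seteqP; split => -[[w r] u]; rewrite /slab /=.
  move=> /andP[r0 rt]; split => //; move: r0; rewrite le_eqVlt => /orP[/eqP <-|r0]; [left|right] => //.
  by split => //=; rewrite ?in_itv/= r0 rt.
move=> [[[_ ->]|[_ +]] _]; first by rewrite lexx t0.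
by rewrite ?in_itv/= => /andP[/ltW -> ->].
Qed.

Let D : set (R * borel U) := `[0%R, T]%classic `*` setT.
Let mD : measurable D. Proof. exact: measurableX. Qed.

(** The whole of U need not be in the ring, but the sets [Un n] are, and the bound over the ring
    passes to their increasing limit. *)
Lemma qv_ae_finite_measure : {ae P, forall w,
  exists2 m : {measure set (R * borel U) -> \bar R},
    forall C, measurable C -> qv w C = m C & m D < +oo}.
Proof.
have [_ _ qm] := qv_random; apply: filterS2 qm qv_bounded => w [[m mE] _] supoo.
exists m => //; apply: le_lt_trans supoo.
pose B n : set (R * borel U) := `[0%R, T]%classic `*` Un n.
have mB n : measurable (B n) by exact: measurableX.
have DE : D = \bigcup_n B n.
  rewrite /D /B -TUn; apply/seteqP; split => [[r u] [/= r0 [n _ Unu]]|[r u] [n _ [/= r0 Unu]]].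
    by exists n.
  by split => //; exists n.
have : (m \o B) n @[n --> \oo] --> m (\bigcup_n B n).
  apply: nondecreasing_cvg_mu => //; first exact: bigcupT_measurable.
  apply/nondecreasing_seqP => n; apply/subsetPset => -[r u] [/= r0 Unu]; split => //.
  exact: ndUn.
rewrite -DE => cv; rewrite -(cvg_lim _ cv)//; apply: lime_le; first by apply/cvg_ex; exists (m D).
apply: nearW => n /=; apply: ereal_sup_ubound; exists (Un n) => //.
by rewrite mE; [|exact: mB].
Qed.

(** Integrating [qv w] over [w] is a semidirect product once the exceptional null set is removed and
    time is cut to [0, T]; transport by [reassoc] then gives [doleans] on predictable sets. *)
Lemma doleans_sigma_finite :
  exists mu : {sigma_finite_measure set (Omega * (R * borel U))%type -> \bar R},
    forall C, measurable C -> doleans P F T qv C = mu (reassoc @^-1` C).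
Proof.
have [Z [mZ Z0 HZ]] := qv_ae_finite_measure.
have Hm w : exists m : {measure set (R * borel U) -> \bar R}, ~ Z w ->
    (forall C, measurable C -> qv w C = m C) /\ m D < +oo.
  have [Zw|nZw] := pselect (Z w); first by exists mzero.
  have [m mE mDoo] : exists2 m : {measure set (R * borel U) -> \bar R},
      forall C, measurable C -> qv w C = m C & m D < +oo.
    by apply: contra_notP nZw => H; apply: HZ.
  by exists m.
have [m {}Hm] := choice Hm.
(* On the null set [Z] the kernel is 0: this keeps it a finite measure for every [w] and measurable
   in [w]. *)
pose k w : {measure set (R * borel U) -> \bar R} :=
  if pselect (Z w) is left _ then (mzero : {measure set (R * borel U) -> \bar R})
  else (mrestr (m w) mD : {measure set (R * borel U) -> \bar R}).
have kfin w : k w setT < +oo.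
  rewrite /k; case: pselect => [_|nZ]; first exact: ltry.
  rewrite -[X in X < _]/(m w (setT `&` D)) setTI.
  by have [] := Hm w nZ.
have kE w B : measurable B -> ~ Z w -> k w B = qv w (B `&` D).
  move=> mB nZ; rewrite /k; case: pselect => [/nZ//|_].
  rewrite -[LHS]/(m w (B `&` D)).
  by have [-> //] := Hm w nZ; exact: measurableI.
have mk : measurable_family k.
  move=> B mB; have [_ mqv _] := qv_random.
  rewrite (_ : k ^~ B = (fun w => qv w (B `&` D)) \_ (~` Z)).
    apply/(measurable_restrictT _ _).1; first exact: measurableC.
    by apply: measurable_funTS; apply: mqv; exact: measurableI.
  apply/funext => w; rewrite patchE; case: ifPn; rewrite ?notin_setE ?inE /= => nZ.
    exact: kE.
  by rewrite /k; case: pselect => // /nZ.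
exists (sigma_semidirect P mk kfin) => C mC.
rewrite /doleans -[RHS]/(\int[P]_w k w (xsection (reassoc @^-1` C) w)).
apply: ae_eq_integralT; exists Z; split => // w /=; apply: contra_notP => nZ.
have mpre : measurable (reassoc @^-1` C).
  by rewrite -[X in measurable X]setTI; exact: measurable_reassoc.
have mx : measurable (xsection (reassoc @^-1` C) w) by exact: measurable_xsection.
have [mE _] := Hm w nZ.
rewrite kE// mE; last exact: measurableI.
rewrite (@eq_integral_set_fun _ _ _ _ (m w) _ _ mE).
rewrite -(@integral_indic _ _ _ (m w) D mD)//.
by apply: eq_integral => -[r u] _; rewrite !indicE /xsection/= mem_setE.
Qed.

End doleans_measure.

(** * Bochner integrals of Hilbert-Schmidt operators *)

Section hilbert_schmidt_bound.
Local Open Scope ereal_scope.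
Context {R : realType} {H G : hilbertType R}.
Variables (g : nat -> G) (b : nat -> H).
Hypotheses (g_parseval : parseval setT setT g) (b_parseval : parseval setT setT b).

(** [|T h|^2] is the sum of the squares of the [dot h (T' k)], each at most [|h|^2 |T' k|^2], and
    the [|T' k|^2] sum to the squared Hilbert-Schmidt norm. *)
Lemma hs_bound (T : H -> G) h : bounded_linear T ->
  (`|T h|)%:E <= l2norm (sigma_counting R) (hs_coef g b T) * (`|h|)%:E.
Proof.
move=> bT; have [T' adj] := choice (fun k => adjoint_exists (g k) bT).
have adjT x k : dot (T x) (g k) = dot x (T' k) by [].
have e0 : 0 <= l2norm (sigma_counting R) (hs_coef g b T) by exact: l2norm_ge0.
apply: lee_of_sqr; first by rewrite lee_fin.
  by rewrite mule_ge0.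
rewrite muleACA sqr_l2norm -!EFinM -!expr2 -g_parseval//.
rewrite [X in X * _](@ge0_integral_count R)// hs_coefE//.
rewrite (@hs_esum _ _ _ _ g_parseval T setT _ setT b T')//.
rewrite -!nneseries_esumT// muleC -nneseriesZl//.
apply: lee_nneseries => // k _.
rewrite -EFinM lee_fin adjT -exprMn -[leLHS]real_normK ?num_real//.
by rewrite ler_pXn2r ?nnegrE ?mulr_ge0// dot_le_norm.
Qed.

End hilbert_schmidt_bound.

Section pointwise_bochner.
Local Open Scope ereal_scope.
Context {R : realType} {H G : hilbertType R}.
Variables (g : nat -> G) (b : nat -> H).
Hypotheses (g_parseval : parseval setT setT g) (b_parseval : parseval setT setT b).
Hypothesis H_sep : separable H.
Variable A : H -> H.
Hypotheses (linA : linear A) (contA : continuous A).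
Context {d} {E : measurableType d}.
Variable rho : {sigma_finite_measure set E -> \bar R}.
Variable Phi : E -> H -> G.

Let ip (x y : H) : R := dot (pseudo_inverse A x) (pseudo_inverse A y).
Let S : set (H -> G) := HS (range A) ip.
Let N : (H -> G) -> \bar R := hs_norm (range A) ip.
Let count := sigma_counting R.
Let cf (L : H -> G) i : R := hs_coef g b (L \o A) i.

Hypothesis HPhi : forall e, S (Phi e).
Hypothesis mPhi : forall h k, measurable_fun setT (fun e => dot (Phi e (A h)) k).

Let f (p : nat * E) : R := cf (Phi p.2) p.1.

Lemma measurable_phi_coef : measurable_fun setT f.
Proof.
apply: measurable_fun_nat_prod => i.
exact: (mPhi (pair_fst b i) (pair_snd g i)).
Qed.

Let subS : linear_subspace S.
Proof.
split; first exact: (HS_range0 g_parseval b_parseval H_sep linA contA).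
move=> a L L'; exact: (HS_range_lin g_parseval b_parseval H_sep linA contA).
Qed.

Let N0 L : 0 <= N L. Proof. exact: poweR_ge0. Qed.

Lemma HS_norm_coef L : S L -> N L = l2norm count (cf L).
Proof. by move=> /(HS_rangeP g_parseval b_parseval H_sep linA contA)[bL _]; exact: hs_norm_range. Qed.

Lemma HS_norm_lty L : S L -> l2norm count (cf L) < +oo.
Proof. by move=> /(HS_rangeP g_parseval b_parseval H_sep linA contA)[]. Qed.

Lemma cf_sub_sum n (a : 'I_n -> R) (L : H -> G) (K : 'I_n -> H -> G) i :
  cf (L - \sum_(j < n) a j *: K j)%R i = (cf L i - \sum_(j < n) a j * cf (K j) i)%R.
Proof.
rewrite /cf /hs_coef /= [X in dot X _](_ : _ = L (A (pair_fst b i)) -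
  \sum_(j < n) a j *: K j (A (pair_fst b i)))%R; last first.
  by rewrite -[LHS]/(L _ - (\sum_(j < n) a j *: K j) _)%R fct_sumE.
rewrite dotBl dot_suml; congr (_ - _)%R; apply: eq_bigr => j _.
by rewrite dotZl.
Qed.

Lemma S_sub_sum n (a : 'I_n -> R) (L : H -> G) (K : 'I_n -> H -> G) :
  S L -> (forall j, S (K j)) -> S (L - \sum_(j < n) a j *: K j)%R.
Proof.
move=> SL SK; apply: subspaceB => //; apply: subspace_sum => // j.
exact: subspaceZ.
Qed.

Let bnd_lin L : S L -> bounded_linear (L \o A).
Proof.
move=> /(HS_rangeP g_parseval b_parseval H_sep linA contA)[bL _].
exact: range_bounded_linear bL.
Qed.

(** Evaluation at [A h] followed by pairing with [k] is a bounded functional on Hilbert-Schmidt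
    operators, so it commutes with the Bochner integral. Measurability of the integral in the point
    rests on this. *)
Lemma pointwise_functional v h k : is_bochner_integral rho S N Phi v ->
  dot (v (A h)) k = fine (\int[rho]_e (dot (Phi e (A h)) k)%:E).
Proof.
move=> Phiv; pose l (L : H -> G) := dot (L (A h)) k.
(* The added 1 makes the constant positive when [h] or [k] is 0. *)
have c0 : (0 < `|h| * `|k| + 1)%R by rewrite ltr_wpDl// mulr_ge0.
have bnd L : S L -> (`|l L|)%:E <= (`|h| * `|k| + 1)%:E * N L.
  move=> SL; apply: (@le_trans _ _ ((`|L (A h)|)%:E * (`|k|)%:E)).
    by rewrite -EFinM lee_fin dot_le_norm.
  apply: (@le_trans _ _ (N L * (`|h|)%:E * (`|k|)%:E)).
    rewrite lee_wpmul2r ?lee_fin// HS_norm_coef//.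
    exact: (hs_bound g_parseval b_parseval h (bnd_lin SL)).
  by rewrite -muleA -EFinM muleC lee_wpmul2r// lee_fin lerDl.
have lin (a : R) (L K : H -> G) : S L -> S K -> l (a *: L + K)%R = (a * l L + l K)%R.
  by move=> _ _; rewrite /l -dotPl.
have [_ ->] // := bochner_integral_functional subS N0 c0 lin bnd Phiv (mPhi h k)
  (aeW _ (fun e => erefl)).
Qed.

(** One approximating step at distance less than 1 suffices: its norm is integrable, and so is that
    of the error. Hence [bochner] takes its default value wherever the integral of the norms is
    infinite, which fixes it at every point of the slab. *)
Lemma pointwise_converse v : is_bochner_integral rho S N Phi v ->
  \int[rho]_e l2norm count (fun i => f (i, e)) < +oo.
Proof.
move=> [_ [s [[_ _ ci] _]]]; have [n /(_ n (leqnn n)) Hn] := cvg0_small ci ltr01.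
pose psi (i : nat) e := (\sum_(j < bs_size (s n)) \1_(bs_set j) e * cf (bs_val j) i)%R.
have NE e : N (Phi e - bs_fun (s n) e)%R = l2norm count (fun i => f (i, e) - psi i e)%R.
  rewrite HS_norm_coef; last by apply: S_sub_sum => // j; exact: bs_mem.
  by congr (l2norm count _); apply/funext => i; rewrite cf_sub_sum.
have mpsi i : measurable_fun setT (psi i).
  apply: measurable_sum => j; apply: measurable_funM => //.
  by apply: measurable_indic; exact: bs_measurable.
have mf := measurable_phi_coef.
have md : measurable_fun setT (fun p : nat * E => f p - psi p.1 p.2)%R.
  apply: measurable_fun_nat_prod => i; apply: measurable_funB => /=; last exact: mpsi.
  exact: (measurable_sections1 mf).
have mp : measurable_fun setT (fun p : nat * E => psi p.1 p.2).
  apply: (@measurable_fun_nat_prod _ _ E R (fun p => psi p.1 p.2)) => j; exact: mpsi.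
have ml1 := measurable_l2norm_section count md.
have ml2 := measurable_l2norm_section count mp.
apply: (@le_lt_trans _ _ (\int[rho]_e (l2norm count (fun i => f (i, e) - psi i e)%R +
  l2norm count (fun i => psi i e)))).
  apply: ge0_le_integralT => e; first exact: l2norm_ge0.
  rewrite [X in l2norm _ X <= _](_ : _ = (fun i => f (i, e) - psi i e) \+ (fun i => psi i e))%R.
    exact: l2norm_triangle.
  by apply/funext => i /=; rewrite subrK.
rewrite ge0_integralD//; apply: lte_add_pinfty; last first.
  apply: integral_l2norm_sum_lty => // j.
  + exact: bs_measurable.
  + exact: bs_finite.
  + by apply: HS_norm_lty; exact: bs_mem.
under eq_integral do rewrite -NE.
by apply: lt_trans Hn _; rewrite ltry.
Qed.

Hypothesis Phi_int : \int[rho]_e l2norm count (fun i => f (i, e)) < +oo.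

Let sample_norm (s : sample E) (gs : good_sample count rho f s) e :
  N (Phi e - \sum_(i < sample_size s) \1_(sample_set i) e *: Phi (@sample_point _ _ s i))%R
  = sample_error count f s e.
Proof.
rewrite HS_norm_coef; last by apply: S_sub_sum.
by congr (l2norm count _); apply/funext => i; rewrite cf_sub_sum.
Qed.

Lemma pointwise_integrable : bochner_integrable rho S N Phi.
Proof.
apply: (@bochner_integrable_samples _ _ _ _ _ count rho f measurable_phi_coef Phi_int).
- by [].
- by move=> e _.
- by move=> s gs e _; exact: sample_norm.
Qed.

Let le_dot h k e : (`|dot (Phi e (A h)) k|)%:E <=
  (`|h| * `|k|)%:E * l2norm count (fun i => f (i, e)).
Proof.
apply: (@le_trans _ _ ((`|Phi e (A h)|)%:E * (`|k|)%:E)).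
  by rewrite -EFinM lee_fin dot_le_norm.
rewrite EFinM (muleC (`|h|)%:E) -muleA (muleC (`|k|)%:E) (muleC (`|h|)%:E).
rewrite lee_wpmul2r ?lee_fin//.
exact: (hs_bound g_parseval b_parseval h (bnd_lin (HPhi e))).
Qed.

Let mphi h k : measurable_fun setT (fun e => (dot (Phi e (A h)) k)%:E).
Proof. exact/measurable_EFinP. Qed.

Let ml2 : measurable_fun setT (fun e => l2norm count (fun i => f (i, e))).
Proof. exact: measurable_l2norm_section measurable_phi_coef. Qed.

Let C := \int[rho]_e l2norm count (fun i => f (i, e)).

Let C0 : 0 <= C. Proof. by apply: integral_ge0. Qed.

Let le_int_dot h k : \int[rho]_e (`|dot (Phi e (A h)) k|)%:E <= (`|h| * `|k|)%:E * C.
Proof.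
rewrite -ge0_integralZl//.
by apply: ge0_le_integralT.
Qed.

Let iphi h k : rho.-integrable setT (fun e => (dot (Phi e (A h)) k)%:E).
Proof.
apply/integrableP; split => //; apply: le_lt_trans (le_int_dot h k) _.
by apply: lte_mul_pinfty => //; rewrite lee_fin mulr_ge0.
Qed.

Let wk h k : R := fine (\int[rho]_e (dot (Phi e (A h)) k)%:E).

Let wkE h k : \int[rho]_e (dot (Phi e (A h)) k)%:E = (wk h k)%:E.
Proof. by rewrite fineK// integrable_fin_num. Qed.

Let Cfin : C \is a fin_num. Proof. by rewrite ge0_fin_numE. Qed.

Let wk_le h k : (`|wk h k| <= `|h| * `|k| * fine C)%R.
Proof.
rewrite -lee_fin EFinM (fineK Cfin); apply: le_trans (le_int_dot h k).
rewrite -[leLHS]/(`|(wk h k)%:E|) -wkE.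
exact: le_trans (le_abse_integral _ measurableT (mphi h k)) _.
Qed.

Let wk_linr h a k k' : wk h (a *: k + k')%R = (a * wk h k + wk h k')%R.
Proof.
apply: EFin_inj; rewrite -wkE EFinD EFinM -!wkE -integralZl// -integralD//; last exact: integrableZl.
by apply: eq_integral => e _; rewrite dotDr dotZr EFinD EFinM.
Qed.

(** The integral is built weakly rather than as a limit: the integrals [wk h k] of the matrix
    coefficients form a bounded bilinear form, Riesz' theorem gives the vectors, and Minkowski's
    inequality shows that the resulting operator is Hilbert-Schmidt. *)
Lemma pointwise_integral_exists : exists v, is_bochner_integral rho S N Phi v.
Proof.
have Hv h : exists u, forall k, wk h k = dot k u.
  apply: (@riesz _ _ (wk h) (`|h| * fine C)) => [a k k'|k]; first exact: wk_linr.
  by rewrite (le_trans (wk_le h k))// mulrAC.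
have [v_ Hv_] := choice Hv.
(* An operator on [range A] is wanted, so a preimage must be chosen; [vE] shows that [wk h k]
   depends on [h] through [A h] only. *)
pose v y := v_ (pseudo_inverse A y).
have vE h k : dot (v (A h)) k = wk h k.
  rewrite /v dotC -Hv_ /wk; congr fine; apply: eq_integral => e _.
  by have [_ ->] := pseudo_inverseP linA contA h.
have bv : range_bounded A v.
  split.
    move=> a y y' [h _ <-] [h' _ <-]; rewrite -linA.
    apply/eqP; rewrite -subr_eq0; apply/eqP; apply: dot_eq0.
    set z := (v _ - _)%R; rewrite {1}/z dotBl dotDl dotZl !vE -[X in (_ - X)%R]/(_ + _)%R.
    apply/eqP; rewrite subr_eq0; apply/eqP; apply: EFin_inj.
    rewrite EFinD EFinM -!wkE -integralZl// -integralD//; last exact: integrableZl.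
    apply: eq_integral => e _; have [linPhi _] := (HS_rangeP g_parseval b_parseval H_sep linA contA (Phi e)).1 (HPhi e).
    by rewrite linA (linPhi.1)// dotDl dotZl EFinD EFinM.
  exists (fine C ^+ 2)%R => y [h _ <-].
  have [Kp Ap] := pseudo_inverseP linA contA h; set p := pseudo_inverse A (A h) in Kp Ap *.
  (* The operator bound comes from pairing [v (A h)] with itself and dividing by its norm; [|p| ^ 2]
     is [ip (A h) (A h)]. *)
  have : (`|v (A h)| ^+ 2 <= `|p| * `|v (A h)| * fine C)%R.
    rewrite -dot_norm -{1}Ap vE; apply: le_trans (ler_norm _) _; exact: wk_le.
  have [->|v0] := eqVneq (v (A h)) 0%R.
    by move=> _; rewrite normr0 expr0n mulr_ge0 ?sqr_ge0 ?dot_ge0.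
  rewrite mulrAC [X in (X <= _)%R -> _]expr2 ler_pM2r ?normr_gt0// => le.
  rewrite dot_norm -exprMn ler_pXn2r ?nnegrE ?mulr_ge0 ?fine_ge0// mulrC.
  exact: le.
have cfv : cf v = fun i => fine (\int[rho]_e (f (i, e))%:E).
  by apply/funext => i; rewrite /cf /hs_coef vE.
have Sv : S v.
  apply/(HS_rangeP g_parseval b_parseval H_sep linA contA); split => //.
  have -> : hs_coef g b (v \o A) = fun i => fine (\int[rho]_e (f (i, e))%:E) by exact: cfv.
  exact: le_lt_trans (minkowski_Rintegral count rho measurable_phi_coef) Phi_int.
exists v.
apply: (@is_bochner_integral_samples _ _ _ _ _ count rho f measurable_phi_coef Phi_int _ S N Phi) => //.
- by move=> s gs e _; exact: sample_norm.
- move=> s gs; rewrite HS_norm_coef; last exact: S_sub_sum.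
  rewrite (_ : cf _ = fun i => fine (\int[rho]_e (f (i, e))%:E) -
    \sum_(i0 < sample_size s) fine (rho (sample_set i0)) * f (i, @sample_point _ _ s i0))%R//.
  by apply/funext => i; rewrite cf_sub_sum cfv.
Qed.

End pointwise_bochner.

(** * Hilbert-valued random variables *)

Section hilbert_borel.
Context {R : realType} {G : hilbertType R}.
Hypothesis G_sep : separable G.

Lemma continuous_borel_measurable (h : G -> R) : continuous h ->
  @measurable_fun _ _ (borel G) R setT h.
Proof.
move=> ch; apply: (measurability _ (RGenOpens.measurableE R)).
move=> _ [_ [a [c ->]] <-]; rewrite setTI; apply: sub_sigma_algebra.
by move/continuousP: ch; apply; exact: interval_open.
Qed.

Lemma dot_continuous (k : G) : continuous (fun x : G => dot x k).
Proof.
move=> x; apply/cvgrPdist_le => e e0.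
have k0 : 0 < `|k| + 1 by rewrite ltr_wpDl.
have e1 : 0 < e / (`|k| + 1) by rewrite divr_gt0.
apply/nbhs_ballP; exists (e / (`|k| + 1)) => //= y; rewrite -ball_normE /= => /ltW xy.
rewrite -dotBl (le_trans (dot_le_norm _ _))//.
apply: (@le_trans _ _ (e / (`|k| + 1) * `|k|)); first by rewrite ler_wpM2r.
by rewrite mulrAC ler_pdivrMr// ler_pM2l// lerDl.
Qed.

Context d (X : measurableType d).

Lemma measurable_dotr (f : X -> G) (k : G) : measurable_fun setT (f : X -> borel G) ->
  measurable_fun setT (fun x => dot (f x) k).
Proof.
move=> mf; have mh := continuous_borel_measurable (@dot_continuous k).
exact: (measurableT_comp mh mf).
Qed.

Lemma measurable_normG (f : X -> G) : measurable_fun setT (f : X -> borel G) ->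
  measurable_fun setT (fun x => `|f x|).
Proof.
move=> mf; have mh := continuous_borel_measurable (@norm_continuous _ G).
exact: (measurableT_comp mh mf).
Qed.

(** Open sets are countable unions of balls centred at a dense sequence, and the squared distance to
    a centre is the sum of the squares of measurable coordinates. *)
Lemma weak_measurable (D : set X) (f : X -> G) : measurable D ->
  (forall k, measurable_fun D (fun x => dot (f x) k)) ->
  measurable_fun D (f : X -> borel G).
Proof.
move=> mD mf; have [g gP] := parseval_sequence G_sep; have [s sd] := dense_sequence G_sep.
pose h n x := `|f x - s n| ^+ 2.
have mh n : measurable_fun D (h n).
  apply/measurable_EFinP.
  rewrite (_ : EFin \o h n = fun x => (\sum_(i <oo) (dot (f x - s n) (g i) ^+ 2)%:E)%E).
    apply: ge0_emeasurable_sum => [i x _ _|i _]; first by rewrite lee_fin sqr_ge0.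
    apply/measurable_EFinP; apply: measurable_funX.
    under eq_fun do rewrite dotBl.
    exact: measurable_funB.
  by apply/funext => x; rewrite /h /= -gP// nneseries_esumT.
apply: (@measurability _ _ X (borel G) D f open) => //.
move=> _ [V openV <-].
pose I : set (nat * nat) := [set p | ball (s p.1) (p.2.+1%:R^-1) `<=` V].
rewrite (_ : D `&` f @^-1` V =
    \bigcup_p (D `&` [set x | I p /\ h p.1 x < (p.2.+1%:R^-1) ^+ 2])).
  apply: countable_bigcupT_measurable => [|p]; first exact: countableP.
  have [Ip|nI] := pselect (I p); last first.
    by rewrite (_ : [set x | _] = set0) ?setI0//; apply/seteqP; split => x // [].
  rewrite (_ : [set x | _] = h p.1 @^-1` `]-oo, (p.2.+1%:R^-1) ^+ 2[%classic).
    exact: mh.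
  by apply/seteqP; split => x /=; rewrite in_itv /=; tauto.
have hball n q x : (h n x < (q.+1%:R^-1) ^+ 2) = (`|s n - f x| < q.+1%:R^-1).
  by rewrite /h distrC ltr_pXn2r ?nnegrE// invr_ge0.
apply/seteqP; split => [x [Dx Vfx]|x [[n q] _ [Dx /= [In]]]]; last first.
  rewrite hball => Hx; split => //; apply: In => /=.
  by rewrite -ball_normE.
have := open_nbhs_nbhs (conj openV Vfx : open_nbhs (f x) V).
move/nbhs_ballP => [r /= r0 rV].
have r20 : 0 < r / 2 by rewrite divr_gt0.
have [q _ /(_ q (leqnn q)) /= Hq] := near_infty_natSinv_lt (PosNum r20).
have q0 : 0 < (q.+1%:R^-1 : R) by rewrite invr_gt0.
have [n Hn] := sd (f x) _ q0.
exists (n, q) => //; split => //=; split; last by rewrite hball distrC.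
move=> y /=; rewrite -ball_normE /= => Hy; apply: rV; rewrite -ball_normE /=.
rewrite (le_lt_trans (ler_distD (s n) _ _))// (splitr r) ltrD//.
  exact: lt_trans Hn Hq.
exact: lt_trans Hy Hq.
Qed.

Lemma measurable_borelD (f f' : X -> G) (a : R) : measurable_fun setT (f : X -> borel G) ->
  measurable_fun setT (f' : X -> borel G) ->
  measurable_fun setT ((fun x => a *: f x + f' x) : X -> borel G).
Proof.
move=> mf mf'; apply: weak_measurable => // k.
under eq_fun do rewrite dotPl.
by apply: measurable_funD; [apply: measurable_funM => //|]; exact: measurable_dotr.
Qed.

Lemma measurable_dot (f f' : X -> G) : measurable_fun setT (f : X -> borel G) ->
  measurable_fun setT (f' : X -> borel G) -> measurable_fun setT (fun x => dot (f x) (f' x)).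
Proof.
move=> mf mf'.
have mp := measurable_normG (measurable_borelD 1 mf mf').
have mm := measurable_normG (measurable_borelD (-1) mf' mf).
rewrite (_ : (fun x => _) = fun x => 4^-1 * (`|1 *: f x + f' x| ^+ 2 - `|-1 *: f' x + f x| ^+ 2)).
  by apply: measurable_funM => //; apply: measurable_funB; exact: measurable_funX.
apply/funext => x; rewrite scale1r scaleN1r (addrC (- f' x)) sqr_normD sqr_normB.
by field.
Qed.

End hilbert_borel.

Section L2_bochner.
Local Open Scope ereal_scope.
Context {R : realType} {G : hilbertType R} {d} {Omega : measurableType d}.
Variable P : probability Omega R.
Hypothesis G_sep : separable G.

Let SL2 : set (Omega -> G) := L2 P.

Lemma L2_normE (X : Omega -> G) : L2_norm P X = l2norm P (fun w => `|X w|%R).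
Proof. by []. Qed.

Lemma L2_norm_lty X : SL2 X -> L2_norm P X < +oo.
Proof. by move=> [_ X2]; rewrite L2_normE l2norm_lty. Qed.

Lemma L2_subspace : linear_subspace SL2.
Proof.
split; first split.
- exact: measurable_cst.
- rewrite integral0_eq// => w _; by rewrite [X in `|X|%R]/(0%R : G) normr0 expr0n.
- move=> a X Y SX SY; have [mX X2] := SX; have [mY Y2] := SY.
  have m := measurable_borelD G_sep a mX mY.
  split; first exact: m.
  rewrite -[X in X < _]/(\int[P]_w ((fun w => `|(a *: X + Y) w|%R) w ^+ 2)%:E) -l2norm_lty.
  have mnX := measurable_normG mX; have mnY := measurable_normG mY.
  apply: (@le_lt_trans _ _ (l2norm P (fun w => `|a| * `|X w| + `|Y w|)%R)); last first.
    by apply: l2norm_lin_lty => //; rewrite l2norm_lty.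
  apply: le_l2norm => w; rewrite normr_id ger0_norm; last by rewrite addr_ge0 ?mulr_ge0.
  by rewrite -[X in (`|X| <= _)%R]/(a *: X w + Y w)%R (le_trans (ler_normD _ _))// normrZ.
Qed.

Lemma L2_integrable_dot X Y : SL2 X -> SL2 Y ->
  P.-integrable setT (fun w => (dot (X w) (Y w))%:E) /\
  `|\int[P]_w (dot (X w) (Y w))%:E| <= L2_norm P X * L2_norm P Y.
Proof.
move=> SX SY; have [mX _] := SX; have [mY _] := SY.
have md := measurable_dot G_sep mX mY.
have mdE : measurable_fun setT (fun w => (dot (X w) (Y w))%:E) by exact/measurable_EFinP.
have le : \int[P]_w `|(dot (X w) (Y w))%:E| <= L2_norm P X * L2_norm P Y.
  rewrite !L2_normE.
  apply: le_trans (cauchy_schwarz P (measurable_normG mX) (measurable_normG mY)).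
  apply: ge0_le_integralT => w //; rewrite lee_fin normrM !normr_id.
  exact: dot_le_norm.
split; last exact: le_trans (le_abse_integral P measurableT mdE) le.
apply/integrableP; split => //; apply: le_lt_trans le _.
apply: lte_mul_pinfty; first by rewrite L2_normE l2norm_ge0.
  by rewrite ge0_fin_numE ?L2_norm_lty// L2_normE l2norm_ge0.
exact: L2_norm_lty.
Qed.

(** Both integrals have the same pairing with [Z = X - Y], so the pairing of [X - Y] with itself,
    its squared norm, is 0. *)
Lemma L2_bochner_unique dE (E : measurableType dE) (rho : {measure set E -> \bar R})
    (f : E -> Omega -> G) (X Y : Omega -> G) :
  is_bochner_integral rho SL2 (L2_norm P) f X ->
  is_bochner_integral rho SL2 (L2_norm P) f Y -> {ae P, forall w, X w = Y w}.
Proof.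
move=> fX fY; have [SX _] := fX; have [SY _] := fY.
pose Z : Omega -> G := (X - Y)%R.
have SZ : SL2 Z by apply: subspaceB => //; exact: L2_subspace.
pose l (W : Omega -> G) : R := fine (\int[P]_w (dot (W w) (Z w))%:E).
have lE W : SL2 W -> \int[P]_w (dot (W w) (Z w))%:E = (l W)%:E.
  by move=> SW; rewrite fineK// integrable_fin_num//; case: (L2_integrable_dot SW SZ).
have lin (a : R) V W : SL2 V -> SL2 W -> l (a *: V + W)%R = (a * l V + l W)%R.
  move=> SV SW; have [iV _] := L2_integrable_dot SV SZ; have [iW _] := L2_integrable_dot SW SZ.
  have SVW : SL2 (a *: V + W)%R by case: L2_subspace => _; apply.
  apply: EFin_inj; rewrite -lE// EFinD EFinM -!lE// -integralZl// -integralD//; last exact: integrableZl.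
  by apply: eq_integral => w _; rewrite -EFinM -EFinD -dotPl.
pose c : R := (fine (L2_norm P Z) + 1)%R.
have Z0 : 0 <= L2_norm P Z by rewrite L2_normE l2norm_ge0.
have Zfin : L2_norm P Z \is a fin_num by rewrite ge0_fin_numE ?L2_norm_lty.
have c0 : (0 < c)%R by rewrite ltr_wpDl// fine_ge0.
have N0 (W : Omega -> G) : 0 <= L2_norm P W by rewrite L2_normE l2norm_ge0.
have bnd W : SL2 W -> (`|l W|)%:E <= c%:E * L2_norm P W.
  move=> SW; have [_] := L2_integrable_dot SW SZ; rewrite lE// => /le_trans; apply.
  rewrite muleC; apply: lee_wpmul2r; first exact: N0.
  by rewrite /c EFinD fineK// leeDl.
have lXY := bochner_integral_functional_unique L2_subspace N0 c0 lin bnd fX fY.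
have : \int[P]_w `|(`|Z w| ^+ 2)%:E| = 0.
  transitivity (\int[P]_w (dot (X w) (Z w) - dot (Y w) (Z w))%:E).
    apply: eq_integral => w _; rewrite gee0_abs ?lee_fin ?sqr_ge0// -dotBl -dot_norm.
    by [].
  have [iX _] := L2_integrable_dot SX SZ; have [iY _] := L2_integrable_dot SY SZ.
  under eq_integral do rewrite EFinB.
  by rewrite integralB// !lE// lXY subee.
have mZ : measurable_fun setT (fun w => (`|Z w| ^+ 2)%:E).
  apply/measurable_EFinP; apply: measurable_funX; apply: measurable_normG.
  by case: SZ.
move/(ae_eq_integral_abs P measurableT mZ); apply: filterS => w /(_ Logic.I) /= [] /eqP.
by rewrite sqrf_eq0 normr_eq0 subr_eq0 => /eqP.
Qed.

End L2_bochner.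

(** * Integrands in coordinates *)

(** The default value of [psqrt] is the zero operator, so both properties hold at every point, also
    where [Q x] has no root. *)
Lemma psqrt_bounded (R : realType) (H : hilbertType R) (L : H -> H) :
  linear (psqrt L) /\ continuous (psqrt L).
Proof.
rewrite /psqrt; case: xgetP => [B _ []//|_]; split; last exact: cst_continuous.
by move=> a x y; rewrite scaler0 addr0.
Qed.

Section coordinates.
Local Open Scope ereal_scope.
Context {R : realType} {d} {Omega : measurableType d}.
Variables (P : probability Omega R) (F : R -> set (set Omega)).
Context {U : ptopologicalType} {H G : hilbertType R}.
Variables (T : R) (qv : Omega -> set (R * borel U) -> \bar R) (Q : Omega * R * U -> H -> H).
Hypotheses (F_usual : usual_filtration P F) (T_gt0 : (0 < T)%R).
Hypotheses (H_sep : separable H) (G_sep : separable G).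
Variable mu : {sigma_finite_measure set (Omega * (R * borel U))%type -> \bar R}.
Hypothesis muE : forall C : set (predictableType F * borel U), measurable C ->
  doleans P F T qv C = mu (@reassoc R d Omega F U @^-1` C).
Variables (g : nat -> G) (b : nat -> H).
Hypotheses (g_parseval : parseval setT setT g) (b_parseval : parseval setT setT b).

Local Notation ra := (@reassoc R d Omega F U).
Local Notation sl := (@slab R d Omega F U).
Local Notation process := (Omega * R * U -> H -> G)%type.

Definition coord_measure := sigma_prod mu (sigma_counting R).

Definition hs_sum (Psi : process) (x : Omega * R * U) : \bar R :=
  \sum_(i <oo) (hs_coef g b (Psi x \o psqrt (Q x)) i ^+ 2)%:E.

(** Extended by 0 outside the slab, as the conditions on an integrand concern the slab only. *)
Definition hs_coord (Psi : process) (p : (Omega * (R * borel U)) * nat) : R :=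
  ((fun x => hs_coef g b (Psi x \o psqrt (Q x)) p.2) \_ (sl T)) (ra p.1).

Definition weakly_measurable (Psi : process) := forall h k,
  measurable_fun (sl T) (fun x => dot (Psi x (psqrt (Q x) h)) k).

Lemma measurable_slabT : measurable (sl T).
Proof. by apply: (measurable_slab F_usual); exact: ltW. Qed.

(** On measurable sets [doleans] is the image of [mu] by [reassoc]; this replaces a bare set
    function by a sigma-finite measure, for which Tonelli's theorem is available. *)
Lemma integral_doleans t (h : Omega * R * U -> \bar R) : (0 <= t)%R ->
  (forall x, sl t x -> 0 <= h x) -> measurable_fun (sl t) h ->
  \int[doleans P F T qv]_(x in sl t) h x = \int[mu]_y (h \_ (sl t)) (ra y).
Proof.
move=> t0 h0 mh.
have msl := @measurable_slab _ _ _ _ _ U F_usual t t0.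
have mra := @measurable_reassoc _ _ _ _ _ U F_usual.
rewrite (@eq_integral_set_fun _ _ _ _ (pushforward mu ra) _ _ muE).
rewrite integral_mkcond (ge0_integral_pushforward mra)//.
- exact/(measurable_restrictT _ _).1.
- by move=> x _; rewrite erestrict_ge0.
Qed.

Lemma hs_sum_ge0 Psi x : 0 <= hs_sum Psi x.
Proof. by apply: nneseries_ge0 => i _ _. Qed.

Lemma measurable_hs_sum Psi t : (t <= T)%R -> weakly_measurable Psi ->
  measurable_fun (sl t) (hs_sum Psi).
Proof.
move=> tT mPsi; apply: (@measurable_funS _ _ _ _ (sl T)).
- exact: measurable_slabT.
- by move=> x; rewrite /slab/= => /andP[-> /le_trans]; apply.
- apply: ge0_emeasurable_sum => [i x _ _|i _]; first by [].
  by apply/measurable_EFinP; apply: measurable_funX; exact: mPsi.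
Qed.

Definition hs_valued (Psi : process) := forall x, sl T x -> HSQ Q x (Psi x).

Lemma hs_valued_bounded Psi x : hs_valued Psi -> sl T x ->
  bounded_linear (Psi x \o psqrt (Q x)).
Proof.
move=> hPsi Tx; have [linA contA] := psqrt_bounded (Q x).
have [bL _] := (HS_rangeP g_parseval b_parseval H_sep linA contA (Psi x)).1 (hPsi x Tx).
exact: range_bounded_linear bL.
Qed.

Lemma Lambda2_norm2_mu Psi t : (0 <= t <= T)%R -> hs_valued Psi -> weakly_measurable Psi ->
  Lambda2_norm2 P F T qv Q t Psi = \int[mu]_y (hs_sum Psi \_ (sl t)) (ra y).
Proof.
move=> /andP[t0 tT] hPsi mPsi; rewrite -integral_doleans//; last 2 first.
- by move=> x _; exact: hs_sum_ge0.
- exact: measurable_hs_sum.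
(* [hs_norm2] is identified with [hs_sum] on the slab only, so the rewriting is done on the
   restrictions. *)
have e : {in sl t, (fun x => hs_norm2 setT (@dot R H) (Psi x \o psqrt (Q x))) =1 hs_sum Psi}.
  move=> x; rewrite inE => tx; apply: (hs_norm2_setT g_parseval b_parseval H_sep).
  by apply: hs_valued_bounded => //; move: tx; rewrite /slab/= => /andP[-> /le_trans]; exact.
by move/eq_restrictP: e => e; rewrite /Lambda2_norm2 /integral e.
Qed.

Lemma Lambda2_norm2_le Psi t : (0 <= t <= T)%R -> hs_valued Psi -> weakly_measurable Psi ->
  Lambda2_norm2 P F T qv Q t Psi <= Lambda2_norm2 P F T qv Q T Psi.
Proof.
move=> tT hPsi mPsi; rewrite !Lambda2_norm2_mu//; last by rewrite lexx ltW.
apply: ge0_le_integralT => y; first by apply: erestrict_ge0 => x _; exact: hs_sum_ge0.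
rewrite !patchE; case: ifPn => [|_]; last first.
  by case: ifP => // _; exact: hs_sum_ge0.
rewrite inE /slab/= => /andP[y0 yt]; rewrite mem_set//.
by rewrite /slab /= y0 (le_trans yt)//; case/andP: tT.
Qed.

Lemma measurable_coord Psi : weakly_measurable Psi -> measurable_fun setT (hs_coord Psi).
Proof.
move=> mPsi.
pose c (q : nat * (Omega * (R * borel U))) := hs_coord Psi (q.2, q.1).
have mc : measurable_fun setT c.
  apply: measurable_fun_nat_prod => i; rewrite /c /hs_coord /=.
  have mh : measurable_fun setT ((fun x => hs_coef g b (Psi x \o psqrt (Q x)) i) \_ (sl T)).
    exact: (iffLR (measurable_restrictT _ measurable_slabT)
      (mPsi (pair_fst b i) (pair_snd g i))).
  exact: measurableT_comp mh (@measurable_reassoc _ _ _ _ _ U F_usual).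
have msw : measurable_fun setT (fun p : (Omega * (R * borel U)) * nat => (p.2, p.1)).
  by apply/measurable_fun_pairP; split; [exact: measurable_snd|exact: measurable_fst].
rewrite (_ : hs_coord Psi = c \o (fun p => (p.2, p.1))); first exact: measurableT_comp.
by apply/funext => -[].
Qed.

Lemma Lambda2_norm2_coord Psi : hs_valued Psi -> weakly_measurable Psi ->
  Lambda2_norm2 P F T qv Q T Psi = \int[coord_measure]_p (hs_coord Psi p ^+ 2)%:E.
Proof.
move=> hPsi mPsi; rewrite Lambda2_norm2_mu// ?lexx ?ltW//.
rewrite [RHS](@fubini_tonelli1 _ _ _ _ _ mu (sigma_counting R)); last 2 first.
- exact: measurable_sqr_EFin (measurable_coord mPsi).
- by [].
apply: eq_integral => y _; rewrite /fubini_F [RHS](@ge0_integral_count R)//.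
rewrite patchE; case: ifPn => [yT|yT].
  apply: eq_eseriesr => i _; by rewrite /hs_coord patchE yT.
rewrite eseries0// => i _ _; by rewrite /hs_coord patchE (negbTE yT) expr0n.
Qed.

Lemma Lambda2_norm_coord Psi : hs_valued Psi -> weakly_measurable Psi ->
  Lambda2_norm P F T qv Q Psi = l2norm coord_measure (hs_coord Psi).
Proof. by move=> hPsi mPsi; rewrite /Lambda2_norm Lambda2_norm2_coord. Qed.

(** Membership in [Lambda2] stated through coordinates, where linear combinations of integrands
    reduce to those of real functions. *)
Definition regular (Psi : process) := [/\ hs_valued Psi, weakly_measurable Psi &
  l2norm coord_measure (hs_coord Psi) < +oo].

Lemma regular_Lambda2 Psi : regular Psi -> Lambda2 P F T qv Q Psi.
Proof.
move=> [hPsi mPsi foo]; split => //; last by rewrite Lambda2_norm2_coord// -l2norm_lty.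
move=> h; apply: weak_measurable => //.
exact: measurable_slabT.
Qed.

Lemma hs_coord_lin (a : R) Psi Psi' p :
  (hs_coord (a *: Psi + Psi') p = a * hs_coord Psi p + hs_coord Psi' p)%R.
Proof.
rewrite /hs_coord !patchE; case: ifPn => _; last by rewrite mulr0 addr0.
by rewrite -hs_coef_lin.
Qed.

Lemma regular_subspace : linear_subspace regular.
Proof.
have linP x := (psqrt_bounded (Q x)).1; have contP x := (psqrt_bounded (Q x)).2.
split.
- split.
  + by move=> x _; exact: (HS_range0 g_parseval b_parseval H_sep (linP x) (contP x)).
  + move=> h k; rewrite (_ : (fun x => _) = cst 0%R); first exact: measurable_cst.
    by apply/funext => x; exact: dot0l.
  + rewrite l2norm_lty integral0_eq// => p _.
    rewrite (_ : hs_coord 0%R p = 0%R) ?expr0n//.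
    by rewrite /hs_coord patchE; case: ifP => // _; rewrite /hs_coef dot0l.
- move=> a Psi Psi' [h m f] [h' m' f']; split.
  + move=> x Tx.
    by apply: (HS_range_lin g_parseval b_parseval H_sep (linP x) (contP x)); [exact: h|exact: h'].
  + move=> u k.
    rewrite (_ : (fun x => _) = (fun x => a * dot (Psi x (psqrt (Q x) u)) k
      + dot (Psi' x (psqrt (Q x) u)) k)%R); last by apply/funext => x; exact: dotPl.
    have := measurable_funD (measurable_funM (measurable_cst a) (m u k)) (m' u k).
    exact.
  + rewrite (_ : hs_coord _ = fun p => a * hs_coord Psi p + hs_coord Psi' p)%R.
      by apply: l2norm_lin_lty => //; exact: measurable_coord.
    by apply/funext => p; exact: hs_coord_lin.
Qed.

Lemma hs_coord_sub_sum n (a : 'I_n -> R) Psi (K : 'I_n -> process) p :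
  hs_coord (Psi - \sum_(j < n) a j *: K j)%R p =
  (hs_coord Psi p - \sum_(j < n) a j * hs_coord (K j) p)%R.
Proof.
elim: n a K Psi => [|n IH] a K Psi; first by rewrite !big_ord0 !subr0.
rewrite !big_ord_recl opprD addrA IH -scaleNr [X in hs_coord X p]addrC hs_coord_lin.
by rewrite opprD addrA mulNr (addrC (- _)%R).
Qed.

End coordinates.

(** * The stochastic integral in coordinates *)

Section isometry.
Local Open Scope ereal_scope.
Context {R : realType} {d} {Omega : measurableType d}.
Variables (P : probability Omega R) (F : R -> set (set Omega)).
Context {U : ptopologicalType} {H G : hilbertType R}.
Variables (T : R) (qv : Omega -> set (R * borel U) -> \bar R) (Q : Omega * R * U -> H -> H).
Hypotheses (F_usual : usual_filtration P F) (T_gt0 : (0 < T)%R).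
Hypotheses (H_sep : separable H) (G_sep : separable G).
Variable mu : {sigma_finite_measure set (Omega * (R * borel U))%type -> \bar R}.
Hypothesis muE : forall C : set (predictableType F * borel U), measurable C ->
  doleans P F T qv C = mu (@reassoc R d Omega F U @^-1` C).
Variables (g : nat -> G) (b : nat -> H).
Hypotheses (g_parseval : parseval setT setT g) (b_parseval : parseval setT setT b).
Variables (calA : set (set U)) (M : R -> set U -> H -> Omega -> R).
Local Notation process := (Omega * R * U -> H -> G)%type.
Variable I : process -> R -> Omega -> G.
Hypothesis I_M : is_stochastic_integral P F calA M T qv Q I.
Local Notation regular := (regular F T Q mu g b).

Let regular_L2 Psi : regular Psi -> Lambda2 P F T qv Q Psi.
Proof. exact: (regular_Lambda2 F_usual T_gt0 H_sep G_sep muE g_parseval b_parseval). Qed.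

Lemma MT2_norm_ae (X Y : R -> Omega -> G) :
  {ae P, forall w t, (0 <= t <= T)%R -> X t w = Y t w} -> MT2_norm P T X = MT2_norm P T Y.
Proof.
move=> XY; rewrite /MT2_norm; congr (ereal_sup _ `^ _).
apply: eq_imagel => t /=; rewrite in_itv/= => tT.
apply: ge0_ae_eq_integralT => //.
by apply: filterS XY => w ->.
Qed.

(** The squared L2 norm of the integral at time [t] is [Lambda2_norm2] at [t], which is
    nondecreasing, so the supremum over [0, T] is attained at [T]. *)
Lemma MT2_norm_integral Psi : regular Psi ->
  MT2_norm P T (I Psi) = l2norm (coord_measure mu) (hs_coord F T Q g b Psi).
Proof.
move=> rPsi; have [hPsi mPsi _] := rPsi; have LPsi := regular_L2 rPsi.
rewrite -(Lambda2_norm_coord F_usual T_gt0 H_sep muE g_parseval b_parseval hPsi mPsi).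
rewrite /MT2_norm /Lambda2_norm; congr (_ `^ _).
have [_ _ isom _] := I_M.
apply/eqP; rewrite eq_le; apply/andP; split.
- apply: ge_ereal_sup => _ [t /= + <-]; rewrite in_itv/= => tT.
  rewrite isom//.
  exact: (Lambda2_norm2_le F_usual T_gt0 H_sep muE g_parseval b_parseval).
- have TT : (0 <= T <= T)%R by rewrite lexx ltW.
  by rewrite -isom//; apply: ereal_sup_ubound; exists T => //=.
Qed.

Lemma regular_sub_sum n (a : 'I_n -> R) Psi (K : 'I_n -> process) :
  regular Psi -> (forall j, regular (K j)) -> regular (Psi - \sum_(j < n) a j *: K j)%R.
Proof.
have rs := regular_subspace Q F_usual T_gt0 H_sep mu g_parseval b_parseval.
by move=> rPsi rK; apply: (subspaceB rs) => //; apply: (subspace_sum _ rs) => j; exact: (subspaceZ _ rs).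
Qed.

(** [I] is linear only up to indistinguishability, so the combination is unfolded one term at a
    time, off one more null set at each step. *)
Lemma integral_sub_sum n (a : 'I_n -> R) Psi (K : 'I_n -> process) :
  regular Psi -> (forall j, regular (K j)) ->
  {ae P, forall w t, (0 <= t <= T)%R ->
    I (Psi - \sum_(j < n) a j *: K j)%R t w =
    (I Psi - \sum_(j < n) a j *: I (K j))%R t w}.
Proof.
elim: n a K => [|n IH] a K rPsi rK; first by apply: aeW => w t _; rewrite !big_ord0 !subr0.
have [_ Ilin _ _] := I_M.
pose K' := fun j : 'I_n => K (lift ord0 j); pose a' := fun j : 'I_n => a (lift ord0 j).
have r' : regular (Psi - \sum_(j < n) a' j *: K' j)%R.
  by apply: regular_sub_sum => // j; exact: rK.
have := Ilin (- a ord0)%R (K ord0) _ (regular_L2 (rK ord0)) (regular_L2 r').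
have := IH a' K' rPsi (fun j => rK (lift ord0 j)).
apply: filterS2 => w e1 e2 t tT.
have -> : (Psi - \sum_(j < n.+1) a j *: K j)%R =
    (- a ord0 *: K ord0 + (Psi - \sum_(j < n) a' j *: K' j))%R.
  by rewrite big_ord_recl opprD scaleNr [in RHS]addrCA.
rewrite e2// e1// [in RHS]big_ord_recl opprD scaleNr.
rewrite [RHS](_ : _ = (- a ord0 *: I (K ord0) +
  (I Psi - \sum_(j < n) a' j *: I (K' j)))%R t w); last first.
  by rewrite [in RHS]addrCA scaleNr.
by rewrite -scaleNr.
Qed.

End isometry.

Lemma l2norm_ae d (T : measurableType d) (R : realType) (m : {measure set T -> \bar R})
    (f h : T -> R) : {ae m, forall x, f x = h x} -> l2norm m f = l2norm m h.
Proof.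
move=> fh; rewrite /l2norm; congr (_ `^ _)%E; apply: ge0_ae_eq_integralT => //.
by apply: filterS fh => x ->.
Qed.

(** * The integral of the field over the parameter space *)

Section integrand.
Local Open Scope ereal_scope.
Context {R : realType} {d} {Omega : measurableType d}.
Variables (P : probability Omega R) (F : R -> set (set Omega)).
Context {U : ptopologicalType} {H G : hilbertType R}.
Variables (T : R) (qv : Omega -> set (R * borel U) -> \bar R) (Q : Omega * R * U -> H -> H).
Hypotheses (F_usual : usual_filtration P F) (T_gt0 : (0 < T)%R).
Hypotheses (H_sep : separable H) (G_sep : separable G).
Variable mu : {sigma_finite_measure set (Omega * (R * borel U))%type -> \bar R}.
Hypothesis muE : forall C : set (predictableType F * borel U), measurable C ->
  doleans P F T qv C = mu (@reassoc R d Omega F U @^-1` C).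
Variables (g : nat -> G) (b : nat -> H).
Hypotheses (g_parseval : parseval setT setT g) (b_parseval : parseval setT setT b).
Context {dE} {E : measurableType dE}.
Variable rho : {sigma_finite_measure set E -> \bar R}.
Variable Phi : Omega * R * U -> E -> H -> G.
Hypothesis Phi_L12 : Lambda12 P F T qv Q rho Phi.

Local Notation ra := (@reassoc R d Omega F U).
Local Notation sl := (@slab R d Omega F U).
Local Notation space := (predictableType F * borel U)%type.
Local Notation regular := (regular F T Q mu g b).
Local Notation hs_coord := (hs_coord F T Q g b).
Local Notation count := (sigma_counting R).

Let mslab : measurable (sl T). Proof. exact: (measurable_slabT F_usual T_gt0). Qed.
Let mra : measurable_fun setT ra. Proof. exact: (measurable_reassoc F_usual). Qed.

Definition pairing h k (z : space * E) : R :=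
  ((fun z : space * E => dot (Phi z.1 z.2 (psqrt (Q z.1) h)) k) \_ (sl T `*` setT)) z.

Lemma pairing_slab h k x e : sl T x -> pairing h k (x, e) = dot (Phi x e (psqrt (Q x) h)) k.
Proof. by move=> Tx; rewrite /pairing patchE mem_set. Qed.

Lemma pairing_off h k x e : ~ sl T x -> pairing h k (x, e) = 0%R.
Proof. by move=> Tx; rewrite /pairing patchE memNset// => -[]. Qed.

Lemma measurable_pairing h k : measurable_fun setT (pairing h k).
Proof.
have [_ mPhi _] := Phi_L12.
have mD : measurable (sl T `*` setT : set (space * E)) by exact: measurableX.
exact: (iffLR (measurable_restrictT _ mD) (mPhi h k)).
Qed.

Definition coefficient (p : nat * (space * E)) : R :=
  pairing (pair_fst b p.1) (pair_snd g p.1) p.2.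

Lemma measurable_coefficient : measurable_fun setT coefficient.
Proof.
exact: (measurable_fun_nat_prod (fun i => measurable_pairing (pair_fst b i) (pair_snd g i))).
Qed.

Lemma coefficient_slab x e i : sl T x ->
  coefficient (i, (x, e)) = hs_coef g b (Phi x e \o psqrt (Q x)) i.
Proof. exact: pairing_slab. Qed.

Lemma measurable_pairing_slice x h k : sl T x ->
  measurable_fun setT (fun e => dot (Phi x e (psqrt (Q x) h)) k).
Proof.
move=> Tx; have := measurable_sections1 (measurable_pairing h k) x.
by congr measurable_fun; apply/funext => e; exact: pairing_slab.
Qed.

Lemma slice_weakly_measurable e : weakly_measurable F T Q (fun x => Phi x e).
Proof.
move=> h k; apply: (iffRL (measurable_restrictT _ mslab)).
have := measurable_sections2 (measurable_pairing h k) e.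
congr measurable_fun; apply/funext => x; rewrite patchE; case: ifPn => [|].
  by rewrite inE => Tx; exact: pairing_slab.
by rewrite notin_setE => Tx; exact: pairing_off.
Qed.

Lemma slice_hs_valued e : hs_valued F T Q (fun x => Phi x e).
Proof. by move=> x Tx; case: Phi_L12 => + _ _; exact. Qed.

Definition field_coord (q : ((Omega * (R * borel U)) * nat) * E) : R :=
  hs_coord (fun x => Phi x q.2) q.1.

Lemma field_coordE y i e : field_coord ((y, i), e) = coefficient (i, (ra y, e)).
Proof.
rewrite /field_coord /hs_coord patchE; case: ifPn => [|].
  by rewrite inE => Ty; rewrite -coefficient_slab.
by rewrite notin_setE => Ty; rewrite /coefficient pairing_off.
Qed.

Lemma measurable_field_coord : measurable_fun setT field_coord.
Proof.
pose t (q : ((Omega * (R * borel U)) * nat) * E) := (q.1.2, (ra q.1.1, q.2)).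
have mt : measurable_fun setT t.
  apply/measurable_fun_pairP; split.
    exact: (measurableT_comp measurable_snd measurable_fst).
  apply/measurable_fun_pairP; split; last exact: measurable_snd.
  exact: (measurableT_comp mra (measurableT_comp measurable_fst measurable_fst)).
have := measurableT_comp measurable_coefficient mt.
by congr measurable_fun; apply/funext => -[[y i] e]; rewrite field_coordE.
Qed.

Lemma slice_regular e : l2norm (coord_measure mu) (fun p => field_coord (p, e)) < +oo ->
  regular (fun x => Phi x e).
Proof. by split; [exact: slice_hs_valued|exact: slice_weakly_measurable|]. Qed.

Lemma field_coord_lty : \int[rho]_e l2norm (coord_measure mu) (fun p => field_coord (p, e)) < +oo.
Proof.
have [_ _] := Phi_L12; congr (_ < _); apply: eq_integral => e _.
exact: (Lambda2_norm_coord F_usual T_gt0 H_sep muE g_parseval b_parseval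
  (@slice_hs_valued e) (@slice_weakly_measurable e)).
Qed.

Definition hs_size (z : space * E) : \bar R := l2norm count (fun i => coefficient (i, z)).

Lemma measurable_hs_size : measurable_fun setT hs_size.
Proof. exact: (measurable_l2norm_section count measurable_coefficient). Qed.

Lemma hs_size_ge0 z : 0 <= hs_size z. Proof. exact: l2norm_ge0. Qed.

Lemma hs_size_slab x e : sl T x ->
  hs_size (x, e) = l2norm count (fun i => hs_coef g b (Phi x e \o psqrt (Q x)) i).
Proof.
by move=> Tx; congr l2norm; apply/funext => i; exact: coefficient_slab.
Qed.

Lemma hs_size_lty z : hs_size z < +oo.
Proof.
case: z => x e; have [Tx|Tx] := pselect (sl T x).
  rewrite hs_size_slab//.
  have hx : HSQ Q x (Phi x e) := @slice_hs_valued e x Tx.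
  have [linA contA] := psqrt_bounded (Q x).
  exact: (HS_norm_lty g_parseval b_parseval H_sep linA contA hx).
rewrite l2norm_lty integral0_eq// => i _.
by rewrite /coefficient pairing_off// expr0n.
Qed.

Definition total_size (x : space) : \bar R := \int[rho]_e hs_size (x, e).

Lemma measurable_total_size : measurable_fun setT total_size.
Proof.
exact: (@measurable_fun_fubini_tonelli_F _ _ _ _ _ rho hs_size measurable_hs_size hs_size_ge0).
Qed.

(** By Tonelli's theorem, the L2 norm in [y] of the Hilbert-Schmidt size of the field at [e] is the
    [coord_measure] norm of its coordinates. These norms have finite integral over [e], so
    [ae_integrable_section] applies to the sizes themselves. *)
Lemma total_size_ae : {ae mu, forall y, total_size (ra y) < +oo}.
Proof.
pose F0 (z : (Omega * (R * borel U)) * E) : R := fine (hs_size (ra z.1, z.2)).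
have F0E z : (F0 z)%:E = hs_size (ra z.1, z.2).
  by rewrite fineK// ge0_fin_numE ?hs_size_ge0// hs_size_lty.
have mF0 : measurable_fun setT F0.
  apply: measurableT_comp => //; apply: (measurableT_comp measurable_hs_size).
  apply/measurable_fun_pairP; split; last exact: measurable_snd.
  exact: measurableT_comp mra measurable_fst.
have := @ae_integrable_section _ _ _ _ _ mu rho _ mF0.
have -> : \int[rho]_e l2norm mu (fun x => F0 (x, e)) =
    \int[rho]_e l2norm (coord_measure mu) (fun p => field_coord (p, e)).
  apply: eq_integral => e _; congr (_ `^ _).
  rewrite [RHS](@fubini_tonelli1 _ _ _ _ _ mu count); last 2 first.
  - exact: measurable_sqr_EFin (measurable_sections2 measurable_field_coord e).
  - by move=> p; exact: sqr_ge0E.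
  apply: eq_integral => y _; rewrite /fubini_F expr2 EFinM F0E /hs_size sqr_l2norm.
  by apply: eq_integral => i _; rewrite field_coordE.
move=> /(_ field_coord_lty); apply: filterS => y /integrableP[_].
congr (_ < _); apply: eq_integral => e _.
by rewrite F0E gee0_abs// hs_size_ge0.
Qed.

Definition good_points : set space := [set x | total_size x < +oo].

Lemma measurable_good_points : measurable good_points.
Proof.
rewrite (_ : good_points = ~` (total_size @^-1` [set +oo])); last first.
  by apply/seteqP; split=> x; rewrite /good_points/= ltey => /eqP.
apply: measurableC; rewrite -[X in measurable X]setTI.
by apply: measurable_total_size => //; exact: emeasurable_set1.
Qed.

Lemma bad_points_negligible : (doleans P F T qv).-negligible (~` good_points).
Proof.
exists (~` good_points); split => //; first exact: measurableC measurable_good_points.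
rewrite muE; last exact: measurableC measurable_good_points.
have mB : measurable (ra @^-1` (~` good_points)).
  rewrite -[X in measurable X]setTI; apply: mra => //.
  exact: measurableC measurable_good_points.
exact: (iffLR (negligibleP mu mB) total_size_ae).
Qed.

Lemma good_pointsP x : sl T x -> good_points x <->
  \int[rho]_e l2norm count (fun i => hs_coef g b (Phi x e \o psqrt (Q x)) i) < +oo.
Proof.
move=> Tx; rewrite /good_points /= /total_size.
suff -> : \int[rho]_e hs_size (x, e) =
  \int[rho]_e l2norm count (fun i => hs_coef g b (Phi x e \o psqrt (Q x)) i) by [].
by apply: eq_integral => e _; exact: hs_size_slab.
Qed.

Lemma field_integrable x : sl T x -> good_points x ->
  bochner_integrable rho (HSQ Q x) (HSQ_norm Q x) (Phi x).
Proof.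
move=> Tx /(good_pointsP Tx) gx; have [linA contA] := psqrt_bounded (Q x).
have hP e : HSQ Q x (Phi x e) := @slice_hs_valued e x Tx.
exact: (pointwise_integrable g_parseval b_parseval H_sep linA contA hP
  (fun h k => measurable_pairing_slice h k Tx) gx).
Qed.

Definition field_mean (x : Omega * R * U) : H -> G :=
  bochner rho (HSQ Q x) (HSQ_norm Q x) (Phi x).

Lemma field_mean_good x : sl T x -> good_points x ->
  is_bochner_integral rho (HSQ Q x) (HSQ_norm Q x) (Phi x) (field_mean x).
Proof.
move=> Tx /(good_pointsP Tx) gx; have [linA contA] := psqrt_bounded (Q x).
have hP e : HSQ Q x (Phi x e) := @slice_hs_valued e x Tx.
have [v hv] := pointwise_integral_exists g_parseval b_parseval H_sep linA contA hP
  (fun h k => measurable_pairing_slice h k Tx) gx.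
exact: (xgetPex 0%R (ex_intro _ v hv)).
Qed.

Lemma field_mean_bad x : sl T x -> ~ good_points x -> field_mean x = 0%R.
Proof.
move=> Tx bx; have [linA contA] := psqrt_bounded (Q x).
have hP e : HSQ Q x (Phi x e) := @slice_hs_valued e x Tx.
rewrite /field_mean /bochner xgetPN// => v hv; apply: bx; apply/(good_pointsP Tx).
exact: (pointwise_converse g_parseval b_parseval H_sep linA contA hP
  (fun h k => measurable_pairing_slice h k Tx) hv).
Qed.

(** One formula covers the slab: at good points the matrix coefficients commute with the integral,
    and at the others no integral exists and [bochner] is 0. Measurability of the mean is read off
    it. *)
Lemma field_mean_pairing x h k : sl T x -> dot (field_mean x (psqrt (Q x) h)) k =
  (fine (\int[rho]_e (pairing h k (x, e))%:E) * \1_good_points x)%R.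
Proof.
move=> Tx; have [linA contA] := psqrt_bounded (Q x).
have [gx|bx] := pselect (good_points x); last first.
  rewrite field_mean_bad// indicE memNset// mulr0.
  by rewrite [X in dot X _](_ : _ = 0%R)// dot0l.
rewrite indicE mem_set// mulr1.
rewrite (pointwise_functional g_parseval b_parseval H_sep linA contA
  (fun h k => measurable_pairing_slice h k Tx) h k (field_mean_good Tx gx)).
by congr fine; apply: eq_integral => e _; rewrite pairing_slab.
Qed.

Lemma field_mean_hs_valued : hs_valued F T Q field_mean.
Proof.
move=> x Tx; have [linA contA] := psqrt_bounded (Q x).
have [gx|bx] := pselect (good_points x); first by have [] := field_mean_good Tx gx.
rewrite field_mean_bad//.
exact: (HS_range0 g_parseval b_parseval H_sep linA contA).
Qed.

Lemma field_mean_weakly_measurable : weakly_measurable F T Q field_mean.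
Proof.
move=> h k.
have mp : measurable_fun setT (fun z => (pairing h k z)%:E).
  by apply/measurable_EFinP; exact: measurable_pairing.
(* At bad points the pairing need not be integrable; measurability comes from Tonelli's theorem for
   its positive and negative parts separately. *)
have mint : measurable_fun setT (fun x => \int[rho]_e (pairing h k (x, e))%:E).
  have m1 := @measurable_fun_fubini_tonelli_F _ _ _ _ _ rho _ (measurable_funepos mp) (funepos_ge0 _).
  have m2 := @measurable_fun_fubini_tonelli_F _ _ _ _ _ rho _ (measurable_funeneg mp) (funeneg_ge0 _).
  have := emeasurable_funB m1 m2.
  by congr measurable_fun; apply/funext => x; rewrite [RHS]integralE; congr (_ - _);
    apply: eq_integral => e _; rewrite !(funeposE, funenegE).
have mm : measurable_fun (sl T) (fun x =>
    fine (\int[rho]_e (pairing h k (x, e))%:E) * \1_good_points x)%R.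
  apply: measurable_funTS; apply: measurable_funM; first exact: measurableT_comp mint.
  exact: (measurable_indic measurable_good_points).
apply: eq_measurable_fun mm => x; rewrite inE => Tx.
by rewrite field_mean_pairing.
Qed.

Lemma field_mean_coord : {ae coord_measure mu, forall p,
  hs_coord field_mean p = fine (\int[rho]_e (field_coord (p, e))%:E)}.
Proof.
have [N [mN N0 badN]] := total_size_ae.
exists (N `*` setT); split; first exact: measurableX.
- transitivity (mu N * count setT); last by rewrite N0 mul0e.
  exact: (product_measure1E mu count mN measurableT).
move=> -[y i] /= hyi; split => //=; apply: badN => /= gy; apply: hyi.
under eq_integral do rewrite field_coordE.
rewrite /hs_coord patchE; case: ifPn => [|].
  rewrite inE => Ty; rewrite /hs_coef /= field_mean_pairing//.
  by rewrite indicE mem_set// mulr1.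
rewrite notin_setE => Ty; rewrite integral0_eq// => e _.
by rewrite /coefficient pairing_off.
Qed.

Lemma field_mean_regular : regular field_mean.
Proof.
split; [exact: field_mean_hs_valued|exact: field_mean_weakly_measurable|].
rewrite (l2norm_ae field_mean_coord).
exact: le_lt_trans (minkowski_Rintegral _ _ measurable_field_coord) field_coord_lty.
Qed.

End integrand.

(** * Processes and evaluation *)

(** A point before [T] is a limit of rationals from the right, where both functions are
    right-continuous. No point of [0, T] lies to the right of [T], so agreement there is assumed. *)
Lemma cadlag_eq (R : realType) (G : hilbertType R) (T : R) (X Y : R -> G) :
  cadlag `[0, T]%classic X -> cadlag `[0, T]%classic Y ->
  (forall q : rat, 0 <= (ratr q : R) <= T -> X (ratr q) = Y (ratr q)) -> X T = Y T ->
  forall t, 0 <= t <= T -> X t = Y t.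
Proof.
move=> cX cY XYq XYT t /andP[t0]; rewrite le_eqVlt => /predU1P[->//|tT].
have tD : `[0, T]%classic t by rewrite /= in_itv/= t0 ltW.
have [rX _] := cX t tD; have [rY _] := cY t tD.
apply/eqP; rewrite -subr_eq0 -normr_eq0 eq_le normr_ge0 andbT.
apply/ler_addgt0Pr => e e0; rewrite add0r.
have e20 : 0 < e / 2 by rewrite divr_gt0.
move/cvgrPdist_lt: rX => /(_ _ e20) hX; move/cvgrPdist_lt: rY => /(_ _ e20) hY.
have /nbhs_ballP[r /= r0 hr] : nbhs t (fun y => t < y -> `[0, T]%classic y ->
    `|X t - X y| < e / 2 /\ `|Y t - Y y| < e / 2) by exact: filterI hX hY.
have [|q] := @rat_in_itvoo R t (Num.min (t + r) T).
  by rewrite lt_min tT ltrDl r0.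
rewrite in_itv/= => /andP[tq qr].
move: qr; rewrite lt_min => /andP[qr qT].
have q0 : 0 <= (ratr q : R) <= T by rewrite (ltW qT) andbT ltW// (le_lt_trans t0).
have [|||h1 h2] := hr (ratr q).
- rewrite /ball/= ltr_norml; lra.
- by [].
- by rewrite in_itv.
rewrite (_ : X t - Y t = (X t - X (ratr q)) - (Y t - Y (ratr q))); last first.
  by rewrite XYq// opprB addrA subrK.
apply: (le_trans (ler_normB _ _)); rewrite [leRHS](splitr e); exact: ltW (ltrD h1 h2).
Qed.

Section evaluation.
Local Open Scope ereal_scope.
Context {R : realType} {d} {Omega : measurableType d}.
Variables (P : probability Omega R) (F : R -> set (set Omega)).
Hypothesis F_usual : usual_filtration P F.
Context {G : hilbertType R}.
Variable T : R.
Implicit Types X : R -> Omega -> G.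

Lemma L2_norm_le_MT2 X t : (0 <= t <= T)%R -> L2_norm P (X t) <= MT2_norm P T X.
Proof.
move=> tT.
have h : \int[P]_w (`|X t w| ^+ 2)%:E <=
    ereal_sup [set \int[P]_w (`|X t w| ^+ 2)%:E | t in `[0%R, T]%classic].
  by apply: ereal_sup_ubound; exists t => //=; rewrite in_itv.
have h0 : 0 <= \int[P]_w (`|X t w| ^+ 2)%:E by apply: integral_ge0.
by apply: gt0_ler_poweR; rewrite ?invr_ge0 ?in_itv/= ?h0 ?leey ?(le_trans h0 h).
Qed.

Lemma MT2_L2 X t : (0 <= t <= T)%R -> MT2 P F T X -> L2 P (X t).
Proof.
move=> /andP[t0 tT] [adX _ _ _ Xoo]; split.
  move=> _ B mB; rewrite setTI; apply: (F_measurable F_usual t0).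
  by apply: adX => //; rewrite t0.
rewrite -(l2norm_lty P (fun w => `|X t w|%R)) -L2_normE.
by apply: (le_lt_trans _ Xoo); apply: L2_norm_le_MT2; rewrite t0.
Qed.

Lemma is_bochner_integral_eval {dE} {E : measurableType dE} (rho : {measure set E -> \bar R})
    (f : E -> R -> Omega -> G) X t : (0 <= t <= T)%R ->
  is_bochner_integral rho (MT2 P F T) (MT2_norm P T) f X ->
  is_bochner_integral rho (L2 P) (L2_norm P) (fun e => f e t) (X t).
Proof.
move=> tT; apply: (is_bochner_integral_map (t := fun Y : R -> Omega -> G => Y t)).
- by move=> v; exact: poweR_ge0.
- by [].
- by move=> Y; exact: MT2_L2.
- by move=> Y; exact: L2_norm_le_MT2.
Qed.

End evaluation.

Theorem theorem6p24 (R : realType)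
  (d : measure_display) (Omega : measurableType d) (P : probability Omega R)
  (P_complete : measure_is_complete P)
  (F : R -> set (set Omega)) (F_usual : usual_filtration P F)
  (U : ptopologicalType) (U_borel : homeomorphic_to_borel R U)
  (calA : set (set U)) (calA_ring : borel_ring calA)
  (T : R) (T_gt0 : 0 < T)
  (H G : hilbertType R) (H_sep : separable H) (G_sep : separable G)
  (M : R -> set U -> H -> Omega -> R)
  (M_omvm : cylindrical_omvm P F calA M)
  (nu : H -> Omega -> set (R * borel U) -> \bar R)
  (nu_intensity : is_intensity P F calA M nu)
  (nu_bounded : sequentially_bounded P calA nu)
  (qv : Omega -> set (R * borel U) -> \bar R)
  (qv_M : is_unique_quadratic_variation P calA nu qv)
  (qv_bounded : bounded_qv P calA T qv)
  (nu_signed : polarization_signed_measure P nu T)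
  (Q : Omega * R * U -> H -> H) (Q_M : is_QM P F nu T qv Q)
  (I : (Omega * R * U -> H -> G) -> R -> Omega -> G)
  (I_M : is_stochastic_integral P F calA M T qv Q I)
  (dE : measure_display) (E : measurableType dE)
  (rho : {sigma_finite_measure set E -> \bar R})
  (Phi : Omega * R * U -> E -> H -> G)
  (Phi_L12 : Lambda12 P F T qv Q rho Phi) :
  let intPhi : Omega * R * U -> H -> G :=
    fun x => bochner rho (HSQ Q x) (HSQ_norm Q x) (Phi x) in
  let IPhi : E -> R -> Omega -> G := fun e => I (fun x => Phi x e) in
  ({ae doleans P F T qv, forall x, slab F T x ->
      bochner_integrable rho (HSQ Q x) (HSQ_norm Q x) (Phi x)} /\
   Lambda2 P F T qv Q intPhi) /\
  (bochner_integrable rho (MT2 P F T) (MT2_norm P T) IPhi /\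
   forall t, 0 <= t <= T ->
     is_bochner_integral rho (L2 P) (L2_norm P) (fun e => IPhi e t)
       (bochner rho (MT2 P F T) (MT2_norm P T) IPhi t)) /\
  (* J is a cadlag version of the process of the L^2 integrals over E. *)
  (forall J : R -> Omega -> G,
     {ae P, forall w, cadlag `[0, T] (J ^~ w)} ->
     (forall t, 0 <= t <= T ->
        is_bochner_integral rho (L2 P) (L2_norm P) (fun e => IPhi e t) (J t)) ->
     {ae P, forall w t, 0 <= t <= T -> I intPhi t w = J t w}).
Proof.
move=> intPhi IPhi.
have [[qv_random _ _ _] _] := qv_M.
(* The exhausting sets are those of the L2-valued measure at time 1 and vector 0; any positive time
   and any vector would provide some. *)
have [Un [hUn TUn _ _]] : exists Un : nat -> set U, _ := let: And4 _ _ L _ := M_omvm in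
  let: And3 _ _ x := L 1 0 ltr01 in x.
have [g g_parseval] := parseval_sequence G_sep.
have [b b_parseval] := parseval_sequence H_sep.
have [mu muE] := doleans_sigma_finite F_usual qv_random qv_bounded
  (fun n => let: And4 h _ _ _ := hUn n in h) (fun n => let: And4 _ h _ _ := hUn n in h)
  (fun n => let: And4 h _ h' _ := hUn n in h' _ h (@subset_refl _ _)) TUn.
pose m := coord_measure mu; pose f := field_coord F T Q g b Phi.
have mf : measurable_fun setT f := measurable_field_coord F_usual T_gt0 g b Phi_L12.
have f_fin : (\int[rho]_e l2norm m (fun p => f (p, e)) < +oo)%E :=
  field_coord_lty F_usual T_gt0 H_sep muE g_parseval b_parseval Phi_L12.
have slice_reg e : (l2norm m (fun p => f (p, e)) < +oo)%E ->
    regular F T Q mu g b (fun x => Phi x e).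
  exact: (slice_regular F_usual T_gt0 Phi_L12).
have mean_reg : regular F T Q mu g b intPhi :=
  field_mean_regular F_usual T_gt0 H_sep muE g_parseval b_parseval Phi_L12.
have intL Psi : regular F T Q mu g b Psi -> Lambda2 P F T qv Q Psi :=
  @regular_Lambda2 _ _ _ _ _ _ _ _ _ _ _ F_usual T_gt0 H_sep G_sep mu muE g b g_parseval b_parseval Psi.
have [I_MT2 _ _ _] := I_M.
have N0 (v : R -> Omega -> G) : (0 <= MT2_norm P T v)%E by exact: poweR_ge0.
have FS e : (l2norm m (fun p => f (p, e)) < +oo)%E -> MT2 P F T (IPhi e).
  by move=> /slice_reg/intL/I_MT2.
(* The isometry is wanted for differences with finite combinations, which [I] respects up to a null
   set. *)
have I_norm n (a : 'I_n -> R) Psi (K : 'I_n -> _) : regular F T Q mu g b Psi ->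
    (forall j, regular F T Q mu g b (K j)) ->
    MT2_norm P T (I Psi - \sum_(j < n) a j *: I (K j))%R =
    l2norm m (fun p => hs_coord F T Q g b Psi p - \sum_(j < n) a j * hs_coord F T Q g b (K j) p).
  move=> rPsi rK.
  have h := integral_sub_sum F_usual T_gt0 H_sep G_sep muE g_parseval b_parseval I_M a rPsi rK.
  rewrite -(MT2_norm_ae h).
  rewrite (MT2_norm_integral F_usual T_gt0 H_sep G_sep muE g_parseval b_parseval I_M); last first.
    exact: (regular_sub_sum F_usual T_gt0 H_sep g_parseval b_parseval).
  by congr l2norm; apply/funext => p; exact: hs_coord_sub_sum.
have FN s : good_sample m rho f s -> forall e, (l2norm m (fun p => f (p, e)) < +oo)%E ->
    MT2_norm P T (IPhi e -
      \sum_(i < sample_size s) \1_(sample_set i) e *: IPhi (@sample_point _ _ s i))%R =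
    sample_error m f s e.
  move=> gs e /slice_reg re; apply: I_norm => // j; apply: slice_reg.
  by have [] := gs j.
(* The candidate is the stochastic integral of the pointwise mean; its distance to the integral of a
   sampled step is computed in coordinates. *)
have mean_int : is_bochner_integral rho (MT2 P F T) (MT2_norm P T) IPhi (I intPhi).
  apply: (@is_bochner_integral_samples _ _ _ _ _ m rho f mf f_fin _ _ _ _ N0 FS FN).
    exact/I_MT2/intL.
  move=> s gs; rewrite I_norm//; last first.
    by move=> j; apply: slice_reg; have [] := gs j.
  rewrite (@l2norm_ae _ _ _ m _ (fun p => fine (\int[rho]_e (f (p, e))%:E) -
    \sum_(i < sample_size s) fine (rho (sample_set i)) * f (p, @sample_point _ _ s i)))//.
  have := field_mean_coord F_usual T_gt0 H_sep muE g_parseval b_parseval Phi_L12.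
  by apply: filterS => p hp; congr (_ - _).
split; [|split; [split|]].
- split; last exact: intL.
  have [B [mB B0 badB]] :=
    bad_points_negligible F_usual T_gt0 H_sep muE g_parseval b_parseval Phi_L12.
  exists B; split => // x /= nx; apply: badB => gx; apply: nx => Tx.
  exact: (field_integrable F_usual T_gt0 H_sep g_parseval b_parseval Phi_L12 Tx gx).
- exact: (@bochner_integrable_samples _ _ _ _ _ m rho f mf f_fin _ _ _ _ N0 FS FN).
- move=> t tT; apply: (is_bochner_integral_eval F_usual tT).
  (* [bochner] picks some integral; [mean_int] guarantees that one exists. *)
  exact: (xgetPex 0 (ex_intro _ _ mean_int)).
- move=> J cJ intJ.
  have eqt t : 0 <= t <= T -> {ae P, forall w, I intPhi t w = J t w}.
    move=> tT.
    exact: (L2_bochner_unique G_sep (is_bochner_integral_eval F_usual tT mean_int) (intJ t tT)).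
  have [_ _ _ cI _] := I_MT2 _ (intL _ mean_reg).
  (* The rationals are indexed by [nat], so that countably many null sets can be united. *)
  have eqq : {ae P, forall w n, if unpickle n is Some q then
      0 <= (ratr q : R) <= T -> I intPhi (ratr q) w = J (ratr q) w else True}.
    apply/ae_foralln => n; case: unpickle => [q|]; last exact: aeW.
    have [qT|qT] := boolP (0 <= (ratr q : R) <= T); last by apply: aeW.
    by apply: filterS (eqt _ qT) => w.
  (* The endpoint is treated apart, as [T] may be irrational. *)
  have TT : 0 <= T <= T by rewrite lexx ltW.
  apply: filterS3 cI cJ (filterI eqq (eqt _ TT)) => w cIw cJw [qw Tw] t tT.
  have e (q : rat) : 0 <= (ratr q : R) <= T -> I intPhi (ratr q) w = J (ratr q) w.
    by have := qw (pickle q); rewrite pickleK.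
  exact: (@cadlag_eq R G T (fun r => I intPhi r w) (fun r => J r w) cIw cJw e Tw t tT).
Qed.
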